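(* Let $k$ be a field of characteristic $0$ and let $f_1,\ldots,f_n\in k[[X_1,\ldots,X_n]]$ be such that $f_i(0)=0$ for all $i$ and the ideal $I=(f_1,\ldots,f_n)$ is $\mathfrak{m}$-primary, where $\mathfrak{m}=(X_1,\ldots,X_n)$. Let $m$ be the rank of the Jacobian matrix at the origin, $\left(\frac{\partial f_i}{\partial X_j}(0)\right)_{1\le i,j\le n}$. (1) If $n-m=2$, then $J_X(f_1,\ldots,f_n)\in\overline{I}$. (2) If $n-m\ge 3$, there exists a rational number $\theta=p/q>1$ such that $J_X(f_1,\ldots,f_n)\in\overline{I^{\theta}}$, or equivalently $J_X(f_1,\ldots,f_n)^q\in\overline{I^p}$. (3) Suppose that $k$ is equipped with a nontrivial absolute value $|\cdot|:k\to[0,+\infty[$ and that the $f_i$ are germs of convergent power series. Then: - if $n-m=2$, there exist $r>0$ and $C>0$ such that for all $x\in k^n$, $$\|x\|\le r\ \Longrightarrow\ |J_X(f_1,\ldots,f_n)(x)|\le C\Big(\sum_{i=1}^n|f_i(x)|\Big);$$ - if $n-m\ge 3$, there exist a rational number $\theta>1$ and $r>0$, $C>0$ such that for all $x\in k^n$, $$\|x\|\le r\ \Longrightarrow\ |J_X(f_1,\ldots,f_n)(x)|\le C\Big(\sum_{i=1}^n|f_i(x)|\Big)^{\theta}.$$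
   Context: $J_X(f_1,\ldots,f_n)=\det\left(\frac{\partial f_i}{\partial X_j}\right)_{1\le i,j\le n}$ is the Jacobian. For an ideal $I$ of a commutative Noetherian ring $R$, an element $x\in R$ is integral over $I$ if it satisfies a relation $x^s+a_1x^{s-1}+\cdots+a_s=0$ with $a_i\in I^i$ for $1\le i\le s$; the set of all such elements is an ideal $\overline{I}$, the integral closure of $I$. For a positive rational number $\theta=p/q$, $\overline{I^{\theta}}$ denotes the ideal of all $x\in R$ satisfying a relation $x^s+a_1x^{s-1}+\cdots+a_s=0$ with $\operatorname{ord}_I(a_i)/i\ge\theta$ for $1\le i\le s$, where $\operatorname{ord}_I(a)=\sup\{j\in\mathbb{N}\cup\{+\infty\}: a\in I^j\}$; equivalently $x\in\overline{I^{\theta}}$ if and only if $x^q\in\overline{I^p}$. An absolute value is nontrivial if it is not identically $1$ on $k\setminus\{0\}$; it may be archimedean or not. A power series $\sum a_\alpha X^\alpha$ is convergent if $\sum|a_\alpha|\rho^{|\alpha|}<\infty$ for some $\rho>0$; its values at points near $0$ in $k^n$ are taken in the completion of $k$ (with the extended absolute value). $\|\cdot\|$ is the max norm on $k^n$, $\|x\|=\max_i|x_i|$. *)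

(* Defs.v *)
(* Multi-indices and their arithmetic come from multinomials (multinom n is
   'X_{1..n}), whose notations clash with those of MathComp-Analysis and are
   therefore not imported. *)
From HB Require Import structures.
From mathcomp Require Import all_boot all_order all_algebra finmap.
From mathcomp Require Import boolp classical_sets reals constructive_ereal.
From mathcomp Require Import ereal esum exp.
From mathcomp Require mpoly.
Import -(notations) mpoly.

Set Implicit Arguments.
Unset Strict Implicit.
Unset Printing Implicit Defensive.

Import Order.TTheory GRing.Theory Num.Theory.

Local Open Scope classical_set_scope.
Local Open Scope ring_scope.

(* f stands for the formal series \sum_m f_m X^m. *)
Record mps (n : nat) (k : Type) := Mps { mps_coef :> multinom n -> k }.

HB.instance Definition _ (n : nat) (k : Type) := [isNew for @mps_coef n k].
HB.instance Definition _ (n : nat) (k : choiceType) :=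
  [Choice of mps n k by <:].

Lemma mpsP (n : nat) (k : Type) (f g : mps n k) : f =1 g -> f = g.
Proof. by case: f g => [f] [g] /= /funext ->. Qed.

Section Ring.
Variables (n : nat) (k : comNzRingType).
Implicit Types f g h : mps n k.

Definition mps_zero : mps n k := Mps (fun=> 0).
Definition mps_opp f : mps n k := Mps (fun m => - f m).
Definition mps_add f g : mps n k := Mps (fun m => f m + g m).
Definition mps_one : mps n k := Mps (fun m => (m == @mnm0 n)%:R).

(* Cauchy product; the bound on the degrees only makes the range finite. *)
Definition mps_mul f g : mps n k := Mps (fun m =>
  \sum_(b : bmultinom n (mdeg m).+1 * bmultinom n (mdeg m).+1
        | m == mnm_add (val b.1) (val b.2)) f (val b.1) * g (val b.2)).

Fact mps_addA : associative mps_add.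
Proof. by move=> f g h; apply: mpsP => m /=; rewrite addrA. Qed.
Fact mps_addC : commutative mps_add.
Proof. by move=> f g; apply: mpsP => m /=; rewrite addrC. Qed.
Fact mps_add0 : left_id mps_zero mps_add.
Proof. by move=> f; apply: mpsP => m /=; rewrite add0r. Qed.
Fact mps_addN : left_inverse mps_zero mps_opp mps_add.
Proof. by move=> f; apply: mpsP => m /=; rewrite addNr. Qed.

HB.instance Definition _ := GRing.isZmodule.Build (mps n k)
  mps_addA mps_addC mps_add0 mps_addN.

Definition mps_trunc (d : nat) f : mpoly n k :=
  \sum_(m : bmultinom n d) f (val m) *: mpolyX k (val m).

Lemma mps_truncE d f m : (mdeg m < d)%N -> mcoeff m (mps_trunc d f) = f m.
Proof. exact: mcoeff_mpoly. Qed.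

Lemma mcoeffM_eq (p p' q q' : mpoly n k) (m : multinom n) :
  (forall b, (mdeg b <= mdeg m)%N -> mcoeff b p = mcoeff b p') ->
  (forall b, (mdeg b <= mdeg m)%N -> mcoeff b q = mcoeff b q') ->
  mcoeff m (p * q) = mcoeff m (p' * q').
Proof.
move=> hp hq; rewrite !mcoeffM; apply: eq_bigr => b _.
by rewrite hp ?hq // -ltnS bmdeg.
Qed.

Lemma mps_mulE d f g m : (mdeg m < d)%N ->
  mps_mul f g m = mcoeff m (mps_trunc d f * mps_trunc d g).
Proof.
move=> md; rewrite mcoeffM; apply: eq_bigr => b _.
by rewrite !mps_truncE // (leq_trans (bmdeg _)).
Qed.

Fact mps_mulA : associative mps_mul.
Proof.
move=> f g h; apply: mpsP => m.
pose d := (mdeg m).+1.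
have trM u v b : (mdeg b <= mdeg m)%N ->
    mcoeff b (mps_trunc d (mps_mul u v))
    = mcoeff b (mps_trunc d u * mps_trunc d v).
  by move=> bm; rewrite mps_truncE ?ltnS // (@mps_mulE d) ?ltnS.
rewrite !(@mps_mulE d) //.
rewrite (@mcoeffM_eq _ (mps_trunc d f) _ (mps_trunc d g * mps_trunc d h)) //.
  by rewrite mulrA; apply: mcoeffM_eq => // b bm; rewrite trM.
by move=> b bm; rewrite trM.
Qed.

Fact mps_mulC : commutative mps_mul.
Proof.
by move=> f g; apply: mpsP => m; rewrite !(@mps_mulE (mdeg m).+1) // mulrC.
Qed.

Fact mps_mul1 : left_id mps_one mps_mul.
Proof.
move=> f; apply: mpsP => m; rewrite (@mps_mulE (mdeg m).+1) //.
rewrite (@mcoeffM_eq _ 1 _ (mps_trunc (mdeg m).+1 f)) //.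
  by rewrite mul1r mps_truncE.
by move=> b bm; rewrite mps_truncE ?ltnS // mcoeff1.
Qed.

Fact mps_mulDl : left_distributive mps_mul mps_add.
Proof.
move=> f g h; apply: mpsP => m /=; rewrite -big_split /=.
by apply: eq_bigr => b _; rewrite mulrDl.
Qed.

Fact mps_one_neq0 : mps_one != 0.
Proof.
apply/eqP => /(congr1 (fun f : mps n k => f (@mnm0 n))) /=.
by rewrite eqxx; apply/eqP/oner_neq0.
Qed.

HB.instance Definition _ := GRing.Zmodule_isComNzRing.Build (mps n k)
  mps_mulA mps_mulC mps_mul1 mps_mulDl mps_one_neq0.

End Ring.

Section Jacobian.
Variables (n : nat) (k : comNzRingType).

Definition mpsX (i : 'I_n) : mps n k := Mps (fun m => (m == mnm1 i)%:R).

Definition mps_deriv (j : 'I_n) (f : mps n k) : mps n k :=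
  Mps (fun m => f (mnm_add m (mnm1 j)) *+ (m j).+1).

(* The value at the origin, i.e. the constant coefficient. *)
Definition mps_at0 (f : mps n k) : k := f (@mnm0 n).

Definition jacobian_mx (f : 'I_n -> mps n k) : 'M[mps n k]_n :=
  \matrix_(i, j) mps_deriv j (f i).

Definition jacobian (f : 'I_n -> mps n k) : mps n k := \det (jacobian_mx f).

End Jacobian.

Section Ideals.
Variable A : comNzRingType.
Implicit Types I J P : set A.

Definition is_ideal I : Prop :=
  [/\ I 0, (forall x y, I x -> I y -> I (x + y))
    & (forall a x, I x -> I (a * x))].

Definition ideal_gen (n : nat) (g : 'I_n -> A) : set A :=
  [set x | exists c : 'I_n -> A, x = \sum_(i < n) c i * g i].

Definition ideal_mul I J : set A :=
  [set x | exists s : seq (A * A),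
     (forall u, u \in s -> I u.1 /\ J u.2) /\ x = \sum_(u <- s) u.1 * u.2].

Definition ideal_exp I (p : nat) : set A := iter p (ideal_mul I) setT.

Definition radical I : set A := [set x | exists p : nat, I (x ^+ p)].

Definition is_primary_for P I : Prop :=
  [/\ is_ideal I, ~ I 1,
      (forall x y, I (x * y) -> I x \/ radical I y)
    & radical I = P].

(* A is nontrivial, so the relation forces 0 < s. *)
Definition integral_closure I : set A :=
  [set x | exists (s : nat) (a : nat -> A),
     (forall i, (1 <= i <= s)%N -> ideal_exp I i (a i)) /\
     x ^+ s + \sum_(1 <= i < s.+1) a i * x ^+ (s - i) = 0].

Variable R : realType.

(* a always lies in I^0 = A, so the set is nonempty; the order is +oo when a
   lies in every power of I. *)
Definition ord_ideal I (a : A) : \bar R :=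
  ereal_sup [set (j%:R)%:E | j in [set j : nat | ideal_exp I j a]].

(* The i-th coefficient is required to satisfy ord_I(a_i) / i >= theta. *)
Definition rat_integral_closure I (theta : rat) : set A :=
  [set x | exists (s : nat) (a : nat -> A),
     (forall i, (1 <= i <= s)%N ->
        ((ratr theta)%:E <= ord_ideal I (a i) * (i%:R^-1)%:E)%E) /\
     x ^+ s + \sum_(1 <= i < s.+1) a i * x ^+ (s - i) = 0].

End Ideals.

Section Convergence.
Variable R : realType.

Definition is_absolute_value (k : fieldType) (v : k -> R) : Prop :=
  [/\ (forall x, 0 <= v x), (forall x, v x = 0 <-> x = 0),
      (forall x y, v (x * y) = v x * v y)
    & (forall x y, v (x + y) <= v x + v y)].

Definition nontrivial_absolute_value (k : fieldType) (v : k -> R) : Prop :=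
  exists2 x, x != 0 & v x != 1.

Definition complete_for (K : fieldType) (w : K -> R) : Prop :=
  forall u : nat -> K,
    (forall e : R, 0 < e -> exists N : nat, forall i j : nat,
       (N <= i)%N -> (N <= j)%N -> w (u i - u j) < e) ->
    exists l : K, forall e : R, 0 < e -> exists N : nat, forall i : nat,
      (N <= i)%N -> w (u i - l) < e.

Definition is_completion (k : fieldType) (v : k -> R)
    (K : fieldType) (w : K -> R) (iota : {rmorphism k -> K}) : Prop :=
  [/\ is_absolute_value w, (forall x, w (iota x) = v x), complete_for w
    & (forall (y : K) (e : R), 0 < e -> exists x : k, w (y - iota x) < e)].

Definition max_norm (k : fieldType) (v : k -> R) (n : nat) (x : 'I_n -> k) : R :=
  \big[Num.max/0]_(i < n) v (x i).

Definition mps_convergent (k : fieldType) (v : k -> R) (n : nat)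
    (f : mps n k) : Prop :=
  exists2 rho : R, 0 < rho &
    (\esum_(m in [set: multinom n]) (v (f m) * rho ^+ mdeg m)%:E < +oo)%E.

Section Values.
Variables (k K : fieldType) (w : K -> R) (iota : {rmorphism k -> K}) (n : nat).
Implicit Types (f : mps n k) (x : 'I_n -> k).

(* Unconditional summability in K of the family of terms of f at x: k is
   mapped to its completion K by iota. *)
Definition mps_has_value f x (y : K) : Prop :=
  forall e : R, 0 < e -> exists S0 : {fset multinom n},
    forall S : {fset multinom n}, (S0 `<=` S)%fset ->
      w (y - \sum_(m <- S) iota (f m * \prod_(i < n) x i ^+ m i)) < e.

Definition mps_cvg_at f x : Prop := exists y, mps_has_value f x y.

(* Meaningful only where mps_cvg_at holds; 0 elsewhere. *)
Definition mps_eval f x : K := xget 0 [set y | mps_has_value f x y].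

End Values.
End Convergence.

(* Main.v *)
Require Import Defs.
From HB Require Import structures.
From mathcomp Require Import all_boot all_order all_algebra finmap.
From mathcomp Require Import perm generic_quotient boolp classical_sets.
From mathcomp Require Import cardinality fsbigop reals ereal esum exp.
From mathcomp Require Import zify ring lra.
From mathcomp Require mpoly.
Import -(notations) mpoly.

Set Implicit Arguments.
Unset Strict Implicit.
Unset Printing Implicit Defensive.

Import Order.TTheory GRing.Theory Num.Theory.

Local Open Scope classical_set_scope.
Local Open Scope ring_scope.

(* Let S be the power series ring in Y_1, ..., Y_n, acting on R = k[[X]] by
   Y_i |-> f_i. If J <> 0 this action is injective, R is finite over S, and the
   Euler derivation of Frac S extends to the derivation
   E = J^-1 sum_i f_i D_i of Frac R, where D_i g is the determinant of the
   Jacobian matrix with f_i replaced by g. A valuation v of Frac R over the order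
   valuation of S satisfies v(E x) = v(x) whenever v(x) <> 0, by a logarithmic
   derivative argument (char k = 0). Since J E(X_j) = sum_l adj_(j l) f_l and the
   cofactors adj_(j l) have order at least n - m - 1, this bounds v(J) below for
   all such v, so Gauss's lemma gives the coefficients of the characteristic
   polynomial of J^q over S an order at least p i: this is the required integral
   relation. Evaluating at x the relation with truncated, hence convergent,
   coefficients gives (3); the truncation error is absorbed by
   ||x||^N <= C sum_i |f_i(x)|, which holds because X_j^N is in I. *)

(** * Valuation rings *)

(** S and R are the same ring k[[X]] and the inclusion of S is the endomorphism [subst f]; so Frac S
    and Frac R are one field [L], and the finite extension is an endomorphism [phi] of [L]. Working
    over S lets one valuation [nu], the order, replace a valuative criterion for the powers of I: a
    series of order d in S lands in I^d, and every v over [nu] gives all the f_i the same value D.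
    Put c = n - m - 2 and let mu be the least v(X_j), reached at j. Then v(J) + v(E X_j) >= D + (c +
    1) mu, and v(E X_j) = mu cancels one copy of mu, so v(J) >= D + c mu. Hence exponent 1 when n -
    m = 2 and an exponent above 1 when n - m >= 3. The equality v(E x) = v(x) rests on residue
    characteristic 0: the Euler derivation is zero on the residue field of [nu], hence, by
    separability, on that of v, and D E(x)/x becomes congruent to the integer v(x). That E does not
    lower values is not clear at first: nondegeneracy of the trace form bounds the loss, which is
    then removed one unit at a time. *)

Section ValuationRings.
Variable K : fieldType.
Implicit Types (A B V : set K) (x y z : K).

Definition subring A :=
  [/\ A 1, forall x y, A x -> A y -> A (x - y) & forall x y, A x -> A y -> A (x * y)].

Definition valring V := subring V /\ forall x, x != 0 -> V x \/ V x^-1.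

(** For a valuation ring this is the maximal ideal. Zero is listed apart because [0^-1 = 0] lies in
    [V]. *)
Definition nonunit V x := x = 0 \/ ~ V x^-1.

Lemma subring0 A : subring A -> A 0.
Proof. by case=> A1 AB _; rewrite -(subrr 1); apply: AB. Qed.
Lemma subringN A x : subring A -> A x -> A (- x).
Proof. by move=> sA Ax; rewrite -sub0r; case: (sA) => _ + _; apply=> //; apply: subring0. Qed.

Lemma subringD A x y : subring A -> A x -> A y -> A (x + y).
Proof. by move=> sA Ax Ay; rewrite -[y]opprK; case: (sA) => _ + _; apply=> //; apply: subringN. Qed.
Lemma subringM A x y : subring A -> A x -> A y -> A (x * y).
Proof. by case=> _ _; apply. Qed.

Lemma subringX A x m : subring A -> A x -> A (x ^+ m).
Proof.
move=> sA Ax; elim: m => [|m IH]; first by rewrite expr0; case: sA.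
by rewrite exprS; apply: subringM.
Qed.

Lemma subring_sum A (I : Type) (r : seq I) (P : pred I) (F : I -> K) :
  subring A -> (forall i, P i -> A (F i)) -> A (\sum_(i <- r | P i) F i).
Proof.
move=> sA AF; elim/big_ind: _ => //; first exact: subring0.
by move=> *; apply: subringD.
Qed.

Definition adjoin A x : set K :=
  [set y | exists2 p : {poly K}, (forall i, A p`_i) & y = p.[x]].

Lemma adjoin_subring A x : subring A -> subring (adjoin A x).
Proof.
move=> sA; split.
- exists 1; last by rewrite hornerC.
  move=> i; rewrite coef1; case: (i == 0%N); [by case: sA|exact: subring0].
- move=> _ _ [p Ap ->] [q Aq ->]; exists (p - q); last by rewrite !hornerE.
  by move=> i; rewrite coefB; case: (sA) => _ + _; apply.
- move=> _ _ [p Ap ->] [q Aq ->]; exists (p * q); last by rewrite !hornerE.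
  by move=> i; rewrite coefM; apply: subring_sum => // j _; apply: subringM.
Qed.

Lemma sub_adjoin A x : subring A -> A `<=` adjoin A x.
Proof.
move=> sA y Ay; exists y%:P; last by rewrite hornerC.
by move=> i; rewrite coefC; case: (i == 0%N) => //; apply: subring0.
Qed.

Lemma adjoin_gen A x : subring A -> adjoin A x x.
Proof.
move=> sA; exists 'X; last by rewrite hornerX.
by move=> i; rewrite coefX; case: (i == 1%N); [case: sA|apply: subring0].
Qed.

Lemma exists_maximal_avoiding A y : subring A -> A y^-1 -> ~ A y ->
  exists B, [/\ subring B, A `<=` B, ~ B y &
    forall B', subring B' -> B `<=` B' -> ~ B' y -> B' `<=` B].
Proof.
move=> sA Az nAy.
(* [Zorn_bigcup] also asks for the union of the empty chain, which is no subring; stating the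
   condition for the union of [A] and [C] lets the empty set stand for [A]. *)
pose P : set (set K) := [set C | subring (A `|` C) /\ ~ (A `|` C) y].
have [|C [PC maxC]] := @Zorn_bigcup _ P.
  move=> F FP totF; have [F0|] := pselect (forall X, ~ F X).
    have E : A `|` \bigcup_(X in F) X = A.
      by apply/seteqP; split=> x; [case=> // -[X /F0]|left].
    suff : subring (A `|` \bigcup_(X in F) X) /\ ~ (A `|` \bigcup_(X in F) X) y by [].
    by rewrite E.
  move=> /existsNP[X0 /contrapT FX0].
  have common x x' : (A `|` \bigcup_(X in F) X) x -> (A `|` \bigcup_(X in F) X) x' ->
      exists2 X, F X & (A `|` X) x /\ (A `|` X) x'.
    move=> [Ax|[X FX Xx]] [Ax'|[X' FX' Xx']].
    - by exists X0 => //; split; left.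
    - by exists X' => //; split; [left|right].
    - by exists X => //; split; [right|left].
    - have [XX'|X'X] := totF _ _ FX FX'.
        by exists X' => //; split; right=> //; apply: XX'.
      by exists X => //; split; right=> //; apply: X'X.
  have up X x : F X -> (A `|` X) x -> (A `|` \bigcup_(X in F) X) x.
    by move=> FX [Ax|Xx]; [left|right; exists X].
  split; first split.
  - by left; case: sA.
  - move=> x x' Hx Hx'; have [X FX [Xx Xx']] := common _ _ Hx Hx'.
    by apply: (up X) => //; case: (FP _ FX) => -[_ + _] _; apply.
  - move=> x x' Hx Hx'; have [X FX [Xx Xx']] := common _ _ Hx Hx'.
    by apply: (up X) => //; case: (FP _ FX) => -[_ _ +] _; apply.
  - move=> Hy; have [X FX [Xy _]] := common _ _ Hy Hy.
    by case: (FP _ FX) => _; apply.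
exists (A `|` C); case: PC => sC nCy; split=> //.
move=> B' sB' CB' nB'y.
apply: contrapT => nB'.
have AB' : A `|` B' = B'
  by apply/seteqP; split=> x; [case=> [Ax|//]; apply: CB'; left|right].
apply: (maxC B'); last by suff : subring (A `|` B') /\ ~ (A `|` B') y by []; rewrite AB'.
split; first by move=> x Cx; apply: CB'; right.
by move=> B'C; apply: nB' => x B'x; right; apply: B'C.
Qed.

(** Chevalley's argument. With z = y^-1 in B, maximality puts y in B[x] and in B[x^-1] when x and
    x^-1 are both outside B; this gives 1 = z a(x) and 1 = z b(x^-1). Taken of least degrees, the
    two relations combine to lower the larger degree, a contradiction. *)
Lemma maximal_avoiding_valring B y : subring B -> B y^-1 -> ~ B y ->
  (forall B', subring B' -> B `<=` B' -> ~ B' y -> B' `<=` B) -> valring B.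
Proof.
move=> sB Bz nBy maxB; split=> //.
have y0 : y != 0 by apply/eqP => y0; apply: nBy; rewrite y0; apply: subring0.
set z := y^-1 in Bz.
have z1 c : B c -> 1 != z * c.
  move=> Bc; apply/eqP => zc; apply: nBy.
  by rewrite -[y]mulr1 zc mulVKf.
(* z lies in the Jacobson radical of B. If u^-1 were outside B, y would be a polynomial in u^-1;
   multiplying by a power u^m = 1 - z c' puts y - c' in B. *)
have unit c : B c -> B (1 - z * c)^-1.
  move=> Bc; set u := 1 - z * c.
  have Bu : B u by case: (sB) => B1 BB BM; apply: BB => //; apply: BM.
  have u0 : u != 0 by rewrite subr_eq0 z1.
  apply: contrapT => nBu.
  have uX m : exists2 c', B c' & u ^+ m = 1 - z * c'.
    elim: m => [|m [c' Bc' IH]].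
      by exists 0; [apply: subring0|rewrite expr0 mulr0 subr0].
    exists (c' + c * (1 - z * c')).
      apply: subringD => //; apply: subringM => //.
      by rewrite -IH; apply: subringX.
    rewrite exprS IH /u mulrBl mul1r [in RHS]mulrDr opprD addrA.
    by rewrite -[z * c * _]mulrA.
  apply: nBu; apply: (maxB (adjoin B u^-1)).
  - exact: adjoin_subring.
  - exact: sub_adjoin.
  - move=> [p Bp py].
    have [b Bb yb] : exists2 b, B b & y * u ^+ (size p) = b.
      exists (\sum_(i < size p) p`_i * u ^+ (size p - i)).
        by apply: subring_sum => // i _; apply: subringM => //; apply: subringX.
      rewrite py horner_coef mulr_suml; apply: eq_bigr => i _.
      rewrite -mulrA exprVn; congr (_ * _).
      by rewrite expfB // mulrC.
    have [c' Bc' uE] := uX (size p).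
    have /eqP := z1 (b + c') (subringD sB Bb Bc'); apply.
    by rewrite mulrDr -yb mulKf // uE subrK.
  - exact: adjoin_gen.
(* [N n x] records that y lies in B[x], through a polynomial of degree at most n. *)
pose N n x := exists2 a : nat -> K, (forall i, B (a i)) & 1 = z * \sum_(i < n.+1) a i * x ^+ i.
have exN x : ~ B x -> exists n, `[< N n x >].
  move=> nBx; apply: contrapT => nN; apply: nBx.
  apply: (maxB (adjoin B x)); [exact: adjoin_subring|exact: sub_adjoin| |exact: adjoin_gen].
  move=> [p Bp yp]; apply: nN; exists (size p); apply/asboolP.
  exists (fun i => p`_i) => //.
  by rewrite big_ord_recr /= nth_default // mul0r addr0 -horner_coef -yp mulVf.
(* The relation for x^-1, solved as 1 = v z (b_1 x^-1 + ... + b_m x^-m) with v the inverse of 1 - z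
   b_0, is multiplied into the top term of the relation for x; m <= n keeps the exponents
   nonnegative. *)
have key n m x : x != 0 -> (m <= n)%N -> N n x -> N m x^-1 -> exists2 n', (n' < n)%N & N n' x.
  move=> x0 mn [a Ba Ea] [b Bb Eb].
  case: n mn Ea => [|n] mn Ea.
    move: (Ea); rewrite big_ord1 expr0 mulr1 => /eqP.
    by rewrite (negPf (z1 _ (Ba _))).
  exists n => //.
  set v := (1 - z * b 0%N)^-1.
  have Bv : B v by apply: unit.
  have v0 : 1 - z * b 0%N != 0 by rewrite subr_eq0 z1.
  have E1 : 1 = v * z * \sum_(j < m) b j.+1 * x^-1 ^+ j.+1.
    have : 1 - z * b 0%N = z * \sum_(j < m) b j.+1 * x^-1 ^+ j.+1.
      by rewrite {1}Eb big_ord_recl /= expr0 mulr1 mulrDr addrC addKr.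
    by move=> H; rewrite -mulrA -H /v mulVf.
  exists (fun i => a i + a n.+1 * v * z *
     (if (n < m + i)%N then b (n.+1 - i)%N else 0)).
    move=> i; apply: subringD => //; apply: subringM => //; last first.
      by case: ifP => _ //; apply: subring0.
    by apply: subringM => //; apply: subringM.
  rewrite {1}Ea; congr (z * _).
  rewrite big_ord_recr /=.
  under [RHS]eq_bigr do rewrite mulrDl.
  rewrite big_split /=; congr (_ + _).
  rewrite -[X in a n.+1 * X]mul1r {1}E1.
  under [RHS]eq_bigr do rewrite -mulrA.
  rewrite -mulr_sumr -!mulrA; congr (_ * (_ * (_ * _))).
  rewrite mulr_suml [RHS](reindex_inj rev_ord_inj) /=.
  rewrite (big_ord_widen n.+1 (fun j => b j.+1 * x^-1 ^+ j.+1 * x ^+ n.+1)) //.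
  rewrite big_mkcond; apply: eq_bigr => j _.
  have jn : (j <= n)%N by rewrite -ltnS.
  rewrite subSS.
  have -> : (n < m + (n - j))%N = (j < m)%N.
    by rewrite addnBA // ltn_subRL ltn_add2r.
  case: ifP => jm; last by rewrite mul0r.
  have -> : (n.+1 - (n - j) = j.+1)%N by rewrite subSn ?leq_subr // subKn.
  rewrite -mulrA; congr (_ * _).
  rewrite exprVn; apply: (mulfI (expf_neq0 j.+1 x0)).
  by rewrite mulVKf ?expf_neq0 // -exprD addSn subnKC.
move=> x x0.
apply: contrapT => /not_orP[nBx nBxV].
have [n /asboolP Nn minn] := ex_minnP (exN _ nBx).
have [m /asboolP Nm minm] := ex_minnP (exN _ nBxV).
have [mn|/ltnW nm] := leqP m n.
  have [n' n'n Nn'] := key _ _ _ x0 mn Nn Nm.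
  by have /minn := introT (asboolP _) Nn'; rewrite leqNgt n'n.
have xV0 : x^-1 != 0 by rewrite invr_eq0.
have [|m' m'm Nm'] := key _ _ _ xV0 nm Nm; first by rewrite invrK.
by have /minm := introT (asboolP _) Nm'; rewrite leqNgt m'm.
Qed.

(** If y were a polynomial in y^-1 over A, multiplying by a power of y would give a monic equation.
    So A[y^-1] misses y, and a maximal subring containing it and missing y is a valuation ring. *)
Lemma valring_avoid A y : subring A ->
  (forall p : {poly K}, p \is monic -> (forall i, A p`_i) -> p.[y] != 0) ->
  exists V, [/\ valring V, A `<=` V & ~ V y].
Proof.
move=> sA nint.
have y0 : y != 0.
  have := nint 'X (monicX _); rewrite hornerX; apply=> i.
  by rewrite coefX; case: (i == 1%N); [case: sA|apply: subring0].
have [|||B [sB AB nBy maxB]] := @exists_maximal_avoiding (adjoin A y^-1) y.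
- exact: adjoin_subring.
- exact: adjoin_gen.
- move=> [p Ap yp].
  set d := size p.
  pose q : {poly K} := 'X^(d.+1) - \poly_(i < d.+1) p`_(d - i).
  have sq : (size (\poly_(i < d.+1) p`_(d - i))%R <= d.+1)%N by apply: size_poly.
  have qmon : q \is monic.
    rewrite monicE lead_coefDl ?lead_coefXn // size_polyXn.
    by rewrite size_polyN ltnS.
  have /eqP nq : q.[y] != 0.
    apply: nint => // i; rewrite coefB coefXn coef_poly; case: (sA) => A1 AB _; apply: AB.
      by case: (_ == _) => //; apply: subring0.
    by case: ifP => _ //; apply: subring0.
  apply: nq; rewrite !hornerE horner_poly; apply/eqP; rewrite subr_eq0; apply/eqP.
  rewrite [RHS](reindex_inj rev_ord_inj) /= big_ord_recr /= subnn subn0.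
  rewrite [p`__]nth_default // mul0r addr0 exprS {1}yp horner_coef mulr_suml -/d.
    apply: eq_bigr => i _; rewrite !subSS (subKn (ltnW (ltn_ord i))) -mulrA; congr (_ * _).
  have y0i : y ^+ i != 0 by rewrite expf_neq0.
  by apply: (mulfI y0i); rewrite exprVn mulVKf // -exprD subnKC // ltnW.
- exists B; split=> //; last by move=> x Ax; apply: AB; apply: sub_adjoin.
  by apply: (maximal_avoiding_valring sB _ nBy) => //; apply: AB; apply: adjoin_gen.
Qed.

End ValuationRings.

Section ValuationRingTheory.
Variables (K : fieldType) (V : set K).
Hypothesis vV : valring V.
Implicit Types x y z : K.
Let sV : subring V := vV.1.

Lemma valring_inv x : ~ V x -> V x^-1.
Proof.
move=> nVx; have [x0|x0] := eqVneq x 0; first by case: nVx; rewrite x0; apply: subring0.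
by case: (vV.2 x x0).
Qed.

Lemma nonunitM x y : V x -> nonunit V y -> nonunit V (x * y).
Proof.
move=> Vx [->|nVy]; first by left; rewrite mulr0.
have [->|x0] := eqVneq x 0; first by left; rewrite mul0r.
right=> Vxy; apply: nVy; have -> : y^-1 = x * (x * y)^-1 by rewrite invfM mulVKf.
exact: subringM.
Qed.

Lemma nonunitD x y : nonunit V x -> nonunit V y -> nonunit V (x + y).
Proof.
move=> nx ny; have [x0|x0] := eqVneq x 0; first by rewrite x0 add0r.
have [y0|y0] := eqVneq y 0; first by rewrite y0 addr0.
wlog xy : x y nx ny x0 y0 / V (x / y).
  have xy0 : x / y != 0 by rewrite mulf_neq0 ?invr_eq0.
  move=> H; case: (vV.2 _ xy0); first exact: H.
  by rewrite invf_div => yx; rewrite addrC; apply: H.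
rewrite (_ : x + y = (x / y + 1) * y); last by rewrite mulrDl divfK // mul1r.
by apply: nonunitM => //; apply: subringD => //; case: sV.
Qed.

Lemma nonunit1 : ~ nonunit V 1.
Proof.
case=> [/eqP|]; first by rewrite oner_eq0.
by rewrite invr1; case: sV.
Qed.

Lemma unit_addnonunit x : nonunit V x -> V (1 + x)^-1.
Proof.
move=> nx; apply: contrapT => n1x; apply: nonunit1.
rewrite -[1](addrK x); apply: nonunitD; first by right.
by rewrite -mulN1r; apply: nonunitM => //; apply: subringN => //; case: sV.
Qed.

Lemma nonunit_sum (I : Type) (r : seq I) (P : pred I) (F : I -> K) :
  (forall i, P i -> nonunit V (F i)) -> nonunit V (\sum_(i <- r | P i) F i).
Proof.
move=> VF; elim/big_ind: _ => //; first by left.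
by move=> *; apply: nonunitD.
Qed.

(** When x is outside V, dividing the equation by a power of x writes x as a polynomial in x^-1,
    which lies in V. *)
Lemma valring_root_monic (p : {poly K}) x :
  p \is monic -> (forall i, V p`_i) -> root p x -> V x.
Proof.
move=> pmon Vp /rootP px; apply: contrapT => nVx.
have x0 : x != 0 by apply/eqP => x0; apply: nVx; rewrite x0; apply: subring0.
have VxV := valring_inv nVx.
have p0 := monic_neq0 pmon.
case E : (size p) => [|d]; first by move/eqP: E; rewrite size_poly_eq0 (negPf p0).
case: d E => [|d] E.
  move: px; rewrite horner_coef E big_ord1 expr0 mulr1 => /eqP.
  by move/monicP: pmon; rewrite lead_coefE E /= => ->; rewrite oner_eq0.
apply: nVx.
have -> : x = - \sum_(i < d.+1) p`_i * x^-1 ^+ (d - i).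
  move: px; rewrite horner_coef E big_ord_recr /=.
  move/monicP: pmon; rewrite lead_coefE E /= => ->; rewrite mul1r => /eqP.
  rewrite addrC addr_eq0 => /eqP H.
  have xd : x ^+ d != 0 by rewrite expf_neq0.
  apply: (mulIf xd); rewrite -exprS H mulNr mulr_suml; congr (- _).
  apply: eq_bigr => i _; rewrite -mulrA; congr (_ * _).
  have xi : x ^+ (d - i) != 0 by rewrite expf_neq0.
  by apply: (mulfI xi); rewrite exprVn mulVKf // -exprD subnK // -ltnS.
apply: subringN => //; apply: subring_sum => // i _.
by apply: subringM => //; apply: subringX.
Qed.

(** The chosen coefficient generates the content of [G]: divisibility in a valuation ring is total,
    so one coefficient divides all others. Taking the least such index makes the earlier quotients
    nonunits. *)
Lemma valring_dominating_coef (G : {poly K}) : G != 0 ->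
  exists i, [/\ G`_i != 0, forall j, V (G`_j / G`_i)
    & forall j, (j < i)%N -> nonunit V (G`_j / G`_i)].
Proof.
move=> G0.
pose P i := G`_i != 0 /\ forall j, V (G`_j / G`_i).
have exP : exists i, `[< P i >].
  suff H d : (exists2 i, (i < d)%N & G`_i != 0) ->
      exists2 i, G`_i != 0 & forall j, (j < d)%N -> V (G`_j / G`_i).
    have [|i Gi Hi] := H (size G).
      exists (size G).-1; first by rewrite prednK // size_poly_gt0.
      by rewrite -lead_coefE lead_coef_eq0.
    exists i; apply/asboolP; split=> // j.
    have [/Hi//|sj] := ltnP j (size G).
    by rewrite nth_default // mul0r; apply: subring0.
  elim: d => [[]//|d IH] _.
  have [Hd|Hd] := pselect (exists2 i, (i < d)%N & G`_i != 0); last first.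
    have Gi j : (j < d)%N -> G`_j = 0.
      by move=> jd; apply/eqP; apply: contrapT => /negP Gj; apply: Hd; exists j.
    have [Gd|Gd] := eqVneq G`_d 0; last first.
      exists d => // j; rewrite ltnS leq_eqVlt => /orP[/eqP->|/Gi->].
        by rewrite divff //; case: sV.
      by rewrite mul0r; apply: subring0.
    exists (size G).-1; first by rewrite -lead_coefE lead_coef_eq0.
    move=> j; rewrite ltnS leq_eqVlt => /orP[/eqP->|/Gi->].
      by rewrite Gd mul0r; apply: subring0.
    by rewrite mul0r; apply: subring0.
  have [i Gi Hi] := IH Hd.
  have [VG|nVG] := pselect (V (G`_d / G`_i)).
    by exists i => // j; rewrite ltnS leq_eqVlt => /orP[/eqP->|/Hi].
  have Gd : G`_d != 0.
    by apply/eqP => Gd; apply: nVG; rewrite Gd mul0r; apply: subring0.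
  exists d => // j; rewrite ltnS leq_eqVlt => /orP[/eqP->|/Hi H].
    by rewrite divff //; case: sV.
have -> : G`_j / G`_d = (G`_j / G`_i) * (G`_i / G`_d) by rewrite mulrA divfK.
  by apply: subringM => //; rewrite -invf_div; apply: valring_inv.
have [i /asboolP[Gi Hi] imin] := ex_minnP exP.
exists i; split=> // j ji.
have [Gj|Gj] := eqVneq G`_j 0; first by left; rewrite Gj mul0r.
right; rewrite invf_div => VG.
suff /asboolT/imin : P j by rewrite leqNgt ji.
split=> // l; have -> : G`_l / G`_j = (G`_l / G`_i) * (G`_i / G`_j) by rewrite mulrA divfK.
exact: subringM.
Qed.

(* Gauss's lemma: the dominating coefficients of smallest index of the two
   factors produce a dominating coefficient of the product. *)
Lemma valring_monic_factor (P G H : {poly K}) :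
  G \is monic -> H \is monic -> P = G * H -> (forall i, V P`_i) ->
  forall i, V G`_i.
Proof.
move=> Gmon Hmon PE VP.
have [i [Gi VGi nGi]] := valring_dominating_coef (monic_neq0 Gmon).
have [j [Hj VHj nHj]] := valring_dominating_coef (monic_neq0 Hmon).
have VHj1 : V (H`_j)^-1.
  by have := VHj (size H).-1; rewrite -lead_coefE (monicP Hmon) mul1r.
have VGH : V (G`_i * H`_j).
  pose u := P`_(i + j) / (G`_i * H`_j).
  pose s := \sum_(l < (i + j).+1 | val l != i)
              (G`_l / G`_i) * (H`_(i + j - l) / H`_j).
  have uE : u = 1 + s.
    rewrite /u PE coefM mulr_suml.
    have il : (i < (i + j).+1)%N by rewrite ltnS leq_addr.
    rewrite (bigD1 (Ordinal il)) //= addKn divff ?mulf_neq0 //; congr (_ + _).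
    apply: eq_bigr => l _; rewrite invfM mulrACA; congr (_ * _).
  have ns : nonunit V s.
    apply: nonunit_sum => l li.
    have [lti|] := ltnP l i.
      by rewrite mulrC; apply: nonunitM => //; apply: nGi.
    rewrite leq_eqVlt eq_sym (negPf li) /= => lti.
    apply: nonunitM => //; apply: nHj.
    by rewrite ltn_subLR ?ltn_add2r // -ltnS.
  have Vu : V u^-1 by rewrite uE; apply: unit_addnonunit.
  have u0 : u != 0.
    apply/eqP => u0; apply: nonunit1.
    have -> : 1 = -1 * s by apply/eqP; rewrite mulN1r -addr_eq0 -uE u0.
    by apply: nonunitM => //; apply: subringN => //; case: sV.
  have -> : G`_i * H`_j = P`_(i + j) * u^-1.
    by rewrite /u invf_div mulrCA divff ?mulr1 //; move: u0; rewrite mulf_eq0 negb_or => /andP[].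
  by apply: subringM.
move=> l; rewrite -[G`_l](divfK Gi); apply: subringM => //.
by rewrite -[G`_i](mulfK Hj); apply: subringM.
Qed.

End ValuationRingTheory.

(** p(X) - p(M) is a multiple of X - M among matrices over F[X]; when p(M) = 0, determinants give
    the divisibility. *)
Lemma char_poly_dvd_exp (F : fieldType) d (M : 'M[F]_d.+1) (p : {poly F}) :
  horner_mx M p = 0 -> exists q, p ^+ d.+1 = char_poly M * q.
Proof.
move=> pM.
have [W HW] : exists W, p%:M - map_mx polyC (horner_mx M p) = char_poly_mx M *m W.
  move: {pM}p; apply: poly_ind => [|p c [W HW]].
    by exists 0; rewrite mulmx0 raddf0 (raddf0 (horner_mx M)) (map_mx0 _) subr0.
  exists (W *m 'X%:M + map_mx polyC (horner_mx M p)).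
  rewrite mulmxDr mulmxA -HW (rmorphD (horner_mx M)) (rmorphM (horner_mx M)) /= horner_mx_X horner_mx_C.
  rewrite map_mxD map_mxM map_scalar_mx /= [(_ + _)%:M]raddfD /= opprD addrACA subrr addr0.
  rewrite scalar_mxM mulmxBl -[RHS]addrA; congr (_ + _).
  rewrite /char_poly_mx mulmxBl -scalar_mxC addKr; congr (- _).
  have cM : comm_mx M (horner_mx M p) by apply: comm_mx_horner.
  by rewrite -!map_mxM /= cM.
exists (\det W).
rewrite /char_poly -det_mulmx -HW pM map_mx0 subr0 det_scalar //.
Qed.

Section Integrality.
Variables (K : fieldType) (A : set K).
Hypothesis sA : subring A.

(** Defined through valuation rings, so that stability under ring operations is immediate;
    [integral_overP] recovers monic equations. *)
Definition integral_over (x : K) := forall V, valring V -> A `<=` V -> V x.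

Lemma integral_overP x : integral_over x <->
  exists p : {poly K}, [/\ p \is monic, forall i, A p`_i & root p x].
Proof.
split=> [Ix|[p [pmon Ap px]] V vV AV]; last first.
  by apply: (valring_root_monic vV pmon) => // i; apply: AV.
apply: contrapT => nex.
have nroot p : p \is monic -> (forall i, A p`_i) -> p.[x] != 0.
  by move=> pmon Ap; apply/negP => px; apply: nex; exists p.
have [V [vV AV nVx]] := valring_avoid sA nroot.
by apply: nVx; apply: Ix.
Qed.

(** By [char_poly_dvd_exp] the characteristic polynomial is a monic factor of a power of [p], so
    Gauss's lemma applies in every valuation ring containing [A]. *)
Lemma char_poly_integral d (M : 'M[K]_d.+1) (p : {poly K}) :
  p \is monic -> (forall i, A p`_i) -> horner_mx M p = 0 ->
  forall i, integral_over (char_poly M)`_i.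
Proof.
move=> pmon Ap pM i V vV AV.
have [q pE] := char_poly_dvd_exp pM.
have qmon : q \is monic.
  by rewrite -(monicMl _ (char_poly_monic M)) -pE monic_exp.
apply: (valring_monic_factor vV (char_poly_monic M) qmon pE) => {}i.
suff H m : forall i, V (p ^+ m)`_i by apply: H.
elim: m => [|m IH] j.
  by rewrite expr0 coef1; case: (j == 0%N); [case: vV.1|apply: subring0 vV.1].
rewrite exprS coefM; apply: subring_sum vV.1 _ => l _; apply: (subringM vV.1) => //.
exact: AV.
Qed.
End Integrality.

(** * Integer-valued valuations *)

(* The value [v 0] is junk: [vge v l x] reads "v x >= l" with v 0 = +oo. *)
Definition int_valuation (K : fieldType) (v : K -> int) :=
  (forall x y, x != 0 -> y != 0 -> v (x * y) = v x + v y) /\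
  (forall x y, x != 0 -> y != 0 -> x + y != 0 -> (v x <= v (x + y)) || (v y <= v (x + y))).

Definition vge (K : fieldType) (v : K -> int) (l : int) (x : K) := (x == 0) || (l <= v x).

Section IntValuation.
Variables (K : fieldType) (v : K -> int).
Hypothesis vv : int_valuation v.
Implicit Types (x y : K) (l m : int).

Lemma valM x y : x != 0 -> y != 0 -> v (x * y) = v x + v y.
Proof. exact: vv.1. Qed.

Lemma val1 : v 1 = 0.
Proof.
have := valM (oner_neq0 K) (oner_neq0 K); rewrite mulr1 => /eqP.
by rewrite -subr_eq0 opprD addNKr oppr_eq0 => /eqP.
Qed.

Lemma valX x n : x != 0 -> v (x ^+ n) = n%:Z * v x.
Proof.
move=> x0; elim: n => [|n IH]; first by rewrite expr0 val1 mul0r.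
by rewrite exprS valM ?expf_neq0 // IH intS mulrDl mul1r.
Qed.

Lemma valV x : x != 0 -> v x^-1 = - v x.
Proof.
move=> x0; apply/eqP; rewrite -addr_eq0 addrC -valM ?invr_eq0 //.
by rewrite divff // val1.
Qed.

Lemma valXz x m : x != 0 -> v (x ^ m) = m * v x.
Proof.
move=> x0; case: m => n; first exact: valX.
by rewrite NegzE /= -exprnN valV ?expf_neq0 // valX // mulNr.
Qed.

Lemma valN x : v (- x) = v x.
Proof.
have [->|x0] := eqVneq x 0; first by rewrite oppr0.
have N1 : (-1 : K) != 0 by rewrite oppr_eq0 oner_eq0.
rewrite -mulN1r valM //.
have : v (-1) + v (-1) = 0 by rewrite -valM // mulrNN mulr1 val1.
by move=> H; have -> : v (-1) = 0; [lia|rewrite add0r].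
Qed.

Lemma vge0 l : vge v l 0.
Proof. by rewrite /vge eqxx. Qed.
Lemma vge_val x : vge v (v x) x.
Proof. by rewrite /vge lexx orbT. Qed.

Lemma vgeW l m x : m <= l -> vge v l x -> vge v m x.
Proof. by move=> ml /orP[/eqP->|lx]; rewrite /vge ?eqxx // (le_trans ml lx) orbT. Qed.
Lemma vge_neq0 l x : x != 0 -> vge v l x = (l <= v x).
Proof. by rewrite /vge => /negPf->. Qed.

Lemma vgeN l x : vge v l (- x) = vge v l x.
Proof. by rewrite /vge oppr_eq0 valN. Qed.

Lemma vgeD l x y : vge v l x -> vge v l y -> vge v l (x + y).
Proof.
have [->|x0] := eqVneq x 0; first by rewrite add0r.
have [->|y0] := eqVneq y 0; first by rewrite addr0.
have [->|xy0] := eqVneq (x + y) 0; first by rewrite vge0.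
rewrite !vge_neq0 // => lx ly.
by case/orP: (vv.2 _ _ x0 y0 xy0) => H; [apply: le_trans lx H|apply: le_trans ly H].
Qed.

Lemma vgeB l x y : vge v l x -> vge v l y -> vge v l (x - y).
Proof. by move=> lx ly; apply: vgeD => //; rewrite vgeN. Qed.

Lemma vgeM l m x y : vge v l x -> vge v m y -> vge v (l + m) (x * y).
Proof.
move=> Hx Hy; have [->|x0] := eqVneq x 0; first by rewrite mul0r vge0.
have [->|y0] := eqVneq y 0; first by rewrite mulr0 vge0.
by move: Hx Hy; rewrite !vge_neq0 ?mulf_neq0 // valM //; lia.
Qed.

Lemma vge_sum (I : Type) (r : seq I) (P : pred I) (f : I -> K) l :
  (forall i, P i -> vge v l (f i)) -> vge v l (\sum_(i <- r | P i) f i).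
Proof.
move=> vf; elim/big_ind: _ => //; first exact: vge0.
by move=> *; apply: vgeD.
Qed.

Lemma vgeX l x n : vge v l x -> vge v (n%:Z * l) (x ^+ n).
Proof.
move=> lx; elim: n => [|n IH]; first by rewrite expr0 mul0r vge_neq0 ?oner_neq0 // val1.
by rewrite exprS intS mulrDl mul1r; apply: vgeM.
Qed.

Lemma vge_mull l x y : x != 0 -> vge v l (x * y) = vge v (l - v x) y.
Proof.
move=> x0; have [->|y0] := eqVneq y 0; first by rewrite mulr0 !vge0.
by rewrite !vge_neq0 ?mulf_neq0 // valM //; apply/idP/idP; lia.
Qed.

Lemma valD_lt x y : x != 0 -> vge v (v x + 1) y -> x + y != 0 /\ v (x + y) = v x.
Proof.
move=> x0 xy.
have xy0 : x + y != 0.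
  apply/eqP => /eqP; rewrite addr_eq0 => /eqP xE.
  by move: xy; rewrite -vgeN -xE vge_neq0 //; lia.
split=> //.
have H1 : v x <= v (x + y).
  by rewrite -vge_neq0 //; apply: vgeD; [exact: vge_val|apply: vgeW xy; lia].
have : ~ (v x + 1 <= v (x + y)).
  rewrite -vge_neq0 // => H.
  have : vge v (v x + 1) (x + y - y) by apply: vgeB.
  by rewrite addrK vge_neq0 //; lia.
by lia.
Qed.

Definition val_ring : set K := [set x | vge v 0 x].

Lemma val_ring_valring : valring val_ring.
Proof.
split; first split.
- by rewrite /val_ring /= vge_neq0 ?oner_neq0 // val1.
- by move=> x y; apply: vgeB.
- by move=> x y x0 y0; rewrite /val_ring /= -[0]addr0; apply: vgeM.
- move=> x x0; rewrite /val_ring /= !vge_neq0 ?invr_eq0 // valV //.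
  by have [|] := leP 0 (v x); [left|right; lia].
Qed.

End IntValuation.

(** * Extending a valuation to a finite extension, with [F] acting on [L] through [phi] *)

Section FiniteExtension.
Variables (F L : fieldType) (phi : {rmorphism F -> L}) (d : nat) (e : 'I_d.+1 -> L).
Variable co : L -> 'rV[F]_d.+1.
Hypothesis coK : forall x, \sum_i phi (co x 0 i) * e i = x.
Hypothesis e_free : forall c : 'rV[F]_d.+1, \sum_i phi (c 0 i) * e i = 0 -> c = 0.

Lemma coE (c : 'rV[F]_d.+1) x : \sum_i phi (c 0 i) * e i = x -> co x = c.
Proof.
move=> cx; apply/eqP; rewrite -subr_eq0; apply/eqP; apply: e_free.
under eq_bigr do rewrite !mxE rmorphB mulrBl.
by rewrite sumrB coK cx subrr.
Qed.

Lemma coD x y : co (x + y) = co x + co y.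
Proof.
apply: coE; under eq_bigr do rewrite !mxE rmorphD mulrDl.
by rewrite big_split /= !coK.
Qed.

Lemma co_scale a x : co (phi a * x) = a *: co x.
Proof.
apply: coE; under eq_bigr do rewrite !mxE rmorphM -mulrA.
by rewrite -mulr_sumr coK.
Qed.

Lemma co0 : co 0 = 0.
Proof. by apply: coE; rewrite big1 // => i _; rewrite mxE rmorph0 mul0r. Qed.

Lemma co_sum (I : Type) (r : seq I) (P : pred I) (f : I -> L) :
  co (\sum_(i <- r | P i) f i) = \sum_(i <- r | P i) co (f i).
Proof. exact: (big_morph co coD co0). Qed.

Definition mulrep x : 'M[F]_d.+1 := \matrix_i co (e i * x).

Lemma co_mul x y : co (x * y) = co x *m mulrep y.
Proof.
rewrite -{1}[x]coK mulr_suml co_sum mulmx_sum_row; apply: eq_bigr => i _.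
by rewrite -mulrA co_scale rowK.
Qed.

Lemma co_horner x y p : co (x * (map_poly phi p).[y]) = co x *m horner_mx (mulrep y) p.
Proof.
elim/poly_ind: p x => [|p c IH] x.
  by rewrite rmorph0 horner0 mulr0 co0 (raddf0 (horner_mx _)) mulmx0.
rewrite (rmorphD (horner_mx _)) (rmorphM (horner_mx _)) /= horner_mx_X horner_mx_C.
rewrite mulmxDr mulmxA -IH -co_mul mul_mx_scalar -co_scale -coD.
by rewrite rmorphD rmorphM /= map_polyX map_polyC /= !hornerE mulrDr mulrA [phi c * x]mulrC.
Qed.

Lemma co_unit i : co (e i) = delta_mx 0 i.
Proof.
apply: coE; rewrite (bigD1 i) //= mxE !eqxx rmorph1 mul1r big1 ?addr0 // => j ji.
by rewrite mxE eqxx (negPf ji) rmorph0 mul0r.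
Qed.

Lemma horner_mulrep y p : (map_poly phi p).[y] = 0 -> horner_mx (mulrep y) p = 0.
Proof.
move=> py; apply/row_matrixP => i.
by rewrite rowE -co_unit -co_horner py mulr0 co0 row0.
Qed.

Lemma root_char_poly_mulrep y : root (map_poly phi (char_poly (mulrep y))) y.
Proof.
apply/rootP; rewrite -[LHS]mul1r -[LHS]coK co_horner Cayley_Hamilton mulmx0.
by rewrite big1 // => i _; rewrite mxE rmorph0 mul0r.
Qed.

Section ExtendValuation.
Variables (nu : F -> int) (tau : F) (V : set L) (y : L).
Hypothesis vnu : int_valuation nu.
Hypotheses (tau0 : tau != 0) (nu_tau : nu tau = 1).
Hypothesis vV : valring V.
Hypothesis VF : forall c, vge nu 0 c -> V (phi c).
Hypothesis nVy : ~ V y.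

(** If phi c were in V with nu c < 0, then phi tau^-1 and hence all of phi F would lie in V. As V is
    integrally closed and y is algebraic over F, V would contain y. *)
Lemma valring_phi c : c != 0 -> V (phi c) <-> 0 <= nu c.
Proof.
move=> c0; split; last by move=> H; apply: VF; rewrite vge_neq0.
move=> Vc; rewrite leNgt; apply/negP => nuc; apply: nVy.
have Vt : V (phi tau^-1).
  have -> : tau^-1 = c * (c^-1 * tau^-1) by rewrite mulVKf.
  rewrite rmorphM; apply: (subringM vV.1) => //; apply: VF.
  by rewrite vge_neq0 ?mulf_neq0 ?invr_eq0 // !valM ?valV ?invr_eq0 // nu_tau; lia.
have VphiF b : V (phi b).
  have [->|b0] := eqVneq b 0; first by rewrite rmorph0; apply: subring0 vV.1.
  have -> : b = (b * tau ^+ `|nu b|%N) * tau^-1 ^+ `|nu b|%N.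
    by rewrite exprVn mulfK // expf_neq0.
  rewrite rmorphM rmorphXn; apply: (subringM vV.1); last exact: subringX vV.1 _.
  by apply: VF; rewrite vge_neq0 ?mulf_neq0 ?expf_neq0 // valM ?expf_neq0 // valX // nu_tau; lia.
apply: (valring_root_monic vV _ _ (root_char_poly_mulrep y)).
  by rewrite map_monic char_poly_monic.
by move=> i; rewrite coef_map; apply: VphiF.
Qed.

Let unitV x := V x /\ V x^-1.

Lemma unitVM x z : unitV x -> unitV z -> unitV (x * z).
Proof.
by move=> [Vx Vx'] [Vz Vz']; split; rewrite ?invfM; apply: (subringM vV.1).
Qed.

Lemma unitVV x : unitV x -> unitV x^-1.
Proof. by move=> [Vx Vx']; split; rewrite ?invrK. Qed.

Lemma unitVX x n : unitV x -> unitV (x ^+ n).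
Proof.
by move=> [Vx Vx']; split; rewrite -?exprVn; apply: (subringX _ vV.1).
Qed.

(** In the vanishing sum given by the characteristic equation, a term of least value cannot be
    alone; two terms p_j x^j and p_l x^l of equal value make x^(l-j) equal to p_j / p_l up to a unit
    of V. *)
Lemma power_unit_phi x : x != 0 ->
  exists i c, [/\ (0 < i <= d.+1)%N, c != 0 & unitV (x ^+ i / phi c)].
Proof.
move=> x0; set p := char_poly (mulrep x).
have pmon : p \is monic by apply: char_poly_monic.
(* The terms of the equation become the coefficients of [G], so that [valring_dominating_coef] finds
   one of least value. *)
pose G := \poly_(l < d.+2) (phi p`_l * x ^+ l).
have sG : size p = d.+2 by rewrite size_char_poly.
have G0 : G != 0.
  apply/eqP => /polyP/(_ d.+1); rewrite coef_poly ltnSn coef0.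
  move/monicP: pmon; rewrite lead_coefE sG /= => ->; rewrite rmorph1 mul1r => /eqP.
  by rewrite expf_eq0 (negPf x0) andbF.
have [j [Gj VG _]] := valring_dominating_coef vV G0.
have jd : (j < d.+2)%N.
  by rewrite ltnNge; apply/negP => H; move: Gj; rewrite coef_poly ltnNge H eqxx.
have [l [ld lj Gl ul]] : exists l, [/\ (l < d.+2)%N, l != j, G`_l != 0 & unitV (G`_l / G`_j)].
  apply: contrapT => nex.
  apply: (nonunit1 vV).
  have : \sum_(l < d.+2) G`_l / G`_j = 0.
    rewrite -mulr_suml.
    have /rootP := root_char_poly_mulrep x.
    rewrite -/p horner_coef size_map_poly sG => px.
    rewrite [X in X / _](_ : _ = 0) ?mul0r // -[RHS]px; apply: eq_bigr => i _.
    by rewrite coef_poly ltn_ord coef_map.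
  rewrite (bigD1 (Ordinal jd)) //= divff // => /eqP; rewrite addr_eq0 => /eqP->.
  rewrite -mulN1r; apply: nonunitM => //.
    by apply: (subringN vV.1); case: vV.1.
  apply: nonunit_sum => // l lj; have [->|Gl] := eqVneq G`_l 0; first by left; rewrite mul0r.
  right=> Vl; apply: nex; exists (val l); split=> //; first exact: ltn_ord.
have pl m : G`_m != 0 -> (m < d.+2)%N -> p`_m != 0.
  rewrite coef_poly => + md; rewrite md; apply: contraNN => /eqP->.
  by rewrite rmorph0 mul0r.
have GE m : (m < d.+2)%N -> G`_m = phi p`_m * x ^+ m by rewrite coef_poly => ->.
have pj0 := pl _ Gj jd; have pl0 := pl _ Gl ld.
wlog jl : j l jd ld lj Gj Gl pj0 pl0 ul {VG} / (j < l)%N.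
  move=> H; have [|lj'|jl] := ltngtP j l; first exact: H.
    apply: (H l j) => //; first by rewrite eq_sym.
    by have := unitVV ul; rewrite invf_div.
  by move: lj; rewrite jl eqxx.
exists (l - j)%N, (p`_j / p`_l); split.
- by rewrite subn_gt0 jl /= leq_subLR; lia.
- by rewrite mulf_neq0 // invr_eq0.
- move: ul; rewrite !GE // -(subnK (ltnW jl)) exprD addnK.
  congr unitV; rewrite fmorph_div /= invf_div invfM.
  have pjp : phi p`_j != 0 by rewrite fmorph_eq0.
  have xj : x ^+ j != 0 by rewrite expf_neq0.
  by field; rewrite pjp xj.
Qed.

(** A common multiple of the exponents 1, ..., d+1 allowed by [power_unit_phi]: for every nonzero x,
    x^D is a power of phi tau up to a unit of V. The exponent of that power is the value of x, so
    the new valuation restricts to D times nu. *)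
Let D := (d.+1)`!%N.

Lemma unitV_tau (m : int) : unitV (phi tau ^ m) -> m = 0.
Proof.
have H c : c != 0 -> unitV (phi c) -> nu c = 0.
  move=> c0 [Vc]; rewrite -fmorphV => Vc'.
  have := (valring_phi c0).1 Vc.
  have := (valring_phi (etrans (congr1 negb (invr_eq0 c)) c0)).1 Vc'.
  by rewrite valV //; lia.
rewrite -[_ ^ m](fmorphXz phi) => /H H'.
have := H' (expfz_neq0 _ tau0).
by rewrite valXz // nu_tau mulr1.
Qed.

Lemma exists_val x : x != 0 -> exists m : int, unitV (x ^+ D / phi tau ^ m).
Proof.
move=> x0; have [i [c [/andP[i0 id] c0 uc]]] := power_unit_phi x0.
have iD : (i %| D)%N by rewrite dvdn_fact // i0.
exists (nu c * (D %/ i)%:Z).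
have uc' : unitV (phi c / phi tau ^ nu c).
  rewrite -[_ ^ _](fmorphXz phi) -fmorph_div.
  have t0 : tau ^ nu c != 0 by apply: expfz_neq0.
  have ct0 : c / tau ^ nu c != 0 by rewrite mulf_neq0 // invr_eq0.
  have nct : nu (c / tau ^ nu c) = 0.
    by rewrite valM ?invr_eq0 // valV // valXz // nu_tau mulr1 subrr.
  split; rewrite -?fmorphV; apply: VF; rewrite vge_neq0 ?invr_eq0 ?nct //.
  by rewrite valV // nct.
have := unitVX (D %/ i) (unitVM uc uc').
congr unitV.
have pc : phi c != 0 by rewrite fmorph_eq0.
rewrite mulrA divfK // expr_div_n -exprM [(i * _)%N]mulnC divnK //.
by rewrite -exprz_exp.
Qed.

Definition ext_val x : int := xget 0 [set m | unitV (x ^+ D / phi tau ^ m)].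

Lemma ext_valP x : x != 0 -> unitV (x ^+ D / phi tau ^ ext_val x).
Proof. by move=> x0; have [m um] := exists_val x0; exact: (@xgetPex _ 0 [set m | unitV (x ^+ D / phi tau ^ m)] (ex_intro _ m um)). Qed.

Lemma ext_val_eq x m : x != 0 -> unitV (x ^+ D / phi tau ^ m) -> ext_val x = m.
Proof.
move=> x0 um; have := unitVM um (unitVV (ext_valP x0)).
have pt : phi tau != 0 by rewrite fmorph_eq0.
have xD : x ^+ D != 0 by rewrite expf_neq0.
rewrite invf_div [X in unitV X](_ : _ = phi tau ^ (ext_val x - m)).
  by move/unitV_tau => /eqP; rewrite subr_eq0 => /eqP.
rewrite expfzDr // -invr_expz mulrC mulrA divfK //.
Qed.

Lemma ext_val_ge0 x : x != 0 -> V x <-> 0 <= ext_val x.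
Proof.
move=> x0; have := ext_valP x0; set m := ext_val x => -[Vu Vu'].
have pt : phi tau ^ m != 0 by rewrite expfz_neq0 // fmorph_eq0.
have t0 : tau ^ m != 0 by rewrite expfz_neq0.
have xD : x ^+ D != 0 by rewrite expf_neq0.
have tauE : phi (tau ^ m) = phi tau ^ m by rewrite fmorphXz.
have nutm : nu (tau ^ m) = m by rewrite valXz // nu_tau mulr1.
split=> [Vx|m0].
  rewrite -nutm; apply/(valring_phi t0); rewrite tauE.
  have -> : phi tau ^ m = x ^+ D * (x ^+ D / phi tau ^ m)^-1.
    by rewrite invf_div mulrCA divff ?mulr1.
  by apply: (subringM vV.1) => //; apply: (subringX _ vV.1).
have VxD : V (x ^+ D).
  rewrite -[x ^+ D](divfK pt); apply: (subringM vV.1) => //.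
  by rewrite -tauE; apply/(valring_phi t0); rewrite nutm.
apply: contrapT => nVx; apply: (nVx); have VxV := valring_inv vV nVx.
have -> : x = x ^+ D * x^-1 ^+ D.-1.
  rewrite -{1}[D](@prednK _ (fact_gt0 _)) exprS exprVn mulfK ?expf_neq0 //.
by apply: (subringM vV.1) => //; apply: (subringX _ vV.1).
Qed.

Lemma ext_val_valuation : int_valuation ext_val.
Proof.
have M x z : x != 0 -> z != 0 -> ext_val (x * z) = ext_val x + ext_val z.
  move=> x0 z0; apply: ext_val_eq; first by rewrite mulf_neq0.
  have := unitVM (ext_valP x0) (ext_valP z0).
  have pt : phi tau != 0 by rewrite fmorph_eq0.
  by rewrite exprMn expfzDr // invfM mulrACA.
split=> // x z x0 z0 xz0.
wlog xz : x z x0 z0 xz0 / V (x / z).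
  have xzi0 : x / z != 0 by rewrite mulf_neq0 // invr_eq0.
  move=> H; case: (vV.2 _ xzi0); first exact: H.
  by rewrite invf_div addrC orbC => ?; apply: H => //; rewrite addrC.
have E : x + z = (x / z + 1) * z by rewrite mulrDl divfK // mul1r.
have E0 : x / z + 1 != 0 by apply: contraNneq xz0 => xz0; rewrite E xz0 mul0r.
apply/orP; right; rewrite E M // lerDr; apply/ext_val_ge0 => //.
by apply: (subringD vV.1) => //; case: vV.1.
Qed.

Lemma ext_val_phi c : c != 0 -> ext_val (phi c) = D%:Z * nu c.
Proof.
move=> c0; have pc0 : phi c != 0 by rewrite fmorph_eq0.
have t0 := expfz_neq0 (D%:Z * nu c) tau0.
apply: ext_val_eq => //.
have cD : c ^+ D != 0 by rewrite expf_neq0.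
rewrite -rmorphXn -[_ ^ _](fmorphXz phi) -fmorph_div.
have nu0 : nu (c ^+ D / tau ^ (D%:Z * nu c)) = 0.
  by rewrite valM ?invr_eq0 // valV // valXz // valX // nu_tau mulr1 subrr.
by split; rewrite -?fmorphV; apply: VF; rewrite vge_neq0 ?invr_eq0 ?mulf_neq0 ?invr_eq0 // ?valV ?mulf_neq0 ?invr_eq0 // nu0.
Qed.

End ExtendValuation.

(** By the definition of [integral_over], its failure provides a valuation ring over that of nu
    without y; finiteness of the extension makes it discrete. *)
Lemma exists_valuation_neg (nu : F -> int) (tau : F) (y : L) :
  int_valuation nu -> tau != 0 -> nu tau = 1 ->
  ~ integral_over [set phi c | c in [set c | vge nu 0 c]] y ->
  exists v D, [/\ int_valuation v, 0 < D :> int,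
    forall c, c != 0 -> v (phi c) = D * nu c & ~ vge v 0 y].
Proof.
move=> vnu tau0 nu_tau; move=> /existsNP[V] /not_implyP[vV /not_implyP[VF nVy]].
have {}VF c : vge nu 0 c -> V (phi c) by move=> c0; apply: VF; exists c.
exists (ext_val tau V), (d.+1)`!%:Z; split=> //.
- exact: (ext_val_valuation vnu tau0 nu_tau vV VF nVy).
- by rewrite ltz_nat fact_gt0.
- by move=> c c0; apply: (ext_val_phi vnu tau0 nu_tau vV VF nVy).
- have y0 : y != 0 by apply/eqP => y0; apply: nVy; rewrite y0; apply: subring0 vV.1.
  by rewrite vge_neq0 // => /(ext_val_ge0 vnu tau0 nu_tau vV VF nVy y0).
Qed.

End FiniteExtension.

(** * Extending the logarithmic derivation *)

Section TraceForm.
Variables (F L : fieldType) (phi : {rmorphism F -> L}) (d : nat) (e : 'I_d.+1 -> L).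
Variable co : L -> 'rV[F]_d.+1.
Hypothesis coK : forall x, \sum_i phi (co x 0 i) * e i = x.
Hypothesis e_free : forall c : 'rV[F]_d.+1, \sum_i phi (c 0 i) * e i = 0 -> c = 0.
Let mulrep := (mulrep e co).
Let coD := coD coK e_free.
Let co_scale := co_scale coK e_free.
Let co_unit := co_unit coK e_free.
Let coE := coE coK e_free.
Let co0 := co0 coK e_free.

(** A monic equation of x pulls back along phi to one over A, which annihilates the multiplication
    matrix; [char_poly_integral] concludes. *)
Lemma char_poly_mulrep_integral (A : set F) x : subring A ->
  integral_over [set phi c | c in A] x ->
  forall i, integral_over A (char_poly (mulrep x))`_i.
Proof.
move=> sA.
have spA : subring [set phi c | c in A].
  split.
  - by exists 1; [case: sA|rewrite rmorph1].
  - move=> _ _ [a Aa <-] [b Ab <-]; exists (a - b); last by rewrite rmorphB.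
    by case: sA => _ + _; apply.
  - by move=> _ _ [a Aa <-] [b Ab <-]; exists (a * b); [apply: subringM|rewrite rmorphM].
move=> /(integral_overP spA)[p [pmon Ap /rootP px]].
have /choice[c Hc] : forall i, exists c, A c /\ phi c = p`_i.
  by move=> i; have [c Ac cE] := Ap i; exists c.
pose q := \poly_(i < size p) c i.
have pE : p = map_poly phi q.
  apply/polyP => i; rewrite coef_map coef_poly; case: ltnP => [_|si].
    by case: (Hc i).
  by rewrite nth_default //; apply/esym/(rmorph0 phi).
have qmon : q \is monic by rewrite -(map_monic phi) -pE.
apply: (char_poly_integral qmon).
  move=> i; rewrite coef_poly; case: ifP => _; first by case: (Hc i).
  exact: subring0.
by apply: horner_mulrep => //; rewrite -pE.
Qed.

Lemma mulrepD x y : mulrep (x + y) = mulrep x + mulrep y.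
Proof. by apply/row_matrixP => i; rewrite linearD /= !rowK mulrDr coD. Qed.
Lemma mulrep_scale a x : mulrep (phi a * x) = a *: mulrep x.
Proof. by apply/row_matrixP => i; rewrite linearZ /= !rowK mulrCA co_scale. Qed.

Lemma mulrep1 : mulrep 1 = 1%:M.
Proof. by apply/row_matrixP => i; rewrite rowK mulr1 co_unit // row1. Qed.

Definition trace_mx : 'M[F]_d.+1 := \matrix_(i, j) \tr (mulrep (e i * e j)).

Lemma mul_trace_mx x j : (co x *m trace_mx) 0 j = \tr (mulrep (x * e j)).
Proof.
rewrite -[in RHS](coK x) mulr_suml.
rewrite (big_morph mulrep mulrepD (_ : _ = 0)); last first.
  by rewrite -[0](mul0r 1) -(rmorph0 phi) mulrep_scale scale0r.
rewrite raddf_sum mxE; apply: eq_bigr => i _.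
by rewrite /= mxE -mulrA mulrep_scale mxtraceZ.
Qed.

(** If a nonzero x were orthogonal to everything, x x^-1 = 1 would have trace 0, but its trace is
    d+1. *)
Lemma trace_mx_unit : (d.+1%:R != 0 :> F) -> trace_mx \in unitmx.
Proof.
move=> d0; rewrite -row_free_unit; apply/row_freeP.
suff : forall c : 'rV_d.+1, c *m trace_mx = 0 -> c = 0.
  move=> H; apply/row_freeP; rewrite -kermx_eq0; apply/rowV0P => c.
  by rewrite sub_kermx => /eqP /H.
move=> c cT; pose x := \sum_i phi (c 0 i) * e i.
have cx : co x = c by apply: coE.
have trx y : \tr (mulrep (x * y)) = 0.
  rewrite -[y]coK mulr_sumr.
  rewrite (big_morph mulrep mulrepD (_ : _ = 0)); last first.
    by rewrite -[0](mul0r 1) -(rmorph0 phi) mulrep_scale scale0r.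
  rewrite raddf_sum big1 // => i _.
  by rewrite /= mulrCA mulrep_scale mxtraceZ -mul_trace_mx cx cT mxE mulr0.
have [x0|x0] := eqVneq x 0; first by rewrite -cx x0 co0.
have := trx x^-1; rewrite divff // mulrep1 mxtrace1 => /eqP.
by rewrite (negPf d0).
Qed.

End TraceForm.

Lemma vge_bounded (K : fieldType) (v : K -> int) (I : finType) (f : I -> K) :
  exists N : nat, forall i, vge v (- N%:Z) (f i).
Proof.
exists (\sum_i `|v (f i)|)%N => i; apply/orP; right.
by rewrite (bigD1 i) //=; lia.
Qed.

Section LogDerivation.
Variables (F L : fieldType) (phi : {rmorphism F -> L}) (d : nat) (e : 'I_d.+1 -> L).
Variable co : L -> 'rV[F]_d.+1.
Hypothesis coK : forall x, \sum_i phi (co x 0 i) * e i = x.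
Hypothesis e_free : forall c : 'rV[F]_d.+1, \sum_i phi (c 0 i) * e i = 0 -> c = 0.
Variables (nu : F -> int) (tau : F) (v : L -> int) (D : nat).
Hypotheses (vnu : int_valuation nu) (vv : int_valuation v).
Hypotheses (tau0 : tau != 0) (nu_tau : nu tau = 1) (D0 : (0 < D)%N).
Hypothesis v_phi : forall c, c != 0 -> v (phi c) = D%:Z * nu c.
Local Notation phiO := [set phi c | c in [set c | vge nu 0 c]].
Hypothesis e_integral : forall i, integral_over phiO (e i).
Hypothesis nat_unit : forall n, n.+1%:R != 0 :> F /\ nu (n.+1%:R) = 0.
Variables (EF : F -> F) (E : L -> L).
Hypothesis ED : forall x y, E (x + y) = E x + E y.
Hypothesis EM : forall x y, E (x * y) = E x * y + x * E y.
Hypothesis Ephi : forall c, E (phi c) = phi (EF c).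
Hypothesis EFO : forall c, vge nu 0 c -> vge nu 1 (EF c).
Hypothesis EF_tau : EF tau = tau.
Let mulrep := (mulrep e co).

Lemma vge_phi l c : vge nu l c -> vge v (D%:Z * l) (phi c).
Proof.
move=> lc; have [->|c0] := eqVneq c 0; first by rewrite rmorph0 vge0.
by move: lc; rewrite !vge_neq0 ?fmorph_eq0 // v_phi // ler_pM2l // ltz_nat.
Qed.

Lemma vge_phi_unit c : vge nu 0 c -> vge v 0 (phi c).
Proof. by move/vge_phi; rewrite mulr0. Qed.
Lemma vge_phi_nonunit c : vge nu 1 c -> vge v 1 (phi c).
Proof. by move/vge_phi; rewrite mulr1; apply: vgeW. Qed.

Lemma E0 : E 0 = 0.
Proof. by apply: (addrI (E 0)); rewrite -ED !addr0. Qed.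
Lemma E1 : E 1 = 0.
Proof. by apply: (addrI (E 1)); rewrite addr0 -{3}[1]mulr1 EM !mulr1 mul1r. Qed.

Lemma E_sum (I : Type) (r : seq I) (P : pred I) (f : I -> L) :
  E (\sum_(i <- r | P i) f i) = \sum_(i <- r | P i) E (f i).
Proof. exact: (big_morph E ED E0). Qed.

Definition dlog x := E x / x.

Lemma dlogM x y : x != 0 -> y != 0 -> dlog (x * y) = dlog x + dlog y.
Proof. by move=> x0 y0; rewrite /dlog EM; field; rewrite x0 y0. Qed.

Lemma dlog1 : dlog 1 = 0. Proof. by rewrite /dlog E1 mul0r. Qed.

Lemma dlogX x n : x != 0 -> dlog (x ^+ n) = n%:R * dlog x.
Proof.
move=> x0; elim: n => [|n IH]; first by rewrite expr0 dlog1 mul0r.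
by rewrite exprS dlogM ?expf_neq0 // IH -[in RHS]add1n natrD mulrDl mul1r.
Qed.

Lemma dlogV x : x != 0 -> dlog x^-1 = - dlog x.
Proof.
move=> x0; apply/eqP; rewrite -addr_eq0 -dlogM ?invr_eq0 //.
by rewrite mulVf // dlog1.
Qed.

Lemma dlogXz x (m : int) : x != 0 -> dlog (x ^ m) = m%:~R * dlog x.
Proof.
move=> x0; case: m => n; first exact: dlogX.
by rewrite NegzE /= -exprnN dlogV ?expf_neq0 // dlogX // mulrNz mulNr.
Qed.

Lemma E_horner (Q : {poly F}) u :
  E (map_poly phi Q).[u] =
  (map_poly phi (\poly_(i < size Q) EF Q`_i)).[u] + (map_poly phi Q^`()).[u] * E u.
Proof.
have EX n : E (u ^+ n) = (u ^+ n.-1 *+ n) * E u.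
  elim: n => [|[|n] IH]; first by rewrite expr0 E1 mulr0n mul0r.
    by rewrite expr1 expr0 mulr1n mul1r.
  by rewrite exprS EM IH /= [E u * _]mulrC mulrA mulrnAr -exprS -mulrDl -mulrS.
rewrite horner_coef size_map_poly E_sum.
under eq_bigr do rewrite coef_map EM Ephi.
rewrite big_split /=; congr (_ + _).
  rewrite (@horner_coef_wide _ (size Q)); last first.
    by apply: leq_trans (size_poly _ _) _; apply: size_poly.
  by apply: eq_bigr => i _; rewrite coef_map coef_poly ltn_ord.
under eq_bigr do rewrite EX mulrA.
rewrite -mulr_suml; congr (_ * _).
case sQ : (size Q) => [|m].
  move/eqP: sQ; rewrite size_poly_eq0 => /eqP ->.
  by rewrite big_ord0 derivC rmorph0 horner0.
rewrite big_ord_recl /= mulr0n mulr0 add0r.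
rewrite (@horner_coef_wide _ m); last first.
  by rewrite size_map_poly -ltnS -sQ lt_size_deriv // -size_poly_eq0 sQ.
by apply: eq_bigr => i _; rewrite coef_map coef_deriv raddfMn /= mulrnAr mulrnAl.
Qed.

Lemma vge_natF m : vge nu 0 m%:R.
Proof.
case: m => [|m]; first exact: vge0.
by have [m0 mv] := nat_unit m; rewrite vge_neq0 // mv.
Qed.

Lemma vge_intF (m : int) : vge nu 0 m%:~R.
Proof. by case: m => m; rewrite ?NegzE ?mulrNz ?vgeN //; apply: vge_natF. Qed.

(** Write c = tau^l c' with c' of value at least 0; since E fixes phi tau, the derivative of tau^l
    is l tau^l and the factor tau^l survives. *)
Lemma EF_vge l c : vge nu l c -> vge nu l (EF c).
Proof.
move=> lc; have t0 : tau ^ l != 0 by rewrite expfz_neq0.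
have pt0 : phi tau != 0 by rewrite fmorph_eq0.
have [c' cE c'O] : exists2 c', c = tau ^ l * c' & vge nu 0 c'.
  exists (c / tau ^ l); first by rewrite mulrC divfK.
  have [->|c0] := eqVneq c 0; first by rewrite mul0r vge0.
  by move: lc; rewrite !vge_neq0 ?mulf_neq0 ?invr_eq0 // valM ?invr_eq0 // valV // valXz // nu_tau; lia.
have Et : E (phi (tau ^ l)) = phi (l%:~R * tau ^ l).
  have := dlogXz l pt0; rewrite /dlog Ephi EF_tau divff // mulr1 -fmorphXz => lE.
  by rewrite rmorphM /= rmorph_int -lE divfK // fmorph_eq0.
have -> : EF c = tau ^ l * (l%:~R * c' + EF c').
  apply: (fmorph_inj phi); rewrite -Ephi cE rmorphM EM Et Ephi !rmorphM rmorphD !rmorphM /=.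
  by ring.
rewrite vge_mull // valXz // nu_tau mulr1 subrr; apply: vgeD => //.
  by rewrite -[0]addr0; apply: vgeM => //; apply: vge_intF.
by apply: vgeW (EFO c'O).
Qed.

(* The conductor bound: the coordinates of an integral element have bounded
   denominators, because the trace form is nondegenerate. *)
Lemma E_integral_bounded : exists N : nat, forall x,
  integral_over phiO x -> vge v (- N%:Z) (E x).
Proof.
have Tu : trace_mx e co \in unitmx by apply: trace_mx_unit => //; case: (nat_unit d).
have [N1 HN1] := vge_bounded nu (fun ij : 'I_d.+1 * 'I_d.+1 => invmx (trace_mx e co) ij.1 ij.2).
have [N2 HN2] := vge_bounded v e.
have [N3 HN3] := vge_bounded v (fun i => E (e i)).
(* [N1] bounds the denominators of the inverse trace matrix for nu and is scaled by D for v; [N2]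
   and [N3] bound v(e_i) and v(E e_i). *)
exists (D * N1 + N2 + N3)%N => x Ix.
have sO : subring [set c | vge nu 0 c] by case: (val_ring_valring vnu).
have trO j : vge nu 0 (\tr (mulrep (x * e j))).
  have Ixe : integral_over phiO (x * e j).
    move=> V vV VO; apply: (subringM vV.1); first exact: Ix.
    exact: e_integral.
  have := char_poly_mulrep_integral coK e_free sO Ixe d.
  move=> /(_ _ (val_ring_valring vnu) (fun=> id)).
  by rewrite /val_ring /= (char_poly_trace _ (ltn0Sn d)) vgeN.
have coB i : vge nu (- N1%:Z) (co x 0 i).
  rewrite -(mulmxK Tu (co x)) mxE; apply: vge_sum => // j _.
  rewrite -[- _]add0r; apply: vgeM => //; last exact: (HN1 (j, i)).
  by rewrite (mul_trace_mx coK e_free).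
rewrite -(coK x) E_sum; apply: vge_sum => // i _.
have := vge_phi (coB i).
rewrite EM Ephi => H1.
have EFc := EF_vge (coB i).
have H2 := vge_phi EFc.
by apply: vgeD => //; [apply: (vgeW _ (vgeM vv H2 (HN2 i)))|apply: (vgeW _ (vgeM vv H1 (HN3 i)))]; lia.
Qed.

(* [w] is a partial Horner sum of an integral equation of [x], cut at the last
   coefficient that is a unit; all these partial sums are integral. *)
Lemma unit_denominator x : vge v 0 x -> exists w, [/\ v w = 0, w != 0,
  integral_over phiO w &
  integral_over phiO (x * w)].
Proof.
move=> Vx; set p := char_poly (mulrep x).
have pmon : p \is monic by apply: char_poly_monic.
have sp : size p = d.+2 by rewrite size_char_poly.
(* Coefficients are listed from the top degree down, so the least dominating index selects the
   highest power whose normalised coefficient is a unit. *)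
pose G := \poly_(l < d.+2) p`_(d.+1 - l).
have G0 : G != 0.
  apply/eqP => /polyP/(_ 0%N); rewrite coef_poly coef0 /= subn0.
  by move/monicP: pmon; rewrite lead_coefE sp /= => -> /eqP; rewrite oner_eq0.
have [i [Gi VG nG]] := valring_dominating_coef (val_ring_valring vnu) G0.
pose b l := G`_l / G`_i.
have id : (i < d.+2)%N.
  by rewrite ltnNge; apply/negP => H; move: Gi; rewrite coef_poly ltnNge H eqxx.
have sum0 : \sum_(l < d.+2) phi (b l) * x ^+ (d.+1 - l) = 0.
  have /rootP := root_char_poly_mulrep coK e_free x.
  rewrite -/p horner_coef size_map_poly sp (reindex_inj rev_ord_inj) /= => px.
  rewrite (eq_bigr (fun l : 'I_d.+2 => (phi G`_i)^-1 * (phi p`_(d.+1 - l) * x ^+ (d.+1 - l)))).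
    rewrite -mulr_sumr; apply/eqP; rewrite mulf_eq0; apply/orP; right.
    rewrite -[X in _ == X]px; apply/eqP; apply: eq_bigr => l _.
    by rewrite coef_map subSS.
  by move=> l _; rewrite /b coef_poly ltn_ord fmorph_div mulrAC mulrC.
pose w := \sum_(l < d.+2 | (l <= i)%N) phi (b l) * x ^+ (i - l).
have vb l : vge v 0 (phi (b l)) by apply: vge_phi_unit; apply: VG.
have wE : w = 1 + \sum_(l < d.+2 | (l < i)%N) phi (b l) * x ^+ (i - l).
  rewrite /w (bigD1 (Ordinal id)) //= subnn expr0 mulr1 /b divff // rmorph1; congr (_ + _).
  by apply: eq_bigl => l; rewrite ltn_neqAle andbC.
have [w0 vw] : w != 0 /\ v w = v 1.
  rewrite wE; apply: valD_lt => //; first exact: oner_neq0.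
  rewrite val1 // add0r; apply: vge_sum => // l li.
  rewrite -[1]addr0; apply: vgeM => //.
    apply: vge_phi_nonunit; have := nG _ li; rewrite -/(b l) => -[->|]; first exact: vge0.
    rewrite /val_ring /= => nb.
    have [->|bl0] := eqVneq (b l) 0; first exact: vge0.
    by move: nb; rewrite !vge_neq0 ?invr_eq0 // valV //; lia.
  by rewrite -(mulr0 (i - l)%:Z); apply: vgeX.
exists w; suff [Iw Ixw] : integral_over phiO w /\
    integral_over phiO (x * w).
  by split=> //; rewrite vw val1.
suff H W : valring W -> phiO `<=` W -> W w /\ W (x * w).
  by split=> W vW OW; case: (H W vW OW).
move=> vW OW; have Wb l : W (phi (b l)) by apply: OW; exists (b l) => //; apply: VG.
have [Wx|nWx] := pselect (W x).
  have Ww : W w.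
    by rewrite /w; apply: (subring_sum _ vW.1) => l _; apply: (subringM vW.1) => //; apply: (subringX _ vW.1).
  by split=> //; apply: (subringM vW.1).
have x0 : x != 0 by apply/eqP => x0; apply: nWx; rewrite x0; apply: subring0 vW.1.
have WxV := valring_inv vW nWx.
suff Wxw : W (x * w).
  by split=> //; rewrite -[w](mulKf x0); apply: (subringM vW.1).
(* Multiplied by a negative power of x, the equation trades the sum over l <= i for minus the sum
   over l > i, a polynomial in x^-1. *)
have -> : x * w = - \sum_(l < d.+2 | (i < l)%N) phi (b l) * x^-1 ^+ (l - i.+1).
  have xd : x ^+ (d.+1 - i) != 0 by rewrite expf_neq0.
  apply: (mulfI xd); rewrite mulrCA mulrN [in RHS]mulr_sumr.
  move: sum0; rewrite (bigID (fun l : 'I_d.+2 => (l <= i)%N)) /=.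
  under [X in _ + X]eq_bigl do rewrite -ltnNge.
  have -> : \sum_(l < d.+2 | (l <= i)%N) phi (b l) * x ^+ (d.+1 - l) = x ^+ (d.+1 - i) * w.
    rewrite /w mulr_sumr; apply: eq_bigr => l li; rewrite mulrCA -exprD; congr (_ * x ^+ _).
    by lia.
  move/eqP; rewrite addr_eq0 => /eqP ->; rewrite mulrN mulr_sumr; congr (- _).
  apply: eq_bigr => l li; rewrite mulrCA [RHS]mulrCA -exprS; congr (_ * _).
  have xl : x ^+ (l - i.+1) != 0 by rewrite expf_neq0.
  apply: (mulIf xl); rewrite exprVn divfK // -exprD; congr (x ^+ _).
  by have := ltn_ord l; lia.
apply: (subringN vW.1); apply: (subring_sum _ vW.1) => l _; apply: (subringM vW.1) => //.
exact: (subringX _ vW.1).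
Qed.

(** Since w is a unit for v, it is enough to bound w E x = E(x w) - x E w, where x w and w are
    integral. *)
Lemma E_bounded : exists N : nat, forall x, vge v 0 x -> vge v (- N%:Z) (E x).
Proof.
have [N HN] := E_integral_bounded; exists N => x Vx.
have [w [w0 wn0 Iw Ixw]] := unit_denominator Vx.
suff : vge v (- N%:Z) (w * E x) by rewrite vge_mull // w0 subr0.
have -> : w * E x = E (x * w) - x * E w by rewrite EM addrK mulrC.
apply: vgeB => //; first exact: HN.
by rewrite -[- _]add0r; apply: vgeM => //; apply: HN.
Qed.

Lemma vge_nat m : vge v 0 m%:R.
Proof.
case: m => [|m]; first exact: vge0.
have [m0 mv] := nat_unit m.
by rewrite -(rmorph_nat phi); apply: vge_phi_unit; rewrite vge_neq0 // mv.
Qed.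

Lemma vge_int (m : int) : vge v 0 m%:~R.
Proof. by case: m => m; rewrite ?NegzE ?mulrNz ?vgeN //; apply: vge_nat. Qed.

Lemma int_unit (m : int) : m != 0 -> (m%:~R : L) != 0 /\ v m%:~R = 0.
Proof.
have N n : (n.+1%:R : L) != 0 /\ v n.+1%:R = 0.
  have [n0 nv] := nat_unit n.
  by rewrite -(rmorph_nat phi) fmorph_eq0 v_phi // nv mulr0.
case: m => [[//|n]|n] _; first exact: N.
by rewrite NegzE mulrNz oppr_eq0 valN //; apply: N.
Qed.

(** [Q] lifts a polynomial of least degree killing the residue of u. Its leading coefficient is a
    unit and, in residue characteristic 0, so is that of the derivative; minimality then makes Q'(u)
    a unit. *)
Lemma residue_poly u : u != 0 -> v u = 0 -> exists Q : {poly F},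
  [/\ forall i, vge nu 0 Q`_i, vge v 1 (map_poly phi Q).[u],
    (map_poly phi Q^`()).[u] != 0 & v (map_poly phi Q^`()).[u] = 0].
Proof.
move=> u0 vu.
pose P s := exists Q : {poly F}, [/\ size Q = s, forall i, vge nu 0 Q`_i,
   exists i, ~ vge nu 1 Q`_i & vge v 1 (map_poly phi Q).[u]].
(* The characteristic polynomial of u, divided by a dominating coefficient, is a candidate. *)
have exP : exists s, `[< P s >].
  set p := char_poly (mulrep u).
  have p0 : p != 0 by apply: monic_neq0; apply: char_poly_monic.
  have [i [pi Vp _]] := valring_dominating_coef (val_ring_valring vnu) p0.
  exists (size ((p`_i)^-1 *: p)); apply/asboolP; exists ((p`_i)^-1 *: p); split=> //.
  - by move=> j; rewrite coefZ mulrC; apply: Vp.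
  - by exists i; rewrite coefZ mulVf // vge_neq0 ?oner_neq0 // val1.
  - have /rootP pu := root_char_poly_mulrep coK e_free u.
    by rewrite map_polyZ hornerZ -/p pu mulr0 vge0.
have [s /asboolP[Q [sQ QO [i Qi] Qu]] smin] := ex_minnP exP.
have {}smin (Q1 : {poly F}) : (size Q1 < size Q)%N -> (forall i, vge nu 0 Q1`_i) ->
   (exists i, ~ vge nu 1 Q1`_i) -> ~ vge v 1 (map_poly phi Q1).[u].
  move=> sQ1 Q1O Q1i Q1u; have : (s <= size Q1)%N by apply: smin; apply/asboolP; exists Q1.
  by rewrite leqNgt -sQ sQ1.
have Q0 : Q != 0 by apply: contra_notN Qi => /eqP->; rewrite coef0 vge0.
have sQ0 : (0 < size Q)%N by rewrite size_poly_gt0.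
have hornerO (Q1 : {poly F}) : (forall i, vge nu 0 Q1`_i) -> vge v 0 (map_poly phi Q1).[u].
  move=> Q1O; rewrite horner_coef; apply: vge_sum => // j _.
  rewrite coef_map -[0]addr0; apply: vgeM => //; first exact: vge_phi_unit.
  by rewrite -(mulr0 j%:Z); apply: vgeX => //; rewrite vge_neq0 // vu.
(* Otherwise dropping the leading term leaves a smaller polynomial with the same properties. *)
have lQ : ~ vge nu 1 (lead_coef Q).
  move=> lQ; pose Q1 := \poly_(j < (size Q).-1) Q`_j.
  have QE : Q = Q1 + lead_coef Q *: 'X^((size Q).-1).
    apply/polyP => j; rewrite coefD coefZ coefXn coef_poly.
    have [jl|] := ltnP j (size Q).-1; first by rewrite (ltn_eqF jl) mulr0 addr0.
    rewrite leq_eqVlt => /orP[/eqP<-|jl]; first by rewrite eqxx mulr1 add0r lead_coefE.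
    by rewrite (gtn_eqF jl) mulr0 addr0 nth_default // -(prednK sQ0).
  apply: (smin Q1).
  - by apply: leq_ltn_trans (size_poly _ _) _; rewrite prednK.
  - by move=> j; rewrite coef_poly; case: ifP => _ //; apply: vge0.
  - exists i; rewrite coef_poly; case: ltnP => [//|il].
    exfalso; apply: Qi; move: il; rewrite leq_eqVlt => /orP[/eqP<-//|il].
    by rewrite nth_default ?vge0 // -(prednK sQ0).
  - have -> : (map_poly phi Q1).[u] = (map_poly phi Q).[u] - phi (lead_coef Q) * u ^+ (size Q).-1.
      suff {1}-> : map_poly phi Q = map_poly phi Q1 + phi (lead_coef Q) *: 'X^((size Q).-1).
        by rewrite hornerD hornerZ hornerXn addrK.
      by rewrite {1}QE rmorphD /= map_polyZ map_polyXn.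
    apply: vgeB => //; rewrite -[1]addr0; apply: vgeM => //; first exact: vge_phi_nonunit.
    by rewrite -(mulr0 (size Q).-1%:Z); apply: vgeX => //; rewrite vge_neq0 // vu.
have sQ1 : (1 < size Q)%N.
  rewrite ltnNge; apply/negP => sQ1.
  have QC := size1_polyC sQ1; apply: lQ; rewrite QC lead_coefC.
  move: Qu; have -> : (map_poly phi Q).[u] = phi Q`_0 by rewrite {1}QC map_polyC hornerC.
  have c0 : Q`_0 != 0 by apply: contraNneq Q0 => c0; rewrite QC c0.
  rewrite !vge_neq0 ?fmorph_eq0 // v_phi // => H.
  by rewrite leNgt; apply/negP => H'; nia.
have Q'O j : vge nu 0 (Q^`())`_j.
  by rewrite coef_deriv -mulr_natr -[0]addr0; apply: vgeM => //; apply: vge_natF.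
have Q'u : ~ vge v 1 (map_poly phi Q^`()).[u].
  apply: smin => //; first by rewrite lt_size_deriv.
  case sQ2 : (size Q) sQ1 => [|[|m]] // _; exists m; rewrite coef_deriv -mulr_natr.
  have [n0 nn] := nat_unit m.
  move: lQ; rewrite lead_coefE sQ2 /=.
  have [->|lc0] := eqVneq Q`_m.+1 0; first by rewrite vge0.
  by rewrite !vge_neq0 ?mulf_neq0 // valM // nn addr0.
have Q'0 : (map_poly phi Q^`()).[u] != 0.
  by apply/eqP => H; apply: Q'u; rewrite H vge0.
exists Q; split=> //.
by move: Q'u (hornerO _ Q'O); rewrite !vge_neq0 //; lia.
Qed.

Let unit_part x := x ^+ D / phi tau ^ (v x).

(** As v(phi tau) = D, dividing x^D by phi tau to the power v(x) leaves value 0; as E fixes phi tau,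
    the logarithmic derivative exhibits v(x) as an integer constant of L. *)
Lemma unit_partP x : x != 0 ->
  [/\ unit_part x != 0, v (unit_part x) = 0 &
      dlog (unit_part x) = D%:R * dlog x - (v x)%:~R].
Proof.
move=> x0; have t0 : phi tau != 0 by rewrite fmorph_eq0.
have xD : x ^+ D != 0 by rewrite expf_neq0.
have tv : phi tau ^ (v x) != 0 by rewrite expfz_neq0.
split; first by rewrite mulf_neq0 // invr_eq0.
  by rewrite valM ?invr_eq0 // valV // valX // valXz // v_phi // nu_tau; lia.
rewrite dlogM ?invr_eq0 // dlogX // dlogV // dlogXz //.
by rewrite /dlog Ephi EF_tau divff // mulr1.
Qed.

(** In the expansion [E_horner] of E(Q(u)), the part where EF hits the coefficients has value at
    least 1, and E(u) is multiplied by the unit Q'(u); so a bound on E(Q(u)) passes to E(u). *)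
Lemma dlog_bound (l : int) (Q : {poly F}) u : l <= 1 -> u != 0 -> v u = 0 ->
  (forall i, vge nu 0 Q`_i) -> vge v l (E (map_poly phi Q).[u]) ->
  (map_poly phi Q^`()).[u] != 0 -> v (map_poly phi Q^`()).[u] = 0 ->
  vge v l (dlog u).
Proof.
move=> l1 u0 vu QO EQ Q'0 Q'u.
have EQ1 : vge v l (map_poly phi (\poly_(i < size Q) EF Q`_i)).[u].
  apply: vgeW l1 _; rewrite horner_coef; apply: vge_sum => // i _.
  rewrite coef_map coef_poly; case: ifP => _; last by rewrite raddf0 mul0r vge0.
  rewrite -[1]addr0; apply: vgeM => //; first exact/vge_phi_nonunit/EFO.
  by rewrite -(mulr0 i%:Z); apply: vgeX; rewrite // vge_neq0 // vu.
have Eu : vge v l (E u).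
  suff : vge v l ((map_poly phi Q^`()).[u] * E u) by rewrite vge_mull // Q'u subr0.
  by move: EQ; rewrite E_horner => /(vgeB vv)/(_ EQ1); rewrite addrC addKr.
suff : vge v l (u * dlog u) by rewrite vge_mull // vu subr0.
by rewrite /dlog mulrCA divff // mulr1.
Qed.

Lemma dlog_unit_part (l : int) x : l <= 1 -> x != 0 -> vge v l (dlog (unit_part x)) ->
  vge v l (D%:R * dlog x - (v x)%:~R).
Proof. by move=> l1 x0; have [_ _ ->] := unit_partP x0. Qed.
Lemma E_dlog x : x != 0 -> E x = x * dlog x.
Proof. by move=> x0; rewrite /dlog mulrCA divff // mulr1. Qed.

Lemma D_unit : (D%:R : L) != 0 /\ v D%:R = 0.
Proof. by have := @int_unit D; rewrite -lt0n => /(_ D0). Qed.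

(* Applying E to a separable residual equation Q(u) = 0 (mod v > 0)
   improves any lower bound for v(E x) - v(x) by one. *)
Lemma E_log_step (k : nat) :
  (forall x, x != 0 -> vge v (v x - k.+1%:Z) (E x)) ->
  forall x, x != 0 -> vge v (v x - k%:Z) (E x).
Proof.
move=> Hk x x0; have [u0 vu du] := unit_partP x0; set u := unit_part x in u0 vu du.
have [Q [QO Qu Q'0 Q'u]] := residue_poly u0 vu.
have EQ : vge v (- k%:Z) (E (map_poly phi Q).[u]).
  have [->|Qu0] := eqVneq (map_poly phi Q).[u] 0; first by rewrite E0 vge0.
  by apply: vgeW (Hk _ Qu0); move: Qu; rewrite vge_neq0 //; lia.
have k1 : - k%:Z <= 1 by lia.
have := dlog_bound k1 u0 vu QO EQ Q'0 Q'u.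
move=> /(dlog_unit_part k1 x0) H.
have [Dn0 vD] := D_unit.
rewrite E_dlog // vge_mull // addrAC subrr add0r.
rewrite -[- _]subr0 -vD -vge_mull //.
rewrite -[_ * _](subrK (v x)%:~R); apply: vgeD => //.
by apply: vgeW (vge_int _); lia.
Qed.

(** [E_bounded], applied to unit parts, gives the estimate with some loss N; [E_log_step] is then
    applied N times. *)
Lemma E_log x : x != 0 -> vge v (v x) (E x).
Proof.
have [N HN] := E_bounded.
have : forall x, x != 0 -> vge v (v x - N%:Z) (E x).
  move=> {}x x0; have [u0 vu du] := unit_partP x0.
  have [Dn0 vD] := D_unit.
  rewrite E_dlog // vge_mull // addrAC subrr add0r.
  rewrite -[- _]subr0 -vD -vge_mull //.
  rewrite -[_ * _](subrK (v x)%:~R) -du; apply: vgeD => //; last first.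
    by apply: vgeW (vge_int _); lia.
  suff : vge v (- N%:Z) (unit_part x * dlog (unit_part x)) by rewrite vge_mull // vu subr0.
  by rewrite -E_dlog //; apply: HN; rewrite vge_neq0 // vu.
elim: N {HN} => [|k IH] H x0; first by have := H _ x0; rewrite subr0.
by apply: IH => // y y0; apply: E_log_step H _ y0.
Qed.

(** By [E_log], E(Q(u)) has value at least 1 like Q(u), so D E(x)/x is congruent to v(x) modulo
    elements of positive value. The nonzero integers v(x) and D are units, hence E(x)/x has value
    0. *)
Theorem E_val x : x != 0 -> v x != 0 -> E x != 0 /\ v (E x) = v x.
Proof.
move=> x0 vx0; have [u0 vu du] := unit_partP x0; set u := unit_part x in u0 vu du.
have [Q [QO Qu Q'0 Q'u]] := residue_poly u0 vu.
have EQ : vge v 1 (E (map_poly phi Q).[u]).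
  have [->|Qu0] := eqVneq (map_poly phi Q).[u] 0; first by rewrite E0 vge0.
  by apply: vgeW (E_log Qu0); move: Qu; rewrite vge_neq0.
have := dlog_bound (lexx 1) u0 vu QO EQ Q'0 Q'u.
move=> /(dlog_unit_part (lexx 1) x0) H.
have [Dn0 vD] := D_unit; have [w0 vw] := int_unit vx0.
have [] := valD_lt vv w0 (_ : vge v (v (v x)%:~R + 1) (D%:R * dlog x - (v x)%:~R)).
  by rewrite vw add0r.
rewrite addrC subrK vw => dx0.
have dl0 : dlog x != 0 by apply: contraNneq dx0 => ->; rewrite mulr0.
rewrite valM // vD add0r => vdl.
by rewrite E_dlog // mulf_neq0 // valM // vdl addr0.
Qed.

End LogDerivation.

(** * Formal power series *)

Section SeriesBasics.
Variables (n : nat) (k : comNzRingType).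
Implicit Types (f g h : mps n k) (a b m : multinom n).

Lemma mpsD_coef f g m : (f + g) m = f m + g m. Proof. by []. Qed.
Lemma mps1_coef m : (1 : mps n k) m = (m == @mnm0 n)%:R. Proof. by []. Qed.
Lemma mpsN_coef f m : (- f) m = - f m. Proof. by []. Qed.
Lemma mpsB_coef f g m : (f - g) m = f m - g m. Proof. by []. Qed.

Lemma mps_sum_coef (I : Type) (r : seq I) (P : pred I) (F : I -> mps n k) m :
  (\sum_(i <- r | P i) F i) m = \sum_(i <- r | P i) F i m.
Proof. by elim/big_rec2: _ => // i y1 y2 _ <-. Qed.

Lemma mpsM_coef f g m :
  (f * g) m = \sum_(b : bmultinom n (mdeg m).+1 | lem b m) f b * g (mnm_sub m b).
Proof.
rewrite [LHS]/=.
rewrite -(pair_big_dep xpredT (fun b1 b2 : bmultinom n (mdeg m).+1 => m == mnm_add b1 b2)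
  (fun b1 b2 : bmultinom n (mdeg m).+1 => f b1 * g b2)) /=.
rewrite [RHS]big_mkcond; apply: eq_bigr => b1 _.
case: ifP => bm.
  have dm : (mdeg (mnm_sub m b1) < (mdeg m).+1)%N by rewrite ltnS mdegB.
  rewrite (big_pred1 (BMultinom dm)) // => b2 /=.
  apply/eqP/eqP => [mE|->]; last by rewrite /= addmC submK.
  by apply: val_inj; rewrite /= {2}mE addmC addmK.
rewrite big1 // => b2 /eqP mE; exfalso; move/negP: bm; apply.
by rewrite [X in lem _ X]mE lem_addr.
Qed.

Definition mpsM_term m f : mps n k :=
  Mps (fun b => if lem m b then f (mnm_sub b m) else 0).

Definition mpsXm m : mps n k := Mps (fun b => (b == m)%:R).

Lemma mpsXmM m f : mpsXm m * f = mpsM_term m f.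
Proof.
apply: mpsP => b; rewrite mpsM_coef /=; case: ifP => mb; last first.
  rewrite big1 // => c cb; case: eqP => [cm|_]; last by rewrite mul0r.
  by move: cb; rewrite cm mb.
have dm : (mdeg m < (mdeg b).+1)%N by rewrite ltnS -(submK mb) mdegD leq_addl.
rewrite (bigD1 (BMultinom dm)) //= eqxx mul1r big1 ?addr0 // => c /andP[_ cm].
by rewrite (_ : val c == m = false) ?mul0r //; apply/negbTE; rewrite -val_eqE in cm.
Qed.

Lemma mpsXmD m m' : mpsXm (mnm_add m m') = mpsXm m * mpsXm m'.
Proof.
rewrite mpsXmM; apply: mpsP => b /=; case: ifP => mb.
  by rewrite -{1}(submK mb) addmC eqm_add2l.
by case: eqP => // bE; move: mb; rewrite bE lem_addr.
Qed.

Lemma mpsX_Xm i : @mpsX n k i = mpsXm (mnm1 i). Proof. by []. Qed.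

Lemma mpsXX i N : @mpsX n k i ^+ N = mpsXm (mnm_muln (mnm1 i) N).
Proof.
elim: N => [|N IH]; first by rewrite expr0 mulm0n.
by rewrite exprS IH mulmS mpsXmD.
Qed.

Definition mpsC (c : k) : mps n k := Mps (fun b => if b == @mnm0 n then c else 0).

Lemma mpsC_mul c f m : (mpsC c * f) m = c * f m.
Proof.
rewrite mpsM_coef.
rewrite (bigD1 bm0) /=; last by apply/mnm_lepP => i; rewrite mnm0E.
rewrite eqxx subm0 big1 ?addr0 // => b /andP[_ b0].
by rewrite (_ : val b == @mnm0 n = false) ?mul0r //; apply/negbTE; rewrite -val_eqE in b0.
Qed.

Definition vanish d f := forall m, (mdeg m < d)%N -> f m = 0.

Lemma vanish0 f : vanish 0 f. Proof. by []. Qed.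

Lemma vanish_zero d : vanish d 0. Proof. by []. Qed.
Lemma vanishW d d' f : (d' <= d)%N -> vanish d f -> vanish d' f.
Proof. by move=> dd Hf m md; apply: Hf; apply: leq_trans dd. Qed.

Lemma vanishD d f g : vanish d f -> vanish d g -> vanish d (f + g).
Proof. by move=> Hf Hg m md; rewrite mpsD_coef Hf // Hg // addr0. Qed.
Lemma vanishN d f : vanish d f -> vanish d (- f).
Proof. by move=> Hf m md; rewrite mpsN_coef Hf // oppr0. Qed.

Lemma vanishB d f g : vanish d f -> vanish d g -> vanish d (f - g).
Proof. by move=> Hf Hg; apply: vanishD => //; apply: vanishN. Qed.

Lemma vanish_sum d (I : Type) (r : seq I) (P : pred I) (F : I -> mps n k) :
  (forall i, P i -> vanish d (F i)) -> vanish d (\sum_(i <- r | P i) F i).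
Proof. by move=> HF; elim/big_ind: _ => //; apply: vanishD. Qed.

Lemma vanishM d d' f g : vanish d f -> vanish d' g -> vanish (d + d') (f * g).
Proof.
move=> Hf Hg m md; rewrite mpsM_coef big1 // => b bm.
have [bd|db] := ltnP (mdeg b) d; first by rewrite Hf // mul0r.
rewrite Hg ?mulr0 //.
by have := mdegD (mnm_sub m b) b; rewrite submK //; lia.
Qed.

Lemma vanishMl d f g : vanish d g -> vanish d (f * g).
Proof. by move=> Hg; rewrite -[d]add0n; apply: vanishM. Qed.

Lemma vanishX d f p : vanish d f -> vanish (p * d) (f ^+ p).
Proof.
move=> Hf; elim: p => [|p IH]; first exact: vanish0.
by rewrite exprS mulSn; apply: vanishM.
Qed.

Lemma vanish_eq0 f : (forall d, vanish d f) -> f = 0.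
Proof. by move=> Hf; apply: mpsP => m; apply: (Hf (mdeg m).+1). Qed.

Lemma vanish_at0 f : mps_at0 f = 0 -> vanish 1 f.
Proof.
move=> f0 m; rewrite ltnS leqn0 mdeg_eq0 => /eqP->; exact: f0.
Qed.

Lemma vanish_mpsX i : vanish 1 (@mpsX n k i).
Proof. by apply: vanish_at0; rewrite /mps_at0 /= eq_sym mnm1_eq0. Qed.

(** A monomial outside the box has some exponent at least N; it is charged to the index returned by
    [pick], so that each monomial is divided once. *)
Lemma mps_division N f : (forall m, (forall j, (m j < N)%N) -> f m = 0) ->
  exists q : 'I_n -> mps n k, f = \sum_j mpsX k j ^+ N * q j /\
    forall d, vanish d f -> forall j, vanish (d - N) (q j).
Proof.
move=> boxf.
pose first m : option 'I_n := [pick j | (N <= m j)%N].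
pose q j : mps n k := Mps (fun m =>
  let m' := mnm_add m (mnm_muln (mnm1 j) N) in if first m' == Some j then f m' else 0).
exists q; split; last first.
  move=> d fd j m md /=; case: ifP => // _; apply: fd.
  by rewrite mdegD mdegMn mdeg1 mul1n; lia.
apply: mpsP => m; rewrite mps_sum_coef.
under eq_bigr do rewrite mpsXX mpsXmM /=.
have lemE j : lem (mnm_muln (mnm1 j) N) m = (N <= m j)%N.
  apply/mnm_lepP/idP => [/(_ j)|Nm i].
    by rewrite mulmnE mnm1E eqxx mul1n.
  by rewrite mulmnE mnm1E; case: eqP => [<-|_]; rewrite ?mul1n ?mul0n.
case fm : (first m) => [j0|]; last first.
  have mN j : (m j < N)%N.
    by move: fm; rewrite /first; case: pickP => // H _; rewrite ltnNge; apply/negbT/H.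
  by rewrite boxf // big1 // => j _; rewrite lemE leqNgt mN.
have Nm : (N <= m j0)%N by move: fm; rewrite /first; case: pickP => // j Nmj [<-].
rewrite (bigD1 j0) //= lemE Nm submK ?lemE // fm eqxx big1 ?addr0 // => j jj0.
rewrite lemE; case: ifP => // Nmj; rewrite submK ?lemE // fm.
by rewrite (inj_eq Some_inj) eq_sym (negPf jj0).
Qed.

Lemma vanish_division d f : vanish d.+1 f ->
  exists q : 'I_n -> mps n k, f = \sum_j mpsX k j * q j /\ forall j, vanish d (q j).
Proof.
move=> fd; have [|q [fE qd]] := @mps_division 1 f.
  move=> m m0; apply: fd; rewrite (_ : m = @mnm0 n) ?mdeg0 //.
  by apply/mnmP => j; rewrite mnm0E; have := m0 j; lia.
exists q; split; first by rewrite fE; apply: eq_bigr => j _; rewrite expr1.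
by move=> j; have := qd _ fd j; rewrite subn1.
Qed.

End SeriesBasics.

Section Domain.
Variables (n : nat) (k : fieldType).
Implicit Types (f g h : mps n k) (a b m : multinom n).

(** The order on exponents is graded, so [mdeg a] is the order of [f]; being a well-order compatible
    with addition, it makes initial exponents add in products. *)
Definition initial f a := f a != 0 /\ forall b, (b < a)%O -> f b = 0.

Lemma exists_initial f : f <> 0 -> exists a, initial f a.
Proof.
move=> f0.
have [m fm] : exists m, f m != 0.
  apply: contrapT => nex; apply: f0; apply: mpsP => m; apply/eqP.
  by apply: contrapT => /negP fm; apply: nex; exists m.
elim/(well_founded_ind (@ltom_wf n)): m fm => m IH fm.
have [Hb|] := pselect (forall b, (b < m)%O -> f b = 0); first by exists m.
by move=> /existsNP[b /not_implyP[bm /eqP fb]]; apply: (IH b).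
Qed.

Lemma initialM f g a b : initial f a -> initial g b ->
  (f * g) (mnm_add a b) = f a * g b /\ forall c, (c < mnm_add a b)%O -> (f * g) c = 0.
Proof.
move=> [fa fa'] [gb gb'].
have zero c l : (c <= mnm_add a b)%O -> lem l c -> (l != a) || (c != mnm_add a b) ->
    f l * g (mnm_sub c l) = 0.
  move=> cab lc ne; have [la|al] := ltP l a; first by rewrite fa' // mul0r.
  rewrite [X in _ * X]gb' ?mulr0 //.
  rewrite ltNge; apply/negP => bc.
  have := lem_add al bc; rewrite [mnm_add l _]addmC submK // => abc.
  have cE : c = mnm_add a b by apply/eqP; rewrite eq_le cab abc.
  move: ne; rewrite cE eqxx orbF => ne.
  have {}al : (a < l)%O by rewrite lt_neqAle eq_sym ne.
  have := ltmc_le_add al bc; rewrite [mnm_add l _]addmC submK // cE ltxx //.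
split=> [|c cab]; last first.
  rewrite mpsM_coef big1 // => l lc; apply: zero => //; first exact: ltW.
  by rewrite (lt_eqF cab) orbT.
rewrite mpsM_coef.
have da : (mdeg a < (mdeg (mnm_add a b)).+1)%N by rewrite mdegD ltnS leq_addr.
rewrite (bigD1 (BMultinom da)) /=; last exact: lem_addr.
rewrite [mnm_sub (mnm_add a b) a](_ : _ = b); last by rewrite addmC addmK.
rewrite big1 ?addr0 // => l /andP[lab la]; apply: zero => //.
by rewrite -val_eqE in la; rewrite la.
Qed.

Lemma initial_mul f g a b : initial f a -> initial g b -> initial (f * g) (mnm_add a b).
Proof.
move=> fa gb; have [E H] := initialM fa gb; split=> //.
by rewrite E mulf_neq0 //; [case: fa|case: gb].
Qed.

Lemma initial_neq0 f a : initial f a -> f <> 0.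
Proof. by case=> + _ f0; rewrite f0 /= eqxx. Qed.

Lemma mps_domain f g : f * g = 0 -> f = 0 \/ g = 0.
Proof.
move=> fg; have [->|f0] := pselect (f = 0); first by left.
right; apply: contrapT => g0.
have [a fa] := exists_initial f0; have [b gb] := exists_initial g0.
by have := initial_neq0 (initial_mul fa gb); apply.
Qed.

Lemma initial_uniq f a b : initial f a -> initial f b -> a = b.
Proof.
move=> [fa fa'] [fb fb']; case: (ltgtP a b) => // [ab|ba].
  by move: fa; rewrite fb' // eqxx.
by move: fb; rewrite fa' // eqxx.
Qed.

Lemma initial_vanish f a d : initial f a -> vanish d f -> (d <= mdeg a)%N.
Proof.
move=> [fa _] fd; rewrite leqNgt; apply/negP => ad.
by move: fa; rewrite fd // eqxx.
Qed.

Lemma vanish_initial f a : initial f a -> vanish (mdeg a) f.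
Proof. by move=> [_ fa] m ma; apply: fa; apply: lt_mdeg_ltmc. Qed.

Lemma initialX f a N : initial f a -> initial (f ^+ N) (mnm_muln a N).
Proof.
move=> fa; elim: N => [|N IH].
  rewrite expr0 mulm0n; split; first by rewrite mps1_coef eqxx oner_neq0.
  by move=> b; rewrite ltNge le0m.
by rewrite exprS mulmS; apply: initial_mul.
Qed.

End Domain.

(** * Fraction fields and the structures that extend to them *)

Section Fractions.
Variable A : comNzRingType.
Hypothesis domA : forall x y : A, x * y = 0 -> x = 0 \/ y = 0.

(** A copy of [A] indexed by the proof, so that instances depending on [domA] can be attached to a
    type. *)
Definition domain_of (_ : forall x y : A, x * y = 0 -> x = 0 \/ y = 0) : Type := A.
Local Notation T := (domain_of domA).

HB.instance Definition _ := GRing.ComNzRing.on T.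

Let unit_T : {pred T} := fun x => `[< exists y : T, y * x = 1 >].
Let inv_T (x : T) : T := if unit_T x then xget 0 [set y | y * x = 1] else x.

Fact mulV_T : {in unit_T, left_inverse 1 inv_T *%R}.
Proof.
move=> x ux; have {}ux : unit_T x by []; rewrite /inv_T ux.
move: ux => /asboolP[y yx].
by apply: (@xgetPex _ 0 [set y | y * x = 1]); exists y.
Qed.

Fact unitP_T (x y : T) : y * x = 1 -> unit_T x.
Proof. by move=> yx; apply/asboolP; exists y. Qed.

Fact invr_out_T : {in [predC unit_T], inv_T =1 id}.
Proof. by move=> x ux; have {}ux : ~~ unit_T x by []; rewrite /inv_T (negPf ux). Qed.

HB.instance Definition _ := GRing.ComNzRing_hasMulInverse.Build T mulV_T unitP_T invr_out_T.

Fact integral_T : GRing.integral_domain_axiom T.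
Proof.
move=> x y xy; apply/orP; have [->|->] := domA xy; first by left.
by right.
Qed.

HB.instance Definition _ := GRing.ComUnitRing_isIntegral.Build T integral_T.

Lemma exists_fraction_field : exists (L : fieldType) (iota : {rmorphism A -> L}),
  injective iota /\ forall z, exists a b, b <> 0 /\ z = iota a / iota b.
Proof.
exists {fraction T}, (@FracField.tofrac T : {rmorphism T -> {fraction T}}); split.
  by move=> x y /eqP; rewrite tofrac_eq => /eqP.
elim/quotW => x; exists (frac x).1, (frac x).2.
have d0 := denom_ratioP x.
split; first by move=> H; move: d0; rewrite H; case/eqP.
have d0' : FracField.tofrac (frac x).2 != 0 :> {fraction T} by rewrite tofrac_eq0.
apply: (mulIf d0'); rewrite divfK //.
suff H : FracField.mul (\pi_({fraction T})%qT x) (FracField.tofrac (frac x).2) =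
   FracField.tofrac (frac x).1 by exact: H.
apply/eqP; rewrite !piE /= FracField.equivfE /FracField.mulf !numden_Ratio ?oner_eq0 ?mulf_neq0 ?oner_eq0 //.
by rewrite !mulr1 mulrC.
Qed.

End Fractions.

Section FractionExtensions.
Variables (A : comNzRingType) (L : fieldType) (iota : {rmorphism A -> L}).
Hypothesis iota_inj : injective iota.
Hypothesis fracP : forall z, exists a b, b <> 0 /\ z = iota a / iota b.

Lemma iota_neq0 a : a <> 0 -> iota a != 0.
Proof. by move=> a0; apply/eqP => H; apply: a0; apply: iota_inj; rewrite H rmorph0. Qed.

Lemma domM_neq0 (a b : A) : a <> 0 -> b <> 0 -> a * b <> 0.
Proof.
move=> /iota_neq0 a0 /iota_neq0 b0 ab.
by move: (mulf_neq0 a0 b0); rewrite -rmorphM ab rmorph0 eqxx.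
Qed.

Lemma frac_extension (T : Type) (f : A -> A -> T) :
  (forall a b a' b', b <> 0 -> b' <> 0 -> a * b' = a' * b -> f a b = f a' b') ->
  exists g : L -> T, forall a b, b <> 0 -> g (iota a / iota b) = f a b.
Proof.
move=> fE.
have /choice[num Hnum] : forall z, exists ab : A * A, ab.2 <> 0 /\ z = iota ab.1 / iota ab.2.
  by move=> z; have [a [b H]] := fracP z; exists (a, b).
exists (fun z => f (num z).1 (num z).2) => a b b0.
have [nb0 E] := Hnum (iota a / iota b).
apply: fE => //; apply: iota_inj; rewrite !rmorphM.
have ib := iota_neq0 b0; have inb := iota_neq0 nb0.
by apply/eqP; rewrite -eqr_div //; apply/eqP.
Qed.

Lemma frac_rmorphism (L' : fieldType) (psi : {rmorphism A -> L'}) : injective psi ->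
  exists phi : {rmorphism L -> L'}, forall a, phi (iota a) = psi a.
Proof.
move=> psi_inj.
have psi0 a : a <> 0 -> psi a != 0.
  by move=> a0; apply/eqP => H; apply: a0; apply: psi_inj; rewrite H rmorph0.
have [|f fE] := @frac_extension L' (fun a b => psi a / psi b).
  move=> a b a' b' b0 b'0 E; have pb := psi0 _ b0; have pb' := psi0 _ b'0.
  by apply/eqP; rewrite eqr_div // -!rmorphM E.
have fA : GRing.zmod_morphism f.
  move=> x y; have [a [b [b0 ->]]] := fracP x; have [a' [b' [b'0 ->]]] := fracP y.
  have pb := psi0 _ b0; have pb' := psi0 _ b'0.
  have ib := iota_neq0 b0; have ib' := iota_neq0 b'0.
  have -> : iota a / iota b - iota a' / iota b' = iota (a * b' - a' * b) / iota (b * b').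
    by rewrite !(rmorphB, rmorphM); field; rewrite ib ib'.
  rewrite !fE //; last exact: domM_neq0.
  by rewrite !(rmorphB, rmorphM); field; rewrite pb pb'.
have fM : GRing.monoid_morphism f.
  split.
    by rewrite -[1](divr1 1) -(rmorph1 iota) fE ?rmorph1 ?divr1 //; apply/eqP/oner_neq0.
  move=> x y; have [a [b [b0 ->]]] := fracP x; have [a' [b' [b'0 ->]]] := fracP y.
  rewrite mulrACA -invfM -!rmorphM !fE //; last exact: domM_neq0.
  by rewrite mulrACA -invfM -!rmorphM.
pose mA := GRing.isZmodMorphism.Build L L' f fA.
pose mM := GRing.isMonoidMorphism.Build L L' f fM.
pose phi : {rmorphism L -> L'} := HB.pack f mA mM.
exists phi => a.
have o0 : (1 : A) <> 0 by apply/eqP/oner_neq0.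
have -> : iota a = iota a / iota 1 by rewrite rmorph1 divr1.
by change (f (iota a / iota 1) = psi a); rewrite fE // rmorph1 divr1.
Qed.

Lemma frac_derivation (D : A -> A) :
  (forall x y, D (x + y) = D x + D y) -> (forall x y, D (x * y) = D x * y + x * D y) ->
  exists D' : L -> L, [/\ forall a, D' (iota a) = iota (D a),
    forall x y, D' (x + y) = D' x + D' y & forall x y, D' (x * y) = D' x * y + x * D' y].
Proof.
move=> DD DM.
have [|f fE] := @frac_extension L (fun a b => (iota (D a) * iota b - iota a * iota (D b)) / iota b ^+ 2).
  move=> a b a' b' b0 b'0 E; have ib := iota_neq0 b0; have ib' := iota_neq0 b'0.
  have E1 : iota a' = iota a * iota b' / iota b.
    by rewrite -rmorphM E rmorphM mulfK.
  have : iota (D (a * b')) = iota (D (a' * b)) by rewrite E.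
  rewrite !DM !(rmorphD, rmorphM) => E2.
  have E3 : iota (D a') = (iota (D a) * iota b' + iota a * iota (D b') - iota a' * iota (D b)) / iota b.
    by rewrite E2 addrK mulfK.
  by rewrite E3 E1; field; rewrite ib ib'.
exists f; split.
- move=> a; have o0 : (1 : A) <> 0 by apply/eqP/oner_neq0.
  have D1 : D 1 = 0.
    by apply: (addrI (D 1)); rewrite addr0 -{3}[1]mulr1 DM !mulr1 mul1r.
  have -> : iota a = iota a / iota 1 by rewrite rmorph1 divr1.
  by rewrite fE // D1 rmorph0 rmorph1 mulr0 subr0 expr1n divr1 mulr1.
- move=> x y; have [a [b [b0 ->]]] := fracP x; have [a' [b' [b'0 ->]]] := fracP y.
  have ib := iota_neq0 b0; have ib' := iota_neq0 b'0.
  have -> : iota a / iota b + iota a' / iota b' = iota (a * b' + a' * b) / iota (b * b').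
    by rewrite !(rmorphD, rmorphM); field; rewrite ib ib'.
  rewrite !fE //; last exact: domM_neq0.
  rewrite !(DD, DM) !(rmorphD, rmorphM).
  by field; rewrite ib ib'.
- move=> x y; have [a [b [b0 ->]]] := fracP x; have [a' [b' [b'0 ->]]] := fracP y.
  have ib := iota_neq0 b0; have ib' := iota_neq0 b'0.
  have -> : iota a / iota b * (iota a' / iota b') = iota (a * a') / iota (b * b').
    by rewrite !rmorphM; field; rewrite ib ib'.
  rewrite !fE //; last exact: domM_neq0.
  rewrite !DM !(rmorphD, rmorphM).
  by field; rewrite ib ib'.
Qed.

Lemma frac_valuation (ord : A -> nat) :
  (forall a b, a <> 0 -> b <> 0 -> ord (a * b) = (ord a + ord b)%N) ->
  (forall a b, a <> 0 -> b <> 0 -> a + b <> 0 -> (ord a <= ord (a + b)%R)%N \/ (ord b <= ord (a + b)%R)%N) ->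
  exists nu : L -> int, int_valuation nu /\ forall a, a <> 0 -> nu (iota a) = (ord a)%:Z.
Proof.
move=> ordM ordD.
have [|f fE] := @frac_extension int (fun a b => if `[< a = 0 >] then 0 else (ord a)%:Z - (ord b)%:Z).
  move=> a b a' b' b0 b'0 E.
  have [a0|a0] := pselect (a = 0).
    have a'0 : a' = 0.
      apply: contrapT => a'0; apply: (domM_neq0 a'0 b0).
      by rewrite -E a0 mul0r.
    by rewrite !asboolT.
  have a'0 : a' <> 0.
    by move=> a'0; apply: (domM_neq0 a0 b'0); rewrite E a'0 mul0r.
  rewrite !asboolF //.
  by have := congr1 ord E; rewrite !ordM //; lia.
have iota0 a b : b <> 0 -> iota a / iota b != 0 -> a <> 0.
  by move=> b0 + a0; rewrite a0 rmorph0 mul0r eqxx.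
have fE' a b : b <> 0 -> a <> 0 -> f (iota a / iota b) = (ord a)%:Z - (ord b)%:Z.
  by move=> b0 a0; rewrite fE // asboolF.
exists f; split; first split.
- move=> x y; have [a [b [b0 ->]]] := fracP x; have [a' [b' [b'0 ->]]] := fracP y.
  move=> /iota0 -/(_ b0) a0 /iota0 -/(_ b'0) a'0.
  rewrite mulrACA -invfM -!rmorphM !fE' //; try exact: domM_neq0.
  by rewrite !ordM //; lia.
- move=> x y; have [a [b [b0 ->]]] := fracP x; have [a' [b' [b'0 ->]]] := fracP y.
  move=> /iota0 -/(_ b0) a0 /iota0 -/(_ b'0) a'0.
  have ib := iota_neq0 b0; have ib' := iota_neq0 b'0.
  have -> : iota a / iota b + iota a' / iota b' = iota (a * b' + a' * b) / iota (b * b').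
    by rewrite !(rmorphD, rmorphM); field; rewrite ib ib'.
  have bb0 := domM_neq0 b0 b'0.
  move=> /iota0 -/(_ bb0) s0.
  rewrite !fE' //.
  have := ordD _ _ (domM_neq0 a0 b'0) (domM_neq0 a'0 b0) s0.
  have := ordM _ _ a0 b'0; have := ordM _ _ a'0 b0; have := ordM _ _ b0 b'0.
  by move=> E1 E2 E3 [H|H]; apply/orP; [left|right]; move: H; rewrite E1 ?E2 ?E3; move: (ord (a * b' + a' * b)) => s; lia.
- move=> a a0; have o0 : (1 : A) <> 0 by apply/eqP/oner_neq0.
  have ord1 : ord 1 = 0%N by have := ordM _ _ o0 o0; rewrite mulr1; lia.
  have -> : iota a = iota a / iota 1 by rewrite rmorph1 divr1.
  by rewrite fE' // ord1 subr0.
Qed.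

End FractionExtensions.

Lemma scaled_powers_sub (A : comNzRingType) (c q p h : A) :
  (forall N, exists g, c * p ^+ N = q ^+ N * g) ->
  forall N, exists g, c * (p - q * h) ^+ N = q ^+ N * g.
Proof.
move=> /choice[g gE] N.
exists (\sum_(i < N.+1) g (N - i)%N * ((- h) ^+ i) *+ 'C(N, i)).
rewrite -mulrN exprDn !mulr_sumr; apply: eq_bigr => i _.
rewrite !mulrnAr; congr (_ *+ _).
by rewrite [LHS]mulrA gE exprMn [LHS]mulrACA -exprD subnK // -ltnS.
Qed.

(** * Almost integral fractions of power series *)

Section Normality.
Variables (n : nat) (k : fieldType).
Implicit Types (f g h p q : mps n k) (a b m : multinom n).

Lemma vanish_initialP f a d : initial f a -> vanish d f <-> (d <= mdeg a)%N.
Proof.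
move=> fa; split; first exact: initial_vanish fa.
by move=> da; apply: vanishW da (vanish_initial fa).
Qed.

Lemma vanish_cancel q b d g : initial q b -> vanish (d + mdeg b) (q * g) -> vanish d g.
Proof.
move=> qb; have [->|g0] := pselect (g = 0); first by move=> _; apply: vanish_zero.
have [e ge] := exists_initial g0.
move/(initial_vanish (initial_mul qb ge)); rewrite mdegD => H.
by apply/(vanish_initialP _ ge); lia.
Qed.

Variables (q c : mps n k) (b e : multinom n).
Hypotheses (qb : initial q b) (ce : initial c e).

Definition almost_multiple p := forall N, exists h, c * p ^+ N = q ^+ N * h.

Lemma almost_multiple_sub p h : almost_multiple p -> almost_multiple (p - q * h).
Proof. exact: scaled_powers_sub. Qed.

(** Comparing initial exponents in c p^N = q^N h gives N b_j <= e_j + N a_j; the choice N = e_j + 1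
    forces b_j <= a_j. *)
Lemma almost_multiple_initial p a : almost_multiple p -> initial p a -> lem b a.
Proof.
move=> Pp pa; apply/mnm_lepP => j.
have [h hE] := Pp (e j).+1.
have cp := initial_mul ce (initialX (e j).+1 pa).
have h0 : h <> 0.
  by move=> h0; apply: (initial_neq0 cp); rewrite hE h0 mulr0.
have [g hg] := exists_initial h0.
have qh := initial_mul (initialX (e j).+1 qb) hg.
have := initial_uniq cp; rewrite hE => /(_ _ qh)/(congr1 (fun m : multinom n => m j)).
rewrite !mnmDE !mulmnE; nia.
Qed.

Lemma almost_multiple_step p a : almost_multiple p -> initial p a ->
  exists h, forall m, (m <= a)%O -> (p - q * h) m = 0.
Proof.
move=> Pp pa; have ba := almost_multiple_initial Pp pa.
case: (pa) => pa0 pa1; case: (qb) => qb0 qb1.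
have E m : (mpsXm k (mnm_sub a b) * q) m =
    if lem (mnm_sub a b) m then q (mnm_sub m (mnm_sub a b)) else 0 by rewrite mpsXmM.
exists (mpsC n (p a / q b) * mpsXm k (mnm_sub a b)) => m ma.
rewrite mpsB_coef [q * _]mulrC -mulrA mpsC_mul E.
move: ma; rewrite le_eqVlt => /orP[/eqP->|ma].
  by rewrite lem_subr submBA // addmC addmK divfK // subrr.
rewrite (pa1 _ ma); case: ifP => am; last by rewrite mulr0 subrr.
rewrite (qb1 (mnm_sub m (mnm_sub a b))) ?mulr0 ?subrr //.
by rewrite -(ltmc_add2l _ _ (mnm_sub a b)) submK // addmC submK.
Qed.

Lemma almost_multiple_approx d p : almost_multiple p -> exists h, vanish d (p - q * h).
Proof.
(* [S p] lists the exponents of degree below d from the initial one upward; a division step raises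
   the initial exponent, so the list shrinks. *)
pose S p := [set m : bmultinom n d | `[< exists b, (b <= bmnm m)%O /\ p b != 0 >]]%SET.
have [s] := ubnP #|S p|; elim: s p => // s IH p ps Pp.
have [vp|nvp] := pselect (vanish d p).
  by exists 0; rewrite mulr0 subr0.
have p0 : p <> 0 by move=> p0; apply: nvp; rewrite p0.
have [a pa] := exists_initial p0.
have ad : (mdeg a < d)%N.
  by rewrite ltnNge; apply/negP => da; apply: nvp; apply/(vanish_initialP _ pa).
have [h hE] := almost_multiple_step Pp pa.
have [||h' h'E] := IH (p - q * h).
- rewrite ltnS in ps; apply: leq_trans ps; apply: proper_card; apply/properP; split.
    apply/fintype.subsetP => m; rewrite !finset.in_set => /asboolP[b' [b'm pb']].
    apply/asboolP; exists a; split; last by case: pa.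
    apply: le_trans b'm; rewrite leNgt; apply/negP => b'a.
    by move: pb'; rewrite hE ?eqxx // ltW.
  exists (BMultinom ad); rewrite finset.in_set; first by apply/asboolP; exists a; split=> //; case: pa.
  by apply/negP => /asboolP[b' [b'a]]; rewrite hE ?eqxx.
- exact: almost_multiple_sub.
by exists (h + h'); rewrite mulrDr opprD addrA.
Qed.

(* Complete integral closure: p / q is a power series when c (p / q)^N is one for
   all N. *)
Lemma almost_multiple_dvd p : almost_multiple p -> exists h, p = q * h.
Proof.
move=> Pp; have /choice[h hE] : forall d, exists h, vanish d (p - q * h).
  by move=> d; apply: almost_multiple_approx.
(* Cancelling q costs [mdeg b] orders, so the quotients approximating to order [d + mdeg b] agree
   below degree d; each coefficient of [H] is read off once it is stable. *)
pose H : mps n k := Mps (fun m => h ((mdeg m).+1 + mdeg b)%N m).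
have coh d d' : (d <= d')%N -> vanish d (h (d + mdeg b)%N - h (d' + mdeg b)%N).
  move=> dd'; apply: (vanish_cancel qb).
  have -> : q * (h (d + mdeg b)%N - h (d' + mdeg b)%N) =
     (p - q * h (d' + mdeg b)%N) - (p - q * h (d + mdeg b)%N).
    by rewrite mulrBr opprB [RHS]addrC addrA subrK.
  by apply: vanishB => //; apply: vanishW (hE _); rewrite leq_add2r.
exists H; apply/eqP; rewrite -subr_eq0; apply/eqP; apply: vanish_eq0 => d.
have -> : p - q * H = (p - q * h (d + mdeg b)%N) + q * (h (d + mdeg b)%N - H).
  by rewrite mulrBr addrA subrK.
apply: vanishD; first by apply: vanishW (hE _); rewrite leq_addr.
apply: vanishMl => m md; rewrite mpsB_coef /=.
apply/eqP; rewrite subr_eq0 eq_sym -subr_eq0; apply/eqP.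
exact: (coh (mdeg m).+1 d).
Qed.

End Normality.

(** * Substitution *)

Section Derivations.
Variables (n : nat) (k : comNzRingType).
Implicit Types (f g h : mps n k) (a b m : multinom n).

Lemma mpsC_zmod_morphism : GRing.zmod_morphism (@mpsC n k).
Proof.
by move=> x y; apply: mpsP => m; rewrite mpsB_coef /=; case: ifP => _ //; rewrite subr0.
Qed.

Lemma mpsC_monoid_morphism : GRing.monoid_morphism (@mpsC n k).
Proof.
split; first by apply: mpsP => m; rewrite mps1_coef /=; case: ifP.
move=> x y; apply: mpsP => m; rewrite mpsC_mul /=.
by case: ifP => _ //; rewrite mulr0.
Qed.

HB.instance Definition _ := GRing.isZmodMorphism.Build k (mps n k) (@mpsC n k) mpsC_zmod_morphism.
HB.instance Definition _ := GRing.isMonoidMorphism.Build k (mps n k) (@mpsC n k) mpsC_monoid_morphism.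

Lemma mps_derivD j f g : mps_deriv j (f + g) = mps_deriv j f + mps_deriv j g.
Proof. by apply: mpsP => m; rewrite /= mulrnDl. Qed.

Lemma mpsM_trunc d f g m : (mdeg m < d)%N ->
  (f * g) m = mcoeff m (mps_trunc d f * mps_trunc d g).
Proof. exact: mps_mulE. Qed.

Lemma mps_derivM j f g : mps_deriv j (f * g) = mps_deriv j f * g + f * mps_deriv j g.
Proof.
apply: mpsP => m; rewrite mpsD_coef.
pose d := (mdeg m).+2.
have dm : (mdeg m < d)%N by rewrite ltnS.
have dmj : (mdeg (mnm_add m (mnm1 j)) < d)%N by rewrite mdegD mdeg1 addn1.
change ((f * g) (mnm_add m (mnm1 j)) *+ (m j).+1 = (mps_deriv j f * g) m + (f * mps_deriv j g) m).
rewrite (mpsM_trunc _ _ dmj) !(mpsM_trunc _ _ dm).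
have trd u b : (mdeg b <= mdeg m)%N -> mcoeff b (mps_trunc d (mps_deriv j u)) =
    mcoeff b (mderiv j (mps_trunc d u)).
  move=> bm; rewrite mps_truncE ?mcoeff_deriv ?mps_truncE //.
    by rewrite mdegD mdeg1 addn1 ltnS.
  by rewrite ltnS; apply: leq_trans bm _.
rewrite -mcoeff_deriv mderivM mcoeffD.
by congr (_ + _); apply: mcoeffM_eq => // b bm; rewrite trd.
Qed.

Lemma mps_deriv_vanish j d f : vanish d.+1 f -> vanish d (mps_deriv j f).
Proof. by move=> fd m md; rewrite /= fd ?mul0rn // mdegD mdeg1 addn1. Qed.

Definition euler f : mps n k := \sum_j mpsX k j * mps_deriv j f.

Lemma euler_coef f m : euler f m = f m *+ mdeg m.
Proof.
rewrite mps_sum_coef mdegE -sumrMnr; apply: eq_bigr => j _.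
rewrite mpsX_Xm mpsXmM /=; case: ifP => jm.
  rewrite submK //; congr (_ *+ _).
  by rewrite mnmBE mnm1E eqxx; move: jm; rewrite lep1mP; lia.
by move/negbT: jm; rewrite lep1mP negbK => /eqP->.
Qed.

End Derivations.

Section Substitution.
Variables (n : nat) (k : comNzRingType) (f : 'I_n -> mps n k).
Hypothesis f1 : forall i, vanish 1 (f i).
Implicit Types (g h : mps n k) (m : multinom n) (p : mpoly n k).

Let ev p : mps n k := mmap (@mpsC n k) f p.

Lemma mmap1_vanish m : vanish (mdeg m) (mmap1 f m).
Proof.
rewrite /mmap1 mdegE; elim/big_rec2: _ => [|i d g _ gd]; first exact: vanish0.
by apply: vanishM => //; have := @vanishX _ _ _ _ (m i) (f1 i); rewrite muln1.
Qed.

Lemma mmap_vanish d p : (forall m, (mdeg m < d)%N -> mcoeff m p = 0) -> vanish d (ev p).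
Proof.
move=> pd; rewrite /ev /mmap; elim/big_ind: _ => //; first exact: vanishD.
move=> m _; have [md|dm] := ltnP (mdeg m) d.
  by rewrite pd // rmorph0 mul0r.
by apply: vanishMl; apply: (vanishW dm); apply: mmap1_vanish.
Qed.

(** No f_i has a constant term, so the coefficient at m depends only on the terms of g of degree at
    most [mdeg m], and polynomial substitution computes it. *)
Definition subst g : mps n k :=
  Mps (fun m => mmap (@mpsC n k) f (mps_trunc (mdeg m).+1 g) m).

Lemma subst_trunc d p g : (forall m, (mdeg m < d)%N -> mcoeff m p = g m) ->
  vanish d (subst g - ev p).
Proof.
move=> pg m md; rewrite mpsB_coef /subst /=.
have : vanish (mdeg m).+1 (ev (mps_trunc (mdeg m).+1 g - p)).
  apply: mmap_vanish => b bm; rewrite mcoeffB mps_truncE // pg ?subrr //.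
  by apply: leq_ltn_trans md.
rewrite /ev rmorphB => /(_ m); rewrite mpsB_coef; apply.
exact: ltnSn.
Qed.

Lemma subst_eq g h : (forall d, exists p, (forall m, (mdeg m < d)%N -> mcoeff m p = g m) /\
  vanish d (h - ev p)) -> subst g = h.
Proof.
move=> H; apply/eqP; rewrite -subr_eq0; apply/eqP; apply: vanish_eq0 => d.
have [p [pg ph]] := H d.
rewrite -(subrK (ev p) (subst g)) -addrA -[ev p - h]opprB.
by apply: vanishD; [apply: subst_trunc|apply: vanishN].
Qed.

Lemma mps_truncP d g m : (mdeg m < d)%N -> mcoeff m (mps_trunc d g) = g m.
Proof. exact: mps_truncE. Qed.

Lemma subst_zmod_morphism : GRing.zmod_morphism subst.
Proof.
move=> g h; apply: subst_eq => d; exists (mps_trunc d g - mps_trunc d h); split.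
  by move=> m md; rewrite mcoeffB !mps_truncE.
rewrite /ev rmorphB opprB addrACA addrC -opprB.
rewrite (_ : _ + _ = (subst g - ev (mps_trunc d g)) - (subst h - ev (mps_trunc d h))).
  by apply: vanishB; apply: subst_trunc => m; apply: mps_truncP.
by rewrite /ev; ring.
Qed.

Lemma subst_monoid_morphism : GRing.monoid_morphism subst.
Proof.
split.
  apply: subst_eq => d; exists 1; split; first by move=> m _; rewrite mcoeff1.
  by rewrite /ev rmorph1 subrr.
move=> g h; apply: subst_eq => d; exists (mps_trunc d g * mps_trunc d h); split.
  by move=> m md; rewrite (@mpsM_trunc _ _ d).
have Hg := subst_trunc (@mps_truncP d g); have Hh := subst_trunc (@mps_truncP d h).
rewrite (_ : _ - _ = subst g * (subst h - ev (mps_trunc d h)) +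
   ev (mps_trunc d h) * (subst g - ev (mps_trunc d g))).
  by apply: vanishD; apply: vanishMl.
by rewrite /ev rmorphM /=; ring.
Qed.

HB.instance Definition _ := GRing.isZmodMorphism.Build (mps n k) (mps n k) subst subst_zmod_morphism.
HB.instance Definition _ := GRing.isMonoidMorphism.Build (mps n k) (mps n k) subst subst_monoid_morphism.

Lemma subst_rmorph : exists sigma : {rmorphism mps n k -> mps n k}, sigma =1 subst.
Proof. by exists subst. Qed.

Lemma subst_mpsX i : subst (mpsX k i) = f i.
Proof.
apply: subst_eq => d; exists (mpolyX k (mnm1 i)); split.
  by move=> m _; rewrite mcoeffX /= eq_sym.
by rewrite /ev mmapX mmap1U subrr.
Qed.

Lemma subst_mpsC c : subst (mpsC n c) = mpsC n c.
Proof.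
apply: subst_eq => d; exists (mpolyC n c); split.
  by move=> m _; rewrite mcoeffC /=; case: (m == _); rewrite ?mulr1 ?mulr0.
by rewrite /ev mmapC subrr.
Qed.

Lemma subst_vanish d g : vanish d g -> vanish d (subst g).
Proof.
move=> gd; rewrite -[subst g]subr0 -(rmorph0 (mmap (@mpsC n k) f)).
by apply: subst_trunc => m md; rewrite mcoeff0 gd.
Qed.

Lemma subst_at0 g : mps_at0 (subst g) = mps_at0 g.
Proof.
have H : vanish 1 (subst g - ev (mpolyC n (g (@mnm0 n)))).
  apply: subst_trunc => m; rewrite ltnS leqn0 mdeg_eq0 => /eqP->.
  by rewrite mcoeffC eqxx mulr1.
have := H (@mnm0 n); rewrite mdeg0 => /(_ isT)/eqP.
by rewrite mpsB_coef /ev mmapC [mpsC _ _ _]/= eqxx subr_eq0 => /eqP.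
Qed.

Section ChainRule.
Variables (D : mps n k -> mps n k) (J : mps n k) (l : 'I_n).
Hypothesis DD : forall g h, D (g + h) = D g + D h.
Hypothesis DM : forall g h, D (g * h) = D g * h + g * D h.
Hypothesis DC : forall c, D (mpsC n c) = 0.
Hypothesis Dvanish : forall d g, vanish d.+1 g -> vanish d (D g).
Hypothesis Df : forall i, D (f i) = J * (i == l)%:R.

Let good p := D (ev p) = J * ev (mderiv l p).

Lemma chain_mpoly p : good p.
Proof.
have gD p1 p2 : good p1 -> good p2 -> good (p1 + p2).
  by rewrite /good /ev mderivD !rmorphD /= DD mulrDr => -> ->.
have gM p1 p2 : good p1 -> good p2 -> good (p1 * p2).
  rewrite /good /ev mderivM !rmorphM rmorphD !rmorphM /= DM => -> ->.
  by ring.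
have gC c : good (mpolyC n c).
  by rewrite /good /ev mderivC mmapC DC rmorph0 mulr0.
have gX i : good (mpolyX k (mnm1 i)).
  rewrite /good /ev mderivX mmapX mmap1U Df mnm1E.
  case: eqP => [->|_]; last by rewrite scale0r (raddf0 (mmap (@mpsC n k) f)) !mulr0.
  by rewrite scale1r -[mnm_sub _ _](_ : @mnm0 n = _) ?mmapX ?mmap11 //; apply/mnmP => j; rewrite mnmBE subnn mnm0E.
have gXm m : good (mpolyX k m).
  rewrite mpolyXE_id.
  elim/big_ind: _ => //; first exact: gC.
  move=> i _; elim: (m i) => [|N IH]; first exact: gC.
  by rewrite exprS; apply: gM.
elim/mpolyind: p => [|c m p _ _ IH]; first exact: gC.
by apply: gD => //; rewrite -mul_mpolyC; apply: gM.
Qed.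

(** [chain_mpoly] handles polynomials; D lowers orders by at most one, so the identity passes to the
    limit. *)
Lemma subst_chain g : D (subst g) = J * subst (mps_deriv l g).
Proof.
apply/eqP; rewrite -subr_eq0; apply/eqP; apply: vanish_eq0 => d.
pose p := mps_trunc d.+1 g.
have H1 : vanish d (D (subst g - ev p)).
  by apply: Dvanish; apply: subst_trunc => m; apply: mps_truncP.
have H2 : vanish d (subst (mps_deriv l g) - ev (mderiv l p)).
  apply: subst_trunc => m md; rewrite mcoeff_deriv mps_truncE //.
  by rewrite mdegD mdeg1 addn1 ltnS.
have DN x : D (- x) = - D x.
  have D0 : D 0 = 0 by apply: (addrI (D 0)); rewrite -DD !addr0.
  by apply/eqP; rewrite -addr_eq0 -DD addNr D0.
rewrite (_ : _ - _ = D (subst g - ev p) - J * (subst (mps_deriv l g) - ev (mderiv l p))).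
  by apply: vanishB => //; apply: vanishMl.
by rewrite DD DN chain_mpoly; ring.
Qed.
End ChainRule.

End Substitution.

Section JacobianDerivations.
Variables (n : nat) (k : fieldType) (f : 'I_n -> mps n k).
Hypothesis char0 : [pchar k] =i pred0.
Hypothesis f1 : forall i, vanish 1 (f i).
Implicit Types (g h : mps n k) (m : multinom n) (l i j : 'I_n).
Let J := jacobian f.
Let sigma := subst f.

(** The adjugate expands, along the row of g, the determinant with f_l replaced by g. Formally this
    is J times the partial derivative with respect to f_l. *)
Definition cof_deriv l g := \sum_j mps_deriv j g * (\adj (jacobian_mx f)) j l.

Lemma cof_derivD l g h : cof_deriv l (g + h) = cof_deriv l g + cof_deriv l h.
Proof.
by rewrite /cof_deriv -big_split; apply: eq_bigr => j _; rewrite mps_derivD mulrDl.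
Qed.

Lemma cof_derivM l g h : cof_deriv l (g * h) = cof_deriv l g * h + g * cof_deriv l h.
Proof.
rewrite /cof_deriv mulr_suml mulr_sumr -big_split; apply: eq_bigr => j _.
by rewrite mps_derivM /=; ring.
Qed.

Lemma cof_deriv_vanish l d g : vanish d.+1 g -> vanish d (cof_deriv l g).
Proof.
move=> gd; apply: vanish_sum => j _; rewrite mulrC; apply: vanishMl.
exact: mps_deriv_vanish.
Qed.

Lemma mps_derivC j (c : k) : mps_deriv j (mpsC n c) = 0 :> mps n k.
Proof.
apply: mpsP => m /=; rewrite mnmD_eq0 mnm1_eq0 andbF mul0rn //.
Qed.

Lemma mps_derivX i j : mps_deriv i (mpsX k j) = (i == j)%:R :> mps n k.
Proof.
apply: mpsP => m; rewrite /= [RHS](_ : _ = ((i == j) && (m == @mnm0 n))%:R); last first.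
  by case: (i == j) => //; rewrite mps1_coef.
have [->|ij] := eqVneq i j; last first.
  rewrite /= (_ : _ == _ = false) ?mul0rn //; apply/negbTE/eqP => /(congr1 (fun m : multinom n => m i)).
  by rewrite mnmDE !mnm1E eqxx eq_sym (negPf ij) addn1.
rewrite /= -{2}[mnm1 j]add0m eqm_add2r; case: eqP => [->|_]; last by rewrite mul0rn.
by rewrite mnm0E.
Qed.

Lemma cof_deriv_f l i : cof_deriv l (f i) = J * (i == l)%:R.
Proof.
have := mul_mx_adj (jacobian_mx f) => /(congr1 (fun M : 'M_n => M i l)).
rewrite !mxE mulr_natr => <-.
by apply: eq_bigr => j _; rewrite [jacobian_mx f i j]mxE.
Qed.

Lemma cof_deriv_subst l g : cof_deriv l (sigma g) = J * sigma (mps_deriv l g).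
Proof.
apply: subst_chain => //.
- exact: cof_derivD.
- exact: cof_derivM.
- by move=> c; rewrite /cof_deriv big1 // => j _; rewrite mps_derivC mul0r.
- exact: cof_deriv_vanish.
- exact: cof_deriv_f.
Qed.

(** By the chain rule, J times the substituted partial derivatives of g vanish, so these derivatives
    are in the kernel too. By induction they have order at least d; in characteristic 0 this gives g
    order at least d+1, its constant term being preserved by the substitution. *)
Lemma subst_eq0 g : J <> 0 -> sigma g = 0 -> g = 0.
Proof.
move=> J0 g0; apply: vanish_eq0 => d; elim: d g g0 => [|d IH] g g0; first exact: vanish0.
have dg l : vanish d (mps_deriv l g).
  apply: IH; have [//|//] : J = 0 \/ sigma (mps_deriv l g) = 0.
  apply: mps_domain; rewrite -cof_deriv_subst g0 /cof_deriv big1 // => j _.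
  rewrite (_ : mps_deriv j 0 = 0) ?mul0r //.
  by apply: mpsP => m; rewrite /= mul0rn.
move=> m; rewrite ltnS leq_eqVlt => /orP[/eqP md|md]; last first.
  exact: IH.
have [m0|[j mj]] : m = @mnm0 n \/ exists j, (0 < m j)%N.
    have [->|m0] := eqVneq m (@mnm0 n); first by left.
    right; apply: contrapT => nex; move/eqP: m0; apply.
    apply/mnmP => j; rewrite mnm0E; apply/eqP; rewrite -leqn0 leqNgt; apply/negP => mj.
    by apply: nex; exists j.
  have := subst_at0 f1 g; rewrite -/(sigma g) g0 m0 /mps_at0 => <- //.
have jm : lem (mnm1 j) m by rewrite lep1mP -lt0n.
have md' : (mdeg (mnm_sub m (mnm1 j)) < d)%N.
  by have := mdegD (mnm_sub m (mnm1 j)) (mnm1 j); rewrite submK // mdeg1; lia.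
have /eqP := dg j _ md'; rewrite /= submK // -mulr_natr mulf_eq0.
by rewrite ((pcharf0P k).1 char0) orbF => /eqP.
Qed.

(** J times the extended Euler derivation: clearing J keeps it inside power series. *)
Definition big_deriv g := \sum_l f l * cof_deriv l g.

Lemma big_derivD g h : big_deriv (g + h) = big_deriv g + big_deriv h.
Proof.
by rewrite /big_deriv -big_split; apply: eq_bigr => l _; rewrite cof_derivD mulrDr.
Qed.

Lemma big_derivM g h : big_deriv (g * h) = big_deriv g * h + g * big_deriv h.
Proof.
rewrite /big_deriv mulr_suml mulr_sumr -big_split; apply: eq_bigr => l _.
by rewrite cof_derivM /=; ring.
Qed.

Lemma big_deriv_subst g : big_deriv (sigma g) = J * sigma (euler g).
Proof.
have [s sE] := subst_rmorph f1.
rewrite /sigma -!sE /euler raddf_sum mulr_sumr; apply: eq_bigr => l _ /=.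
rewrite sE cof_deriv_subst rmorphM !sE subst_mpsX // /sigma.
by rewrite mulrCA.
Qed.

Lemma big_deriv_mpsX j : big_deriv (mpsX k j) = \sum_l f l * (\adj (jacobian_mx f)) j l.
Proof.
apply: eq_bigr => l _; congr (_ * _); rewrite /cof_deriv (bigD1 j) //= mps_derivX eqxx mul1r.
by rewrite big1 ?addr0 // => i ij; rewrite mps_derivX (negPf ij) mul0r.
Qed.

End JacobianDerivations.

(** * Finiteness of k[[X]] over the series in f *)

Section FiniteGeneration.
Variables (n : nat) (k : fieldType) (f : 'I_n -> mps n k) (N : nat).
Hypothesis f1 : forall i, vanish 1 (f i).
Hypothesis XN : forall j, ideal_gen f (mpsX k j ^+ N).
Implicit Types (g h : mps n k) (m : multinom n) (l i j : 'I_n).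
Let sigma := subst f.

Definition box_mnm (b : {ffun 'I_n -> 'I_N}) : multinom n :=
  Multinom [tuple val (b i) | i < n].

Lemma box_mnmE b i : box_mnm b i = b i.
Proof. exact: mnmE. Qed.

(** The d-th power of I, in a recursive form that peels off one generator at a time. *)
Fixpoint pow_gen d h : Prop :=
  if d is d'.+1 then exists2 r : 'I_n -> mps n k, (forall i, pow_gen d' (r i)) & h = \sum_i f i * r i
  else True.

Lemma pow_gen_vanish d h : pow_gen d h -> vanish d h.
Proof.
elim: d h => [|d IH] h /=; first by move=> _; apply: vanish0.
move=> [r Hr ->]; apply: vanish_sum => i _; rewrite -add1n; apply: vanishM => //.
exact: IH.
Qed.

(** Monomials outside the box are multiples of some X_j^N, hence in I; only constants times box
    monomials remain. *)
Lemma box_reduction h : exists2 r : 'I_n -> mps n k, True &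
  h - \sum_b mpsC n (h (box_mnm b)) * mpsXm k (box_mnm b) = \sum_i f i * r i.
Proof.
set h' := h - _.
have [m mN|q [-> _]] := @mps_division n k N h'.
  pose b : {ffun 'I_n -> 'I_N} := [ffun i => Ordinal (mN i)].
  have mb : box_mnm b = m by apply/mnmP => i; rewrite box_mnmE ffunE.
  rewrite /h' mpsB_coef mps_sum_coef.
  have term b' : (mpsC n (h (box_mnm b')) * mpsXm k (box_mnm b')) m =
      if b' == b then h m else 0.
    rewrite mpsC_mul /=; case: (eqVneq b' b) => [->|b'b]; first by rewrite mb eqxx mulr1.
    case: eqP => [mE|_]; last by rewrite mulr0.
    case/eqP: b'b; apply/ffunP => i; apply: val_inj => /=.
    by rewrite -!box_mnmE mb mE.
  under eq_bigr do rewrite term.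
  by rewrite -big_mkcond big_pred1_eq subrr.
have /choice[c cE] : forall j, exists c : 'I_n -> mps n k, mpsX k j ^+ N = \sum_i c i * f i.
  by move=> j; have [c cE] := XN j; exists c.
exists (fun i => \sum_j c j i * q j) => //.
under eq_bigr do rewrite cE mulr_suml.
rewrite exchange_big /=; apply: eq_bigr => i _; rewrite mulr_sumr; apply: eq_bigr => j _.
by rewrite mulrAC mulrA [f i * _]mulrC mulrAC.
Qed.

(** An element of I^d is a form of degree d in the f_i; applying [box_reduction] to its coefficients
    leaves coefficients of order d in S and an error in I^(d+1). *)
Lemma pow_gen_step d h : pow_gen d h -> exists s : {ffun 'I_n -> 'I_N} -> mps n k,
  (forall b, vanish d (s b)) /\
  pow_gen d.+1 (h - \sum_b sigma (s b) * mpsXm k (box_mnm b)).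
Proof.
have [sg sgE] := subst_rmorph f1.
elim: d h => [|d IH] h.
  move=> _; exists (fun b => mpsC n (h (box_mnm b))); split.
    by move=> b; apply: vanish0.
  have [r _ rE] := box_reduction h; exists r => //.
  rewrite -rE; congr (_ - _); apply: eq_bigr => b _.
  by rewrite /sigma subst_mpsC.
move=> [r Hr ->]; have /choice[s sE] := fun i => IH _ (Hr i).
exists (fun b => \sum_i mpsX k i * s i b); split.
  move=> b; apply: vanish_sum => i _; rewrite -add1n; apply: vanishM; first exact: vanish_mpsX.
  by case: (sE i).
exists (fun i => r i - \sum_b sigma (s i b) * mpsXm k (box_mnm b)); first by move=> i; case: (sE i).
under [RHS]eq_bigr do rewrite mulrBr.
rewrite sumrB; congr (_ - _).
under [RHS]eq_bigr do rewrite mulr_sumr.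
rewrite exchange_big /=; apply: eq_bigr => b _.
rewrite /sigma -sgE raddf_sum mulr_suml; apply: eq_bigr => i _ /=.
by rewrite rmorphM !sgE subst_mpsX // mulrA.
Qed.

Lemma subst_generation g : exists s : {ffun 'I_n -> 'I_N} -> mps n k,
  g = \sum_b sigma (s b) * mpsXm k (box_mnm b).
Proof.
have [sg sgE] := subst_rmorph f1.
have /choice[F FE] : forall dh : nat * mps n k, exists s : {ffun 'I_n -> 'I_N} -> mps n k,
    pow_gen dh.1 dh.2 -> (forall b, vanish dh.1 (s b)) /\
    pow_gen dh.1.+1 (dh.2 - \sum_b sigma (s b) * mpsXm k (box_mnm b)).
  move=> [d h] /=; have [Hh|nHh] := pselect (pow_gen d h); last by exists (fun=> 0).
  by have [s Hs] := pow_gen_step Hh; exists s.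
(* [H d] is the remainder, in I^d, after d corrections. *)
pose fix H d : mps n k := if d is d'.+1 then H d' - \sum_b sigma (F (d', H d') b) * mpsXm k (box_mnm b) else g.
have HP d : pow_gen d (H d).
  by elim: d => [|d IH] //; case: (FE (d, H d) IH).
have Fv d b : vanish d (F (d, H d) b) by case: (FE (d, H d) (HP d)).
have HE d : g = H d + \sum_b sigma (\sum_(e < d) F (val e, H (val e)) b) * mpsXm k (box_mnm b).
  elim: d => [|d IH].
    rewrite big1 ?addr0 // => b _.
    by rewrite big_ord0 /sigma -sgE rmorph0 mul0r.
  rewrite {1}IH /=.
  under [X in _ = _ + X]eq_bigr do rewrite big_ord_recr /= /sigma -sgE rmorphD !sgE mulrDl.
  by rewrite big_split /=; ring.
(* The e-th correction has order at least e in S, so finitely many of them determine each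
   coefficient of the limit. *)
pose s b : mps n k := Mps (fun m => (\sum_(e < (mdeg m).+1) F (val e, H (val e)) b) m).
have sv d b : vanish d (s b - \sum_(e < d) F (val e, H (val e)) b).
  move=> m md; rewrite mpsB_coef /s /= !mps_sum_coef.
  apply/eqP; rewrite subr_eq0; apply/eqP.
  rewrite (big_ord_widen d (fun e => F (e, H e) b m)) //.
  rewrite [LHS]big_mkcond /=; apply: eq_bigr => e _; case: ltnP => // me.
  by rewrite (Fv e b m) //.
exists s; apply/eqP; rewrite -subr_eq0; apply/eqP; apply: vanish_eq0 => d.
rewrite (HE d) (_ : _ - _ = H d - \sum_b sigma (s b - \sum_(e < d) F (val e, H (val e)) b) * mpsXm k (box_mnm b)).
  apply: vanishB; first exact: pow_gen_vanish.
  apply: vanish_sum => b _; rewrite mulrC; apply: vanishMl; apply: subst_vanish => //.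
under [X in _ = _ - X]eq_bigr do rewrite /sigma -sgE rmorphB !sgE mulrBl.
by rewrite sumrB /sigma; ring.
Qed.

(** Split off one X_j at a time; each goes to f_j. This turns orders in S into powers of I. *)
Lemma subst_ideal_exp d g : vanish d g -> ideal_exp (ideal_gen f) d (sigma g).
Proof.
have [sg sgE] := subst_rmorph f1.
elim: d g => [|d IH] g gd //.
have [q [-> qd]] := vanish_division gd.
exists [seq (f j, sigma (q j)) | j <- index_enum 'I_n]; split.
  move=> u /mapP[j _ ->] /=; split; last exact: IH.
  exists (fun i => (i == j)%:R); rewrite (bigD1 j) //= eqxx mul1r big1 ?addr0 // => i ij.
  by rewrite (negPf ij) mul0r.
rewrite big_map /= /sigma -sgE raddf_sum; apply: eq_bigr => j _ /=.
by rewrite rmorphM !sgE subst_mpsX.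
Qed.

End FiniteGeneration.

(** * The integral relation of the Jacobian *)

Lemma char_poly_scale (F : fieldType) d (M : 'M[F]_d) (a : F) j : a != 0 -> (j <= d)%N ->
  (char_poly (a *: M))`_j = a ^+ (d - j) * (char_poly M)`_j.
Proof.
move=> a0 jd.
have H : char_poly (a *: M) \Po (a *: 'X) = a ^+ d *: char_poly M.
  rewrite /char_poly -(det_map_mx (comp_poly (a *: 'X))).
  rewrite (_ : map_mx _ _ = a%:P *: char_poly_mx M); first by rewrite detZ -polyC_exp mul_polyC.
  apply/matrixP => i l; rewrite !mxE rmorphB /= comp_polyC mulrBr -!mul_polyC polyCM.
  congr (_ - _); case: (i == l); rewrite ?mulr1n ?mulr0n ?mulr0 ?comp_polyX //.
  by rewrite comp_poly0.
have : a ^+ j * (char_poly (a *: M))`_j = a ^+ d * (char_poly M)`_j.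
  rewrite -[in RHS]coefZ -H; elim/poly_ind: (char_poly (a *: M)) j {jd} => [|p c IH] j.
    by rewrite comp_poly0 !coef0 mulr0.
  rewrite comp_polyD comp_polyM comp_polyX comp_polyC -scalerAr !coefD coefZ coefMX !coefC coefMX.
  case: j => [|j]; first by rewrite expr0 mul1r /= mulr0.
  by rewrite /= !addr0 exprS -mulrA IH.
have aj : a ^+ j != 0 by rewrite expf_neq0.
have -> : a ^+ d = a ^+ j * a ^+ (d - j) by rewrite -exprD subnKC.
by rewrite -mulrA => /(mulfI aj).
Qed.

Lemma valring_max (K : fieldType) (V : set K) (s : seq K) : valring V ->
  (exists2 x, x \in s & x != 0) -> exists w, [/\ w \in s, w != 0 & forall x, x \in s -> V (x / w)].
Proof.
move=> vV [x xs x0].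
have P0 : Poly s != 0.
  apply/eqP => /(congr1 (fun p : {poly K} => p`_(index x s))).
  by rewrite coef_Poly nth_index // coef0 => /eqP; rewrite (negPf x0).
have [i [Pi VP _]] := valring_dominating_coef vV P0.
rewrite coef_Poly in Pi.
exists s`_i; split=> //.
  by apply: mem_nth; rewrite ltnNge; apply: contraNN Pi => si; rewrite nth_default.
by move=> y ys; have := VP (index y s); rewrite !coef_Poly nth_index.
Qed.

Section FiniteBasis.
Variables (A : comNzRingType) (L : fieldType) (iota : {rmorphism A -> L}).
Hypothesis iota_inj : injective iota.
Hypothesis fracP : forall z, exists a b, b <> 0 /\ z = iota a / iota b.
Variable phi : {rmorphism L -> L}.
Variables (I : finType) (w : I -> A).
Hypothesis w_gen : forall g, exists c : I -> L, iota g = \sum_i phi (c i) * iota (w i).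

(** A family in A of least size that spans A over phi L is free. It also spans L: multiplication by
    b acts on its span by an injective, hence invertible, matrix, so quotients by b stay inside.
    Keeping the basis in A makes its elements integral in the application. *)
Lemma exists_finite_basis : exists (d : nat) (e : 'I_d.+1 -> A) (co : L -> 'rV[L]_d.+1),
  (forall x, \sum_i phi (co x 0 i) * iota (e i) = x) /\
  (forall c : 'rV[L]_d.+1, \sum_i phi (c 0 i) * iota (e i) = 0 -> c = 0).
Proof.
pose spans d := exists e : 'I_d -> A, forall g, exists c : 'rV[L]_d,
  iota g = \sum_i phi (c 0 i) * iota (e i).
have exs : exists d, `[< spans d >].
  exists #|I|; apply/asboolP; exists (fun i => w (enum_val i)) => g.
  have [c ->] := w_gen g; exists (\row_i c (enum_val i)).
  rewrite (reindex (@enum_val I predT)) /=; last first.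
    by apply: onW_bij; apply: enum_val_bij.
  by apply: eq_bigr => i _; rewrite mxE.
have [[|d] /asboolP[e eS] dmin] := ex_minnP exs.
  have [c /eqP] := eS 1; rewrite big_ord0 rmorph1; by rewrite oner_eq0.
have e_free (c : 'rV[L]_d.+1) : \sum_i phi (c 0 i) * iota (e i) = 0 -> c = 0.
  move=> ce; apply: contrapT => c0.
  have [i0 ci0] : exists i, c 0 i != 0.
    apply: contrapT => nex; apply: c0; apply/rowP => i; rewrite mxE.
    by apply/eqP; apply: contrapT => /negP ci; apply: nex; exists i.
  suff /asboolT/dmin : spans d by rewrite ltnn.
  exists (fun i => e (lift i0 i)) => g; have [x ->] := eS g.
  exists (\row_i (x 0 (lift i0 i) - x 0 i0 / c 0 i0 * c 0 (lift i0 i))).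
  have pci0 : phi (c 0 i0) != 0 by rewrite fmorph_eq0.
  have ei0 : iota (e i0) = - \sum_i phi (c 0 (lift i0 i)) / phi (c 0 i0) * iota (e (lift i0 i)).
    move/eqP: ce; rewrite (bigD1_ord i0) //= addr_eq0 => /eqP H.
    apply: (mulfI pci0); rewrite H mulrN mulr_sumr; congr (- _); apply: eq_bigr => i _.
    by rewrite mulrA mulrCA divff // mulr1.
  rewrite (bigD1_ord i0) //= ei0 mulrN mulr_sumr addrC -sumrB; apply: eq_bigr => i _.
  by rewrite mxE rmorphB !rmorphM fmorphV mulrBl; congr (_ - _); ring.
have ext z : exists c : 'rV[L]_d.+1, \sum_i phi (c 0 i) * iota (e i) = z.
  have [a [b [b0 ->]]] := fracP z.
  have ib := iota_neq0 iota_inj b0.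
  have /choice[r rE] := fun i => eS (b * e i).
  pose M := \matrix_i r i.
  have ME (c : 'rV[L]_d.+1) : iota b * \sum_i phi (c 0 i) * iota (e i) =
      \sum_i phi ((c *m M) 0 i) * iota (e i).
    rewrite mulr_sumr.
    under eq_bigr => i _ do rewrite mulrCA -rmorphM rE mulr_sumr.
    rewrite exchange_big /=; apply: eq_bigr => j _.
    rewrite mxE rmorph_sum mulr_suml; apply: eq_bigr => i _.
    by rewrite rmorphM mulrA mxE.
  have Mu : M \in unitmx.
    rewrite -row_free_unit -kermx_eq0; apply/rowV0P => c; rewrite sub_kermx => /eqP cM.
    apply: e_free; apply: (mulfI ib); rewrite ME cM mulr0 big1 // => i _.
    by rewrite mxE rmorph0 mul0r.
  have [x xE] := eS a; exists (x *m invmx M).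
  by apply: (mulfI ib); rewrite ME mulmxKV // -xE mulrCA divff // mulr1.
have /choice[co coP] := ext.
by exists d, e, co.
Qed.

End FiniteBasis.

Section GeneratedIntegral.
Variables (A : comNzRingType) (L : fieldType) (iota : {rmorphism A -> L}).
Variables (phi : {rmorphism L -> L}) (I : finType) (w : I -> A) (S : set L).
Hypothesis w_gen : forall g, exists c : I -> L, (forall i, S (c i)) /\ iota g = \sum_i phi (c i) * iota (w i).

(** The determinant trick in valuative form: take a generator that divides all others in V and
    expand its product with g. *)
Lemma generated_integral g : integral_over [set phi c | c in S] (iota g).
Proof.
move=> V vV SV.
have [|u [/mapP[i0 _ ->] w0 wmax]] := @valring_max L V [seq iota (w i) | i <- index_enum I] vV.
  apply: contrapT => nex.
  have w0 i : iota (w i) = 0.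
    apply/eqP; apply: contrapT => /negP wi; apply: nex; exists (iota (w i)) => //.
    by apply: map_f; rewrite mem_index_enum.
  have [c [_]] := w_gen 1; rewrite rmorph1 big1 => [/eqP|i _]; first by rewrite oner_eq0.
  by rewrite w0 mulr0.
have [c [Sc E]] := w_gen (g * w i0).
have -> : iota g = \sum_i phi (c i) * (iota (w i) / iota (w i0)).
  apply: (mulIf w0); rewrite -rmorphM E mulr_suml; apply: eq_bigr => i _.
  by rewrite -mulrA divfK.
apply: (subring_sum _ vV.1) => i _; apply: (subringM vV.1).
  by apply: SV; exists (c i).
by apply: wmax; apply: map_f; rewrite mem_index_enum.
Qed.

End GeneratedIntegral.

Section SeriesFractions.
Variables (n : nat) (k : fieldType) (L : fieldType) (iota : {rmorphism mps n k -> L}).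
Hypothesis iota_inj : injective iota.
Hypothesis fracP : forall z, exists a b, b <> 0 /\ z = iota a / iota b.
Hypothesis char0 : [pchar k] =i pred0.

Definition series_image : set L := [set iota a | a in setT].

Lemma series_image_subring : subring series_image.
Proof.
split; first by exists 1; rewrite ?rmorph1.
- by move=> _ _ [a _ <-] [b _ <-]; exists (a - b); rewrite ?rmorphB.
- by move=> _ _ [a _ <-] [b _ <-]; exists (a * b); rewrite ?rmorphM.
Qed.

(** If x = a/b satisfies a monic equation of degree D, all powers of x are combinations of 1, ...,
    x^(D-1), so b^D is a common denominator for them and [almost_multiple_dvd] applies. *)
Lemma series_normal x : integral_over series_image x -> series_image x.
Proof.
move=> /(integral_overP series_image_subring)[p [pmon Sp /rootP px]].
have [a [b [b0 xE]]] := fracP x.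
have ib := iota_neq0 iota_inj b0.
have /choice[c cE] : forall i, exists c, iota c = p`_i.
  by move=> i; have [c _ cE] := Sp i; exists c.
case sp : (size p) => [|D].
  by move/eqP: sp; rewrite size_poly_eq0 (negPf (monic_neq0 pmon)).
have xD : x ^+ D = - \sum_(i < D) iota (c i) * x ^+ i.
  move: px; rewrite horner_coef sp big_ord_recr /=.
  move/monicP: pmon; rewrite lead_coefE sp /= => ->; rewrite mul1r => /eqP.
  rewrite addrC addr_eq0 => /eqP ->; congr (- _); apply: eq_bigr => i _.
  by rewrite cE.
have xN N : exists u : nat -> mps n k, x ^+ N = \sum_(i < D) iota (u i) * x ^+ i.
  elim: N => [|N [u IH]].
    case: D sp xD => [|D] sp xD.
      by move: xD; rewrite big_ord0 oppr0 expr0 => /eqP; rewrite oner_eq0.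
    exists (fun i => if i is 0%N then 1 else 0).
    by rewrite big_ord_recl /= rmorph1 mul1r big1 ?addr0 // => i _; rewrite rmorph0 mul0r.
  case: D sp xD u IH => [|D] sp xD u IH.
    by exists u; rewrite exprS IH !big_ord0 mulr0.
  exists (fun i => (if i is i'.+1 then u i' else 0) - u D * c i).
  rewrite exprS IH big_ord_recr /= mulrDr mulrCA -exprS xD.
  under [RHS]eq_bigr do rewrite rmorphB mulrBl.
  rewrite sumrB mulrN; congr (_ - _).
    rewrite big_ord_recl /= rmorph0 mul0r add0r mulr_sumr; apply: eq_bigr => i _.
    by rewrite mulrCA -exprS.
  by rewrite mulr_sumr; apply: eq_bigr => i _; rewrite rmorphM mulrA.
have [bi bini] := exists_initial b0.
have bD0 : b ^+ D <> 0.
  move=> H; have : iota (b ^+ D) = 0 by rewrite H rmorph0.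
  by move/eqP; rewrite rmorphXn expf_eq0 (negPf ib) andbF.
have [ei eini] := exists_initial bD0.
have am : almost_multiple b (b ^+ D) a.
  move=> N; have [u uE] := xN N.
  exists (\sum_(i < D) u i * a ^+ i * b ^+ (D - i)).
  apply: iota_inj; rewrite !rmorphM rmorph_sum !rmorphXn /=.
  have -> : iota a ^+ N = iota b ^+ N * x ^+ N by rewrite -exprMn xE mulrCA divff // mulr1.
  rewrite uE mulrCA; congr (_ * _); rewrite mulr_sumr; apply: eq_bigr => i _.
  rewrite !rmorphM !rmorphXn /= xE expr_div_n.
  have -> : iota b ^+ D = iota b ^+ i * iota b ^+ (D - i) by rewrite -exprD subnKC // ltnW.
  have bi0 : iota b ^+ i != 0 by rewrite expf_neq0.
  by field.
have [h aE] := almost_multiple_dvd bini eini am.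
by exists h => //; rewrite xE aE rmorphM mulrAC divff // mul1r.
Qed.

Definition series_ord (g : mps n k) : nat := mdeg (xget (@mnm0 n) [set a | initial g a]).

Lemma series_ordE g a : initial g a -> series_ord g = mdeg a.
Proof.
move=> ga; rewrite /series_ord; congr mdeg; apply: (@initial_uniq _ _ g) => //.
by apply: (@xgetPex _ _ [set a | initial g a]); exists a.
Qed.

Lemma vanish_series_ord g d : g <> 0 -> vanish d g <-> (d <= series_ord g)%N.
Proof.
by move=> g0; have [a ga] := exists_initial g0; rewrite (series_ordE ga); apply: vanish_initialP.
Qed.

Lemma exists_series_valuation : exists nu : L -> int, int_valuation nu /\
  forall d g, vge nu d%:Z (iota g) <-> vanish d g.
Proof.
have [||nu [vnu nuE]] := @frac_valuation _ _ _ iota_inj fracP series_ord.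
- move=> g h g0 h0; have [a ga] := exists_initial g0; have [b hb] := exists_initial h0.
  by rewrite (series_ordE (initial_mul ga hb)) (series_ordE ga) (series_ordE hb) mdegD.
- move=> g h g0 h0 gh0.
  case: (leqP (series_ord g) (series_ord h)) => H; [left|right].
    apply/(vanish_series_ord _ gh0); apply: vanishD; first exact/(vanish_series_ord _ g0).
    exact/(vanish_series_ord _ h0).
  apply/(vanish_series_ord _ gh0); apply: vanishD; last exact/(vanish_series_ord _ h0).
  by apply/(vanish_series_ord _ g0); apply: ltnW.
exists nu; split=> // d g.
have [->|g0] := pselect (g = 0).
  by rewrite rmorph0; split=> _; [apply: vanish_zero|apply: vge0].
rewrite vge_neq0 ?(iota_neq0 iota_inj) // nuE // lez_nat.
by split=> /(vanish_series_ord _ g0).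
Qed.

Variables (nu : L -> int).
Hypothesis vnu : int_valuation nu.
Hypothesis nuE : forall d g, vge nu d%:Z (iota g) <-> vanish d g.

Lemma series_val_eq g a : initial g a -> nu (iota g) = (mdeg a)%:Z.
Proof.
move=> ga; have g0 : iota g != 0 by apply: iota_neq0 => //; apply: initial_neq0 ga.
have H1 := (nuE (mdeg a) g).2 (vanish_initial ga).
have H2 : ~ vge nu (mdeg a).+1%:Z (iota g).
  by move/nuE/(initial_vanish ga); rewrite ltnn.
by move: H1 H2; rewrite !vge_neq0 //; lia.
Qed.

Lemma initial_mpsXm (m : multinom n) : initial (mpsXm k m) m.
Proof.
split; first by rewrite /= eqxx oner_neq0.
by move=> b bm /=; rewrite (lt_eqF bm).
Qed.

Lemma series_nat_unit m : (m.+1%:R : L) != 0 /\ nu m.+1%:R = 0.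
Proof.
have mE : (m.+1%:R : mps n k) = mpsC n m.+1%:R by rewrite rmorph_nat.
have ini : initial (m.+1%:R : mps n k) (@mnm0 n).
  rewrite mE; split; last by move=> b; rewrite ltNge le0m.
  by rewrite /= eqxx ((pcharf0P k).1 char0).
rewrite -(rmorph_nat iota); split.
  by apply: iota_neq0 => //; apply: initial_neq0 ini.
by rewrite (series_val_eq ini) mdeg0.
Qed.

Lemma eulerD (g h : mps n k) : euler (g + h) = euler g + euler h.
Proof. by apply: mpsP => m; rewrite mpsD_coef !euler_coef mpsD_coef mulrnDl. Qed.

Lemma eulerM (g h : mps n k) : euler (g * h) = euler g * h + g * euler h.
Proof.
rewrite /euler mulr_suml mulr_sumr -big_split; apply: eq_bigr => j _.
by rewrite mps_derivM /=; ring.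
Qed.

(** The Euler operator multiplies an initial form of degree l by l. For a/b of value at least 0 and
    l the order of b, euler a - l a and euler b - l b have order above l, and the terms in l cancel
    in the quotient rule. *)
Lemma euler_residue EF : (forall a, EF (iota a) = iota (euler a)) ->
  (forall x y, EF (x * y) = EF x * y + x * EF y) ->
  forall c, vge nu 0 c -> vge nu 1 (EF c).
Proof.
move=> EFi EFM c; have [a [b [b0 cE]]] := fracP c.
have ib := iota_neq0 iota_inj b0.
have [e be] := exists_initial b0.
have nb := series_val_eq be.
set l := mdeg e in nb.
have EFc : EF c = iota (euler a * b - a * euler b) / iota b ^+ 2.
  have : EF (iota a) = EF (c * iota b) by rewrite cE divfK.
  rewrite EFM !EFi => H.
  have -> : EF c = (iota (euler a) - c * iota (euler b)) / iota b by rewrite H addrK mulfK.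
  by rewrite cE rmorphB !rmorphM; field.
move=> c0.
have la : vanish l a.
  apply/nuE; have -> : iota a = c * iota b by rewrite cE divfK.
  by rewrite -[l%:Z]add0r; apply: vgeM => //; rewrite -nb; apply: vge_val.
have lb : vanish l b by apply: vanish_initial.
have eul g : vanish l g -> vanish l.+1 (euler g - g *+ l).
  move=> gl m; rewrite ltnS => ml; rewrite mpsB_coef euler_coef.
  have -> : (g *+ l) m = g m *+ l.
    by elim: (l) => [|j IH]; rewrite ?mulr0n // !mulrSr mpsD_coef IH.
  move: ml; rewrite leq_eqVlt => /orP[/eqP->|/gl->]; first by rewrite subrr.
  by rewrite !mul0rn subrr.
have num : vanish (l + l.+1) (euler a * b - a * euler b).
  have -> : euler a * b - a * euler b = b * (euler a - a *+ l) - a * (euler b - b *+ l).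
    by rewrite -(mulr_natr a) -(mulr_natr b); ring.
  by apply: vanishB; apply: vanishM => //; apply: eul.
have ib2 : iota b ^+ 2 != 0 by rewrite expf_neq0.
have := (nuE _ _).2 num; rewrite -[iota _](mulfVK ib2) -EFc mulrC vge_mull //.
by rewrite valX // nb; apply: vgeW; lia.
Qed.

End SeriesFractions.

Section MinorsOrder.
Variables (n : nat) (k : fieldType).

Lemma mps_at0_zmod_morphism : GRing.zmod_morphism (@mps_at0 n k).
Proof. by move=> f g; rewrite /mps_at0 mpsB_coef. Qed.

Lemma mps_at0_monoid_morphism : GRing.monoid_morphism (@mps_at0 n k).
Proof.
split; first by rewrite /mps_at0 mps1_coef eqxx.
move=> f g; rewrite /mps_at0 mpsM_coef.
rewrite (bigD1 bm0) /=; last by apply/mnm_lepP => i; rewrite mnm0E.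
rewrite subm0 big1 ?addr0 // => b /andP[/mnm_lepP b0].
case/negP; apply/eqP; apply: val_inj; apply/mnmP => i /=.
by have := b0 i; rewrite mnm0E; lia.
Qed.

HB.instance Definition _ := GRing.isZmodMorphism.Build (mps n k) k (@mps_at0 n k) mps_at0_zmod_morphism.
HB.instance Definition _ := GRing.isMonoidMorphism.Build (mps n k) k (@mps_at0 n k) mps_at0_monoid_morphism.

Lemma mps_at0C c : mps_at0 (mpsC n c) = c :> k.
Proof. by rewrite /mps_at0 /= eqxx. Qed.

(** Invertible constant row and column operations bring the matrix at the origin to rank normal
    form. The rows beyond the rank then vanish at the origin, and every term of the determinant has
    a factor from each of them. *)
Lemma det_vanish p (B : 'M[mps n k]_p) r :
  (\rank (map_mx (@mps_at0 n k) B) <= r)%N -> vanish (p - r) (\det B).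
Proof.
set A0 := map_mx _ B => rA.
pose C := map_mx (@mpsC n k) (col_ebase A0); pose R := map_mx (@mpsC n k) (row_ebase A0).
pose B' := map_mx (@mpsC n k) (invmx (col_ebase A0)) *m B *m map_mx (@mpsC n k) (invmx (row_ebase A0)).
have BE : B = C *m B' *m R.
  rewrite /B' /C /R !mulmxA -map_mxM mulmxV ?col_ebase_unit // map_mx1 mul1mx.
  by rewrite -mulmxA -map_mxM mulVmx ?row_ebase_unit // map_mx1 mulmx1.
have atC (X : 'M[k]_p) : map_mx (@mps_at0 n k) (map_mx (@mpsC n k) X) = X.
  by apply/matrixP => i j; rewrite !mxE mps_at0C.
have B'E : map_mx (@mps_at0 n k) B' = pid_mx (\rank A0).
  rewrite /B' !map_mxM !atC -/A0 -{2}(mulmx_ebase A0) !mulmxA mulVmx ?col_ebase_unit //.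
  by rewrite mul1mx -mulmxA mulmxV ?row_ebase_unit // mulmx1.
clearbody B' C R; rewrite BE !det_mulmx mulrAC; apply: vanishMl.
apply: (@vanishW _ _ _ _ _ (leq_sub2l p rA)).
rewrite /determinant; apply: vanish_sum => s _; apply: vanishMl.
have -> : (p - \rank A0 = \sum_(i < p) (\rank A0 <= i))%N.
  elim: {A0 rA B' C R BE atC B'E s B} p (\rank A0) => [|q IH] t; first by rewrite big_ord0 sub0n.
  by rewrite big_ord_recr /= -IH; lia.
elim/big_rec2: _ => [|i g d _ gd]; first exact: vanish0.
apply: vanishM => //; case: leqP => [ri|_]; last exact: vanish0.
apply: vanish_at0.
have := congr1 (fun X : 'M_p => X i (s i)) B'E; rewrite !mxE => ->.
by rewrite ltnNge ri andbF.
Qed.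

(** The entries are, up to sign, minors of size n-1, and deleting a row and a column does not raise
    the rank at the origin. *)
Lemma adj_vanish (B : 'M[mps n k]_n) i j :
  vanish (n - \rank (map_mx (@mps_at0 n k) B) - 1) (\adj B i j).
Proof.
rewrite mxE /cofactor; apply: vanishMl.
rewrite -subnDA addnC subnDA subn1; apply: det_vanish.
rewrite map_row' map_col'; set A := map_mx _ _.
rewrite row'Esub -[col' _ _]mul1mx -mul_rowsub_mx.
apply: leq_trans (mxrankM_maxr _ _) _.
rewrite -mxrank_tr tr_col' row'Esub -[A^T]mul1mx -mul_rowsub_mx.
by apply: leq_trans (mxrankM_maxr _ _) _; rewrite mxrank_tr.
Qed.

End MinorsOrder.

Section IntegralRelation.
Variables (n : nat) (k : fieldType) (f : 'I_n -> mps n k) (N c : nat) (i0 : 'I_n).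
Hypothesis char0 : [pchar k] =i pred0.
Hypothesis f1 : forall i, vanish 1 (f i).
Hypothesis N0 : (0 < N)%N.
Hypothesis XN : forall j, ideal_gen f (mpsX k j ^+ N).
Hypothesis adjv : forall i j, vanish c.+1 (\adj (jacobian_mx f) i j).
Let J := jacobian f.
Hypothesis J0 : J <> 0.

Variables (L : fieldType) (iota : {rmorphism mps n k -> L}).
Hypothesis iota_inj : injective iota.
Hypothesis fracP : forall z, exists a b, b <> 0 /\ z = iota a / iota b.
Variable phi : {rmorphism L -> L}.
Hypothesis phiE : forall a, phi (iota a) = iota (subst f a).
Variable nu : L -> int.
Hypothesis vnu : int_valuation nu.
Hypothesis nuE : forall d g, vge nu d%:Z (iota g) <-> vanish d g.
Variables (d : nat) (e : 'I_d.+1 -> mps n k) (co : L -> 'rV[L]_d.+1).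
Hypothesis coK : forall x, \sum_i phi (co x 0 i) * iota (e i) = x.
Hypothesis e_free : forall c : 'rV[L]_d.+1, \sum_i phi (c 0 i) * iota (e i) = 0 -> c = 0.

Let O := [set c | vge nu 0 c].
Let tau := iota (mpsX k i0).

Lemma series_integral g : integral_over [set phi c | c in series_image iota] (iota g).
Proof.
apply: (@generated_integral _ _ _ _ {ffun 'I_n -> 'I_N} (fun b => mpsXm k (box_mnm b))) => h.
have [s sE] := subst_generation f1 XN h.
exists (fun b => iota (s b)); split; first by move=> b; exists (s b).
by rewrite {1}sE rmorph_sum; apply: eq_bigr => b _; rewrite phiE rmorphM.
Qed.

Lemma series_image_sub : series_image iota `<=` O.
Proof. by move=> _ [g _ <-]; apply/(nuE 0); apply: vanish0. Qed.

Lemma series_integral_val g : integral_over [set phi c | c in O] (iota g).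
Proof.
move=> V vV OV; apply: (series_integral g vV) => _ [x Sx <-]; apply: OV.
by exists x => //; apply: series_image_sub.
Qed.

Lemma tau0 : tau != 0.
Proof. by apply: (iota_neq0 iota_inj); apply: initial_neq0 (initial_mpsXm _ _). Qed.
Lemma nu_tau : nu tau = 1.
Proof. by rewrite /tau mpsX_Xm (series_val_eq iota_inj nuE (initial_mpsXm _ _)) mdeg1. Qed.

(** E is [big_deriv] divided by J; its compatibility with phi holds on series by the chain rule and
    passes to fractions by the Leibniz rule. *)
Lemma exists_euler_extension : exists EF E : L -> L,
  [/\ forall x y, E (x + y) = E x + E y, forall x y, E (x * y) = E x * y + x * E y,
      forall x, E (phi x) = phi (EF x), forall x, vge nu 0 x -> vge nu 1 (EF x) & EF tau = tau] /\
  forall g, iota J * E (iota g) = iota (big_deriv f g).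
Proof.
have [EF [EFi EFD EFM]] := frac_derivation iota_inj fracP (@eulerD n k) (@eulerM n k).
have [D [Di DD DM]] := frac_derivation iota_inj fracP (big_derivD f) (big_derivM f).
have iJ := iota_neq0 iota_inj J0.
exists EF, (fun x => D x / iota J); split; last first.
  by move=> g; rewrite Di mulrCA divff // mulr1.
split.
- by move=> x y; rewrite DD mulrDl.
- by move=> x y; rewrite DM; ring.
- move=> x; have [a [b [b0 xE]]] := fracP x.
  have ib := iota_neq0 iota_inj b0.
  have Ei g : D (phi (iota g)) / iota J = phi (EF (iota g)).
    by rewrite phiE Di big_deriv_subst // rmorphM EFi phiE mulrC mulKf.
  have pib : phi (iota b) != 0 by rewrite fmorph_eq0.
  have H1 : D (phi (iota a)) = D (phi x) * phi (iota b) + phi x * D (phi (iota b)).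
    by rewrite -DM -rmorphM xE divfK.
  have H2 : EF (iota a) = EF x * iota b + x * EF (iota b).
    by rewrite -EFM xE divfK.
  apply: (mulIf pib).
  have := Ei a; rewrite H1 H2 rmorphD !rmorphM -(Ei b) mulrDl => H3.
  apply: (addIr (phi x * (D (phi (iota b)) / iota J))).
  by rewrite -H3; ring.
- exact: (euler_residue iota_inj fracP vnu nuE EFi EFM).
- rewrite /tau EFi; congr (iota _); apply: mpsP => m; rewrite euler_coef /=.
  case: eqP => [->|_]; first by rewrite mdeg1.
  by rewrite mul0rn.
Qed.

Section Valuation.
Variables (v : L -> int) (D : nat).
Hypothesis vv : int_valuation v.
Hypothesis D0 : (0 < D)%N.
Hypothesis v_phi : forall x, x != 0 -> v (phi x) = D%:Z * nu x.

Lemma vge_series g : vge v 0 (iota g).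
Proof.
apply: (series_integral_val g (val_ring_valring vv)) => _ [x Ox <-].
have [->|x0] := eqVneq x 0; first by rewrite rmorph0; apply: vge0.
by move: Ox; rewrite /O /val_ring /= !vge_neq0 ?fmorph_eq0 // v_phi // pmulr_rge0 // ltz_nat.
Qed.

Lemma val_f i : v (iota (f i)) = D%:Z.
Proof.
rewrite -(subst_mpsX f1 i) -phiE v_phi; last first.
  by apply: (iota_neq0 iota_inj); apply: initial_neq0 (initial_mpsXm _ _).
by rewrite mpsX_Xm (series_val_eq iota_inj nuE (initial_mpsXm _ _)) mdeg1 mulr1.
Qed.

(* J E(X_j) = sum_l adj_(j l) f_l bounds v(J) below, since v(E X_j) = v(X_j). *)
Lemma val_jacobian : N%:Z * v (iota J) >= D%:Z * (N + c)%:Z.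
Proof.
have iX0 j : iota (mpsX k j) != 0.
  by apply: (iota_neq0 iota_inj); apply: initial_neq0 (initial_mpsXm _ _).
have [j0 jmin] : exists j0, forall j, v (iota (mpsX k j0)) <= v (iota (mpsX k j)).
  case: (@Order.TotalTheory.arg_minP _ _ _ i0 xpredT (fun j => v (iota (mpsX k j)))) => // j0 _ H.
  by exists j0 => j; apply: H.
set mu := v (iota (mpsX k j0)) in jmin.
(* X_j^N is a combination of the f_i, which all have value D. *)
have muN : D%:Z <= N%:Z * mu.
  have [a aE] := XN j0.
  have : vge v D%:Z (iota (mpsX k j0 ^+ N)).
    rewrite aE rmorph_sum; apply: vge_sum => // i _; rewrite rmorphM -[D%:Z]add0r.
    by apply: vgeM => //; [apply: vge_series|rewrite -(val_f i); apply: vge_val].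
  by rewrite rmorphXn /= vge_neq0 ?expf_neq0 // valX.
have mu0 : 0 < mu by nia.
have vvan l g : vanish l g -> vge v (l%:Z * mu) (iota g).
  elim: l g => [|l IH] g gl; first by rewrite mul0r; apply: vge_series.
  have [q [-> ql]] := vanish_division gl.
  rewrite rmorph_sum; apply: vge_sum => // j _; rewrite rmorphM intS mulrDl mul1r.
  by apply: vgeM => //; [apply: vgeW (vge_val v _)|apply: IH].
have [EF [E [[ED EM Ephi EFO EFtau] EJ]]] := exists_euler_extension.
have iJ := iota_neq0 iota_inj J0.
have e_int i : integral_over [set phi c | c in O] (iota (e i)) by apply: series_integral_val.
have [] := @E_val _ _ _ _ _ _ coK e_free nu tau v D vnu vv tau0 nu_tau D0 v_phi e_int
  (series_nat_unit iota_inj char0 nuE) EF E ED EM Ephi EFO EFtau (iota (mpsX k j0)) (iX0 j0).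
  by rewrite gt_eqF.
move=> EX0 vEX.
have : vge v (D%:Z + c.+1%:Z * mu) (iota J * E (iota (mpsX k j0))).
  rewrite EJ big_deriv_mpsX rmorph_sum; apply: vge_sum => // l _; rewrite rmorphM.
  by apply: vgeM => //; [rewrite -(val_f l); apply: vge_val|apply: vvan].
(* From v(J) + mu >= D + (c+1) mu follows v(J) >= D + c mu, and N mu >= D turns this into the
   claim. *)
by rewrite vge_neq0 ?mulf_neq0 // valM // vEX -/mu; nia.
Qed.

End Valuation.

Variables (p q : nat).
Hypothesis pq : (p * N <= q * (N + c))%N.
Let mulrep := mulrep (fun i => iota (e i)) co.

(** phi tau is the image of f_i0, and since all the f_i have the same value over nu, this one
    measures I. A valuation with q v(J) < p D would contradict [val_jacobian], as p N <= q (N +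
    c). *)
Lemma jacobian_power_integral :
  integral_over [set phi c | c in O] (iota J ^+ q / phi tau ^+ p).
Proof.
apply: contrapT => /(exists_valuation_neg coK e_free vnu tau0 nu_tau)[v [D [vv D0 v_phi nv]]].
case: D D0 v_phi => // D D0 v_phi; apply: nv.
have iJ := iota_neq0 iota_inj J0.
have pt : phi tau != 0 by rewrite fmorph_eq0 tau0.
rewrite vge_neq0 ?mulf_neq0 ?invr_eq0 ?expf_neq0 //.
rewrite valM ?invr_eq0 ?expf_neq0 // valV ?expf_neq0 // !valX // (v_phi _ tau0) nu_tau mulr1.
have := @val_jacobian v D vv D0 v_phi.
move: (v (iota J)) => w H.
have H1 : p%:Z * N%:Z * D%:Z <= q%:Z * (N + c)%:Z * D%:Z.
  by rewrite ler_pM2r // -!PoszM lez_nat.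
have H2 : q%:Z * (D%:Z * (N + c)%:Z) <= q%:Z * (N%:Z * w) by rewrite ler_wpM2l.
have H3 : 0 <= N%:Z * (q%:Z * w - p%:Z * D%:Z) by nia.
by rewrite pmulr_rge0 // in H3; rewrite ltz_nat.
Qed.

(** The matrix of J^q is tau^p times that of y = J^q / phi tau^p, which is integral over the ring of
    nu; so the coefficient of degree d+1-i gains a factor tau^(p i). It lies in S because J^q is
    integral over S and S is normal. *)
Lemma jacobian_power_relation : exists s : nat -> mps n k,
  (forall i, (i <= d.+1)%N -> vanish (p * i) (s i)) /\
  (J ^+ q) ^+ d.+1 + \sum_(1 <= i < d.+2) subst f (s i) * (J ^+ q) ^+ (d.+1 - i) = 0.
Proof.
have pt : phi tau != 0 by rewrite fmorph_eq0 tau0.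
set y := iota J ^+ q / phi tau ^+ p.
have zE : iota (J ^+ q) = phi (tau ^+ p) * y.
  by rewrite !rmorphXn /= mulrC divfK // expf_neq0.
have ME : mulrep (iota (J ^+ q)) = tau ^+ p *: mulrep y by rewrite zE /mulrep (mulrep_scale coK e_free).
set chi := char_poly (mulrep (iota (J ^+ q))).
have chiE j : (j <= d.+1)%N -> chi`_j = tau ^+ (p * (d.+1 - j)) * (char_poly (mulrep y))`_j.
  by move=> jd; rewrite /chi ME char_poly_scale ?expf_neq0 ?tau0 // -exprM.
have yO j : vge nu 0 (char_poly (mulrep y))`_j.
  have sO : subring O by case: (val_ring_valring vnu).
  exact: (char_poly_mulrep_integral coK e_free sO jacobian_power_integral j (val_ring_valring vnu)).
have /choice[r rE] : forall j, exists r, iota r = chi`_j.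
  move=> j.
  have := char_poly_mulrep_integral coK e_free (series_image_subring iota) (series_integral (J ^+ q)) j.
  by move=> /(series_normal iota_inj fracP)[r _ rE]; exists r.
exists (fun i => r (d.+1 - i)%N); split.
  move=> i id; apply/nuE; rewrite rE chiE ?leq_subr // subKn //.
  rewrite vge_mull ?expf_neq0 ?tau0 // valX ?tau0 // nu_tau mulr1 subrr.
  exact: yO.
have chimon : chi \is monic by apply: char_poly_monic.
have schi : size chi = d.+2 by rewrite size_char_poly.
have /rootP := root_char_poly_mulrep coK e_free (iota (J ^+ q)).
have /monicP : map_poly phi chi \is monic by rewrite map_monic.
rewrite lead_coefE size_map_poly schi /= => lead1.
rewrite -/chi horner_coef size_map_poly schi big_ord_recr /= lead1 mul1r => H; apply: iota_inj; rewrite rmorph0 -[RHS]H addrC rmorphD.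
rewrite [iota (_ ^+ d.+1)]rmorphXn; congr (_ + _).
rewrite rmorph_sum big_add1 /= big_mkord [RHS](reindex_inj rev_ord_inj) /=.
apply: eq_bigr => i _; rewrite rmorphM -phiE rE coef_map [iota (_ ^+ _)]rmorphXn.
by rewrite subSS.
Qed.

End IntegralRelation.

(** * From relations over S to integral closures of powers of I *)

Section JacobianRelation.
Variables (n : nat) (k : fieldType) (f : 'I_n -> mps n k).
Hypothesis char0 : [pchar k] =i pred0.
Hypothesis f1 : forall i, vanish 1 (f i).
Let J := jacobian f.
Let I := ideal_gen f.

(** The coefficients are kept in S because their orders yield membership both in I^(p i) and in the
    nested power (I^p)^i. *)
Definition power_relation (p q D : nat) (s : nat -> mps n k) :=
  (forall i, (i <= D.+1)%N -> vanish (p * i) (s i)) /\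
  (J ^+ q) ^+ D.+1 + \sum_(1 <= i < D.+2) subst f (s i) * (J ^+ q) ^+ (D.+1 - i) = 0.

Lemma exists_power_relation (N c p q : nat) (i0 : 'I_n) :
  (0 < N)%N -> (forall j, I (mpsX k j ^+ N)) ->
  (forall i j, vanish c.+1 (\adj (jacobian_mx f) i j)) ->
  (0 < q)%N -> (p * N <= q * (N + c))%N -> exists D s, power_relation p q D s.
Proof.
move=> N0 XN adjv q0 pq.
(* Injectivity of the substitution needs J nonzero; for J = 0 zero coefficients will do. *)
have [J0|J0] := pselect (J = 0).
  exists 0%N, (fun=> 0); split; first by move=> i _; apply: vanish_zero.
  have [sg sgE] := subst_rmorph f1.
  rewrite J0 expr0n eqn0Ngt q0 /= expr0n /= add0r big1 // => i _.
  by rewrite -sgE rmorph0 mul0r.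
have [L [iota [iota_inj fracP]]] := exists_fraction_field (@mps_domain n k).
have [sg sgE] := subst_rmorph f1.
have psi_inj : injective (iota \o sg).
  move=> a b /= /iota_inj; rewrite !sgE => ab; apply/eqP; rewrite -subr_eq0; apply/eqP.
  by apply: (subst_eq0 char0 f1 J0); rewrite -sgE rmorphB !sgE ab subrr.
have [phi phiE'] := frac_rmorphism iota_inj fracP psi_inj.
have phiE a : phi (iota a) = iota (subst f a) by rewrite phiE' /= sgE.
have [nu [vnu nuE]] := exists_series_valuation iota_inj fracP.
have [|d [e [co [coK e_free]]]] := @exists_finite_basis _ _ _ iota_inj fracP phi
    {ffun 'I_n -> 'I_N} (fun b => mpsXm k (box_mnm b)).
  move=> g; have [s sE] := subst_generation f1 XN g.
  exists (fun b => iota (s b)).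
  by rewrite {1}sE rmorph_sum; apply: eq_bigr => b _; rewrite phiE rmorphM.
exists d; exact: (jacobian_power_relation i0 char0 f1 N0 XN adjv J0 iota_inj fracP phiE vnu nuE coK e_free pq).
Qed.

Lemma ideal_exp0 (A : comNzRingType) (I' : set A) p : ideal_exp I' p 0.
Proof. by case: p => [|p] //; exists [::]; split=> //; rewrite big_nil. Qed.

Lemma vanish_split p r (g : mps n k) : vanish (p + r) g ->
  exists s : seq (mps n k * mps n k), (forall u, u \in s -> vanish p u.1 /\ vanish r u.2) /\
    g = \sum_(u <- s) u.1 * u.2.
Proof.
elim: p g => [|p IH] g gpr.
  exists [:: (1, g)]; split; last by rewrite big_seq1 mul1r.
  by move=> u; rewrite inE => /eqP ->; split=> //; apply: vanish0.
have [h [gE hv]] := vanish_division gpr.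
have /choice[s sP] := fun j => IH (h j) (hv j).
exists (flatten [seq [seq (mpsX k j * u.1, u.2) | u <- s j] | j <- index_enum 'I_n]); split.
  move=> u /flattenP[t /mapP[j _ ->] /mapP[u' u's ->]] /=.
  have [H _] := sP j; have [u1 u2] := H _ u's.
  by split=> //; rewrite -add1n; apply: vanishM => //; apply: vanish_mpsX.
rewrite big_flatten big_map gE; apply: eq_bigr => j _.
have [_ {1}->] := sP j; rewrite big_map mulr_sumr; apply: eq_bigr => u _ /=.
by rewrite mulrA.
Qed.

Lemma subst_ideal_exp_exp p i g : vanish (p * i) g ->
  ideal_exp (ideal_exp I p) i (subst f g).
Proof.
have [sg sgE] := subst_rmorph f1.
elim: i g => [|i IH] g; first by [].
rewrite mulnS => /vanish_split[s [sP ->]].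
exists [seq (subst f u.1, subst f u.2) | u <- s]; split.
  move=> u /mapP[u' u's ->] /=; have [H1 H2] := sP _ u's.
  by split; [apply: subst_ideal_exp|apply: IH].
rewrite big_map -sgE rmorph_sum; apply: eq_bigr => u _.
by rewrite rmorphM !sgE.
Qed.

Lemma integral_closure_exp p q D s : power_relation p q D s ->
  integral_closure (ideal_exp I p) (J ^+ q).
Proof.
move=> [sv rel]; exists D.+1, (fun i => subst f (s i)); split=> // i /andP[_ iD].
by apply: subst_ideal_exp_exp; apply: sv.
Qed.

Lemma integral_closure1 D s : power_relation 1 1 D s -> integral_closure I J.
Proof.
move=> [sv]; rewrite expr1 => rel; exists D.+1, (fun i => subst f (s i)); split=> // i /andP[_ iD].
by apply: subst_ideal_exp => //; have := sv i iD; rewrite mul1n.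
Qed.

Variable R : realType.

Lemma ord_ideal_ge (A : comNzRingType) (I' : set A) (a : A) (l p q i : nat) :
  ideal_exp I' l a -> (p * i <= l * q)%N -> (0 < q)%N -> (0 < i)%N ->
  ((ratr (p%:R / q%:R))%:E <= ord_ideal R I' a * (i%:R^-1)%:E)%E.
Proof.
move=> al pil q0 i0.
have i0R : 0 < i%:R^-1 :> R by rewrite invr_gt0 ltr0n.
have lo : ((l%:R)%:E <= ord_ideal R I' a)%E by apply: ereal_sup_ubound; exists l.
apply: le_trans (lee_wpmul2r _ lo); last by rewrite lee_fin ltW.
rewrite -EFinM lee_fin (fmorph_div (@ratr R)) /= !ratr_nat ler_pdivrMr ?ltr0n // mulrAC ler_pdivlMr ?ltr0n //.
by rewrite -!natrM ler_nat.
Qed.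

Lemma sum_multiples (F : nat -> mps n k) q M : (0 < q)%N ->
  (forall j, ~~ (q %| j)%N -> F j = 0) ->
  \sum_(1 <= j < (q * M).+1) F j = \sum_(1 <= i < M.+1) F (q * i)%N.
Proof.
move=> q0 F0; elim: M => [|M IH]; first by rewrite muln0 !big_geq.
rewrite [RHS]big_nat_recr //= -IH (@big_cat_nat _ _ _ (q * M).+1) //=; last first.
  by rewrite ltnS leq_mul2l leqnSn orbT.
congr (_ + _).
have qM : (q * M.+1 = (q * M + q.-1).+1)%N by rewrite -addnS prednK // mulnSr.
rewrite qM big_nat_recr /=; last by rewrite ltnS leq_addr.
rewrite big_nat_cond big1 ?add0r // => j /andP[/andP[j1 j2] _].
apply: F0; apply/negP => /dvdnP[t tE].
move: j2; rewrite -qM => j2; move: j1 j2; rewrite tE [(q * M)%N]mulnC [(q * _)%N]mulnC.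
by rewrite !ltn_pmul2r //; lia.
Qed.

(** A relation for J^q is one for J of degree q (D+1) whose coefficients vanish at indices not
    divisible by q; zero lies in every power of I. *)
Lemma rat_integral_closure_power p q D s : (0 < q)%N -> power_relation p q D s ->
  rat_integral_closure R I (p%:R / q%:R) J.
Proof.
move=> q0 [sv rel].
pose a j := if (q %| j)%N then subst f (s (j %/ q)%N) else 0.
exists (q * D.+1)%N, a; split.
  move=> j /andP[j1 jD]; rewrite /a; case: ifP => qj; last first.
    by apply: (@ord_ideal_ge _ _ _ (p * j)) => //; [apply: ideal_exp0|rewrite leq_pmulr].
  apply: (@ord_ideal_ge _ _ _ (p * (j %/ q))) => //; last by rewrite -mulnA divnK.
  by apply: subst_ideal_exp => //; apply: sv; rewrite leq_divLR // mulnC.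
rewrite exprM sum_multiples //; last by move=> j /negPf qj; rewrite /a qj mul0r.
rewrite -[RHS]rel; congr (_ + _); apply: eq_bigr => i _.
by rewrite /a dvdn_mulr // mulKn // -exprM mulnBr.
Qed.

End JacobianRelation.

(** * Convergent power series *)

Section AbsoluteValues.
Variables (R : realType) (k : fieldType) (v : k -> R).
Hypothesis av : is_absolute_value v.

Lemma abs_ge0 x : 0 <= v x. Proof. by case: av. Qed.
Lemma abs_eq0 x : v x = 0 -> x = 0. Proof. by case: av => _ /(_ x)[]. Qed.
Lemma abs0 : v 0 = 0. Proof. by case: av => _ /(_ 0)[_ H] _ _; apply: H. Qed.
Lemma absM x y : v (x * y) = v x * v y. Proof. by case: av. Qed.
Lemma absD x y : v (x + y) <= v x + v y. Proof. by case: av. Qed.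

Lemma abs1 : v 1 = 1.
Proof.
have v1 : v 1 != 0 by apply/eqP => /abs_eq0 /eqP; rewrite oner_eq0.
by apply: (mulfI v1); rewrite -absM !mulr1.
Qed.

Lemma absN x : v (- x) = v x.
Proof.
have H : v (-1) ^+ 2 = 1 by rewrite expr2 -absM mulrNN mulr1 abs1.
have v1 : v (-1) = 1.
  by apply/eqP; rewrite -(@eqrXn2 _ 2) ?abs_ge0 // H expr1n.
by rewrite -mulN1r absM v1 mul1r.
Qed.

Lemma absB x y : v (x - y) <= v x + v y.
Proof. by rewrite -(absN y); apply: absD. Qed.
Lemma abs_sub x y : v (x - y) = v (y - x).
Proof. by rewrite -absN opprB. Qed.

Lemma absX x m : v (x ^+ m) = v x ^+ m.
Proof. by elim: m => [|m IH]; rewrite ?expr0 ?abs1 // !exprS absM IH. Qed.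

Lemma abs_sum (I : Type) (r : seq I) (P : pred I) (F : I -> k) :
  v (\sum_(i <- r | P i) F i) <= \sum_(i <- r | P i) v (F i).
Proof.
elim/big_rec2: _ => [|i y x _ H]; first by rewrite abs0.
by apply: le_trans (absD _ _) _; rewrite lerD2l.
Qed.

Lemma abs_prod (I : Type) (r : seq I) (P : pred I) (F : I -> k) :
  v (\prod_(i <- r | P i) F i) = \prod_(i <- r | P i) v (F i).
Proof. exact: (big_morph v absM abs1). Qed.

Lemma abs_nat m : v m%:R <= m%:R.
Proof.
elim: m => [|m IH]; first by rewrite abs0.
by rewrite !mulrSr; apply: le_trans (absD _ _) _; rewrite abs1 lerD2r.
Qed.

End AbsoluteValues.

Lemma ler_sum_uniq (R : realType) (T : eqType) (S S' : seq T) (F : T -> R) :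
  (forall x, 0 <= F x) -> uniq S -> {subset S <= S'} ->
  \sum_(x <- S) F x <= \sum_(x <- S') F x.
Proof.
move=> F0; elim: S S' => [|x S IH] S' /= ; first by move=> _ _; rewrite big_nil; apply: sumr_ge0.
move=> /andP[xS uS] SS'.
have xS' : x \in S' by apply: SS'; rewrite mem_head.
rewrite big_cons (perm_big _ (perm_to_rem xS')) /= big_cons lerD2l.
apply: IH => // y yS; have := SS' y; rewrite inE yS orbT => /(_ isT).
move/perm_mem: (perm_to_rem xS') => ->; rewrite inE => /orP[/eqP yx|//].
by move: xS; rewrite -yx yS.
Qed.

Lemma le_of_le_halves (R : realType) (a b C : R) :
  (forall d, a <= b + 2^-1 ^+ d * C) -> a <= b.
Proof.
move=> H; rewrite leNgt; apply/negP => ba.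
have C0 : 0 < C by have := H 0%N; rewrite expr0 mul1r; lra.
have e0 : 0 < (a - b) / C by rewrite divr_gt0 // subr_gt0.
have [d Hd] : exists d : nat, 2^-1 ^+ d < (a - b) / C.
  exists (Num.bound ((a - b) / C)^-1).
  have lt2 m : m%:R < 2 ^+ m :> R.
    elim: m => [|m IH]; first by rewrite expr0.
    rewrite exprS mulrSr; have : 1 <= 2 ^+ m :> R by rewrite exprn_ege1 // ler1n.
    by lra.
  rewrite exprVn invf_plt ?posrE ?exprn_gt0 //.
  by apply: lt_trans (lt2 _); apply: archi_boundP; rewrite invr_ge0 ltW.
have := H d; rewrite -lerBlDl => H'.
by move: Hd; rewrite ltr_pdivlMr // => Hd; lra.
Qed.

Section ConvergentSeries.
Variables (R : realType) (k : fieldType) (v : k -> R) (n : nat).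
Hypothesis av : is_absolute_value v.
Implicit Types (f g h : mps n k) (m : multinom n) (S : seq (multinom n)) (rho B : R).

Let v_ge0 := abs_ge0 av.

Definition low d : seq (multinom n) := [seq bmnm b | b <- index_enum (bmultinom n d)].

Lemma low_uniq d : uniq (low d).
Proof. by rewrite map_inj_uniq ?index_enum_uniq //; apply: val_inj. Qed.

Lemma mem_low d m : (m \in low d) = (mdeg m < d)%N.
Proof.
apply/mapP/idP => [[b _ ->]|md]; first exact: bmdeg.
by exists (BMultinom md); rewrite ?mem_index_enum.
Qed.

(** A bound on the weighted l1 norm of radius rho, tested on finite lists of distinct exponents. *)
Definition bounded_by rho B f := forall S, uniq S -> \sum_(m <- S) v (f m) * rho ^+ mdeg m <= B.

Lemma low_cover S : exists d, {subset S <= low d}.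
Proof.
exists (\max_(m <- S) mdeg m).+1 => m mS.
by rewrite mem_low ltnS; apply: leq_bigmax_seq.
Qed.

Lemma bounded_by_low rho B f : 0 <= rho ->
  (forall d, \sum_(m <- low d) v (f m) * rho ^+ mdeg m <= B) -> bounded_by rho B f.
Proof.
move=> r0 H S uS; have [d Sd] := low_cover S.
apply: le_trans (H d); apply: ler_sum_uniq => // m.
by rewrite mulr_ge0 ?v_ge0 ?exprn_ge0.
Qed.

Lemma bounded_ge0 rho B f : bounded_by rho B f -> 0 <= B.
Proof. by move=> /(_ [::] isT); rewrite big_nil. Qed.

Lemma convergent_bounded f : mps_convergent v f -> exists rho B, 0 < rho /\ bounded_by rho B f.
Proof.
move=> [rho rho0 H]; set E := esum _ _ in H.
have E0 : (0 <= E)%E by apply: esum_ge0 => m _; rewrite lee_fin mulr_ge0 ?v_ge0 // exprn_ge0 // ltW.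
exists rho, (fine E); split=> // S uS.
rewrite -lee_fin fineK ?ge0_fin_numE //.
apply: esum_ge; exists [set` S]; first by split=> //; apply: finite_seq.
by rewrite -fsbig_seq // sumEFin.
Qed.

Definition Conv rho f := exists B, bounded_by rho B f.

Lemma bounded_le rho rho' B f : 0 <= rho' -> rho' <= rho -> bounded_by rho B f -> bounded_by rho' B f.
Proof.
move=> r0 rr H S uS; apply: le_trans (H S uS); apply: ler_sum => m _.
by rewrite ler_wpM2l ?v_ge0 // lerXn2r // nnegrE // (le_trans r0).
Qed.

Lemma boundedD rho B B' f g : bounded_by rho B f -> bounded_by rho B' g -> 0 <= rho ->
  bounded_by rho (B + B') (f + g).
Proof.
move=> Hf Hg r0 S uS; apply: le_trans (lerD (Hf S uS) (Hg S uS)).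
rewrite -big_split; apply: ler_sum => m _ /=.
by rewrite -mulrDl ler_wpM2r ?exprn_ge0 // absD.
Qed.

Lemma boundedN rho B f : bounded_by rho B f -> bounded_by rho B (- f).
Proof. by move=> Hf S uS; under eq_bigr do rewrite mpsN_coef (absN av); apply: Hf. Qed.

Lemma bounded_finite rho d f : 0 <= rho -> (forall m, (d <= mdeg m)%N -> f m = 0) -> Conv rho f.
Proof.
move=> r0 fd; exists (\sum_(m <- low d) v (f m) * rho ^+ mdeg m) => S uS.
rewrite [X in X <= _](bigID (fun m => mdeg m < d)%N) /= [X in _ + X]big1 ?addr0; last first.
  by move=> m; rewrite -leqNgt => /fd ->; rewrite (abs0 av) mul0r.
rewrite -big_filter; apply: ler_sum_uniq; first by move=> m; rewrite mulr_ge0 ?v_ge0 ?exprn_ge0.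
  exact: filter_uniq.
by move=> m; rewrite mem_filter mem_low => /andP[].
Qed.

Lemma mpsM_pairs d f g m : (mdeg m < d)%N ->
  (f * g) m = \sum_(b <- low d) \sum_(c <- low d) f b * g c * (mnm_add b c == m)%:R.
Proof.
move=> md; rewrite (mpsM_trunc _ _ md) /mps_trunc big_distrlr /= raddf_sum big_map.
apply: eq_bigr => b _; rewrite raddf_sum big_map; apply: eq_bigr => c _ /=.
by rewrite -scalerAl -scalerAr scalerA mcoeffZ -mpolyXD mcoeffX.
Qed.

Lemma boundedM rho B B' f g : 0 <= rho -> bounded_by rho B f -> bounded_by rho B' g ->
  bounded_by rho (B * B') (f * g).
Proof.
move=> r0 Hf Hg; apply: bounded_by_low => // d.
apply: (@le_trans _ _ ((\sum_(b <- low d) v (f b) * rho ^+ mdeg b) *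
   (\sum_(c <- low d) v (g c) * rho ^+ mdeg c))); last first.
  apply: ler_pM; rewrite ?(Hf _ (low_uniq d)) ?(Hg _ (low_uniq d)) //;
  by apply: sumr_ge0 => m _; rewrite mulr_ge0 ?v_ge0 ?exprn_ge0.
rewrite big_distrlr.
apply: (@le_trans _ _ (\sum_(m <- low d) \sum_(b <- low d) \sum_(c <- low d)
   (v (f b) * rho ^+ mdeg b) * (v (g c) * rho ^+ mdeg c) * (mnm_add b c == m)%:R)).
  rewrite big_seq [X in _ <= X]big_seq; apply: ler_sum => m; rewrite mem_low => md.
  rewrite (mpsM_pairs _ _ md).
  apply: (@le_trans _ _ ((\sum_(b <- low d) \sum_(c <- low d) v (f b * g c * (mnm_add b c == m)%:R)) * rho ^+ mdeg m)).
    rewrite ler_wpM2r ?exprn_ge0 //; apply: le_trans (abs_sum av _ _ _) _.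
    by apply: ler_sum => b _; apply: abs_sum.
  rewrite mulr_suml; apply: ler_sum => b _; rewrite mulr_suml; apply: ler_sum => c _.
  case: eqP => [<-|_]; last by rewrite !mulr0 (abs0 av) mul0r.
  by rewrite !mulr1 (absM av) mdegD exprD mulrACA.
rewrite exchange_big /=; apply: ler_sum => b _; rewrite exchange_big /=; apply: ler_sum => c _.
rewrite -mulr_sumr -[X in _ <= X]mulr1 ler_wpM2l //.
  by rewrite !mulr_ge0 ?v_ge0 ?exprn_ge0.
have [bc|bc] := boolP (mnm_add b c \in low d).
  rewrite (bigD1_seq _ bc (low_uniq d)) /= eqxx big1 ?addr0 // => m.
  by rewrite eq_sym => /negPf ->.
rewrite big_seq big1 ?ler01 // => m ml; case: eqP => // bcm.
by move: bc; rewrite bcm ml.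
Qed.

(** Halving the radius pays for the factor m_j + 1, since e + 1 <= 2^(e+1). *)
Lemma bounded_deriv rho B f j : 0 < rho -> bounded_by rho B f ->
  bounded_by (rho / 2) (2 / rho * B) (mps_deriv j f).
Proof.
move=> r0 Hf S uS.
have uS' : uniq [seq mnm_add m (mnm1 j) | m <- S] by rewrite map_inj_uniq //; apply: addIm.
apply: le_trans (ler_wpM2l _ (Hf _ uS')); last by rewrite divr_ge0 // ltW.
rewrite big_map mulr_sumr; apply: ler_sum => m _.
rewrite /= -[f _ *+ _]mulr_natr (absM av) mdegD mdeg1 addn1.
rewrite -mulrA [X in _ <= X]mulrCA ler_wpM2l ?v_ge0 //.
apply: (@le_trans _ _ ((mdeg m).+1%:R * (rho / 2) ^+ mdeg m)).
  rewrite ler_wpM2r ?exprn_ge0 ?divr_ge0 ?(ltW r0) //.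
  apply: le_trans (abs_nat av _) _; rewrite ler_nat ltnS.
  by rewrite mdegE (bigD1 j) //= leq_addr.
have -> : 2 / rho * rho ^+ (mdeg m).+1 = 2 * rho ^+ mdeg m.
  by rewrite exprS mulrA divfK // gt_eqF.
rewrite expr_div_n mulrCA mulrC ler_wpM2r ?exprn_ge0 ?(ltW r0) //.
rewrite ler_pdivrMr ?exprn_gt0 // -exprS.
elim: (mdeg m) => [|e IH]; first by rewrite expr1 ler1n.
rewrite exprS mulrSr; have : 1 <= 2 ^+ e.+1 :> R by rewrite exprn_ege1 // ler1n.
by lra.
Qed.

Lemma tail_bound rho r B f d S : 0 < rho -> 0 <= r -> r <= rho -> bounded_by rho B f -> uniq S ->
  (forall m, m \in S -> (d <= mdeg m)%N \/ f m = 0) ->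
  \sum_(m <- S) v (f m) * r ^+ mdeg m <= (r / rho) ^+ d * B.
Proof.
move=> rho0 r0 rr Hf uS Sd.
have q0 : 0 <= r / rho by rewrite divr_ge0 // ltW.
apply: le_trans (ler_wpM2l (exprn_ge0 d q0) (Hf S uS)).
rewrite mulr_sumr big_seq [X in _ <= X]big_seq; apply: ler_sum => m mS.
case: (Sd m mS) => [dm|->]; last by rewrite (abs0 av) !mul0r mulr0.
rewrite mulrCA ler_wpM2l ?v_ge0 //.
have -> : r ^+ mdeg m = (r / rho) ^+ mdeg m * rho ^+ mdeg m.
  by rewrite -exprMn divfK // gt_eqF.
rewrite ler_wpM2r ?exprn_ge0 ?(ltW rho0) //.
by apply: ler_wiXn2l => //; rewrite ler_pdivrMr // mul1r.
Qed.

End ConvergentSeries.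

(** * Evaluation in the completion, within half the radius *)

Section Evaluation.
Variables (R : realType) (k : fieldType) (v : k -> R) (n : nat).
Hypothesis av : is_absolute_value v.
Variables (K : fieldType) (w : K -> R) (iota : {rmorphism k -> K}).
Hypothesis hK : is_completion v w iota.
Implicit Types (f g h : mps n k) (m : multinom n) (S : seq (multinom n)) (B t : R).
Variables (rho : R) (x : 'I_n -> k).
Hypothesis rho0 : 0 < rho.
Hypothesis xr : forall i, v (x i) <= rho / 2.

Let aw : is_absolute_value w. Proof. by case: hK. Qed.
Let w_iota c : w (iota c) = v c. Proof. by case: hK. Qed.
Let half_rho : 0 <= rho / 2. Proof. by rewrite divr_ge0 // ltW. Qed.
Let half_le : rho / 2 <= rho. Proof. by rewrite ler_pdivrMr // ler_peMr ?ler1n // ltW. Qed.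

Definition mon m : k := \prod_(i < n) x i ^+ m i.
Definition term f m : K := iota (f m * mon m).
Definition partial f d : K := \sum_(m <- low n d) term f m.

Lemma mon_bound t m : 0 <= t -> (forall i, v (x i) <= t) -> v (mon m) <= t ^+ mdeg m.
Proof.
move=> t0 xt; rewrite /mon (abs_prod av) mdegE -prodrXr.
apply: ler_prod => i _; rewrite (abs_ge0 av) (absX av) /=.
by rewrite lerXn2r // nnegrE (abs_ge0 av).
Qed.

Lemma monD m m' : mon (mnm_add m m') = mon m * mon m'.
Proof. by rewrite /mon -big_split; apply: eq_bigr => i _; rewrite mnmDE exprD. Qed.

Lemma term_bound t f m : 0 <= t -> (forall i, v (x i) <= t) -> w (term f m) <= v (f m) * t ^+ mdeg m.
Proof.
by move=> t0 xt; rewrite /term w_iota (absM av) ler_wpM2l ?(abs_ge0 av) // mon_bound.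
Qed.

Lemma sum_close t B f d S : 0 <= t -> t <= rho -> (forall i, v (x i) <= t) ->
  bounded_by v rho B f -> uniq S -> {subset low n d <= S} ->
  w (\sum_(m <- S) term f m - partial f d) <= (t / rho) ^+ d * B.
Proof.
move=> t0 tr xt Hf uS dS.
rewrite (bigID (fun m => mdeg m < d)%N) /= -big_filter.
have -> : \sum_(m <- [seq m <- S | (mdeg m < d)%N]) term f m = partial f d.
  apply: perm_big; apply: uniq_perm; rewrite ?filter_uniq ?low_uniq // => m.
  rewrite mem_filter -mem_low; case: (boolP (m \in low n d)) => //= /dS //.
rewrite addrAC subrr add0r -big_filter.
apply: le_trans (abs_sum aw _ _ _) _.
apply: (@le_trans _ _ (\sum_(m <- [seq m <- S | ~~ (mdeg m < d)%N]) v (f m) * t ^+ mdeg m)).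
  by apply: ler_sum => m _; apply: term_bound.
apply: (tail_bound av rho0 t0 tr Hf); first exact: filter_uniq.
by move=> m; rewrite mem_filter -leqNgt => /andP[dm _]; left.
Qed.

Lemma partial_close B f d d' : bounded_by v rho B f -> (d <= d')%N ->
  w (partial f d' - partial f d) <= 2^-1 ^+ d * B.
Proof.
move=> Hf dd'.
have := @sum_close (rho / 2) B f d (low n d') half_rho half_le xr Hf (low_uniq _ _).
rewrite mulrAC divff ?gt_eqF // mul1r; apply.
by move=> m; rewrite !mem_low => md; apply: leq_trans dd'.
Qed.

Lemma limit_unique (y z : K) C (u : nat -> K) : (forall d, w (y - u d) <= 2^-1 ^+ d * C) ->
  (forall d, w (z - u d) <= 2^-1 ^+ d * C) -> y = z.
Proof.
move=> Hy Hz; apply/eqP; rewrite -subr_eq0; apply/eqP; apply: (abs_eq0 aw).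
apply/le_anti; rewrite (abs_ge0 aw) andbT.
apply: (@le_of_le_halves _ _ _ (C + C)) => d; rewrite add0r.
have -> : y - z = (y - u d) - (z - u d) by rewrite opprB addrA subrK.
by apply: le_trans (absB aw _ _) _; rewrite mulrDr; apply: lerD.
Qed.

Lemma exists_half_pow (e : R) C : 0 < e -> exists d, forall d', (d <= d')%N -> 2^-1 ^+ d' * C < e.
Proof.
move=> e0; apply: contrapT => H.
have C0 : 0 < C.
  rewrite ltNge; apply/negP => C0; apply: H; exists 0%N => d' _.
  by apply: le_lt_trans e0; rewrite mulr_ge0_le0 // exprn_ge0 // invr_ge0.
suff : e <= 0 by rewrite leNgt e0.
apply: (@le_of_le_halves _ _ _ C) => d; rewrite add0r.
rewrite leNgt; apply/negP => dC; apply: H; exists d => d' dd'.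
apply: le_lt_trans dC; rewrite ler_wpM2r ?(ltW C0) //.
by apply: ler_wiXn2l => //; rewrite ?invr_ge0 // invf_le1 // ler1n.
Qed.

Lemma exists_value B f : bounded_by v rho B f -> exists y, mps_has_value w iota f x y /\ forall d, w (y - partial f d) <= 2^-1 ^+ d * B.
Proof.
move=> Hf; have B0 := bounded_ge0 Hf.
have [y Hy] : exists l : K, forall e : R, 0 < e -> exists N : nat, forall i : nat,
    (N <= i)%N -> w (partial f i - l) < e.
  case: hK => _ _ cK _; apply: cK => e e0.
  have [d Hd] := exists_half_pow B e0; exists d => i j di dj.
  have [ij|/ltnW ji] := leqP i j.
    rewrite (abs_sub aw); apply: le_lt_trans (partial_close Hf ij) _; exact: Hd.
  by apply: le_lt_trans (partial_close Hf ji) _; apply: Hd.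
have yd d : w (y - partial f d) <= 2^-1 ^+ d * B.
  apply/ler_addgt0Pr => e e0; have [N HN] := Hy e e0.
  pose i := maxn N d.
  have -> : y - partial f d = (partial f i - partial f d) - (partial f i - y).
    by ring.
  apply: le_trans (absB aw _ _) _; apply: lerD; first by apply: partial_close => //; apply: leq_maxr.
  by apply: ltW; apply: HN; apply: leq_maxl.
exists y; split=> // e e0.
have [d Hd] := exists_half_pow (B + B) e0.
exists [fset m in low n d]%fset => S dS.
have dS' : {subset low n d <= S}.
  by move=> m md; apply: (fsubsetP dS); rewrite in_fset.
have H2 := @sum_close (rho / 2) B f d S half_rho half_le xr Hf (fset_uniq S) dS'.
rewrite mulrAC divff ?gt_eqF // mul1r in H2.
apply: le_lt_trans (Hd d (leqnn d)).
have -> : y - \sum_(m <- S) iota (f m * \prod_(i < n) x i ^+ m i) =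
   (y - partial f d) - (\sum_(m <- S) term f m - partial f d).
  by rewrite opprB addrA subrK.
by apply: le_trans (absB aw _ _) _; rewrite mulrDr; apply: lerD.
Qed.

Lemma has_value_unique f y z : mps_has_value w iota f x y -> mps_has_value w iota f x z -> y = z.
Proof.
move=> Hy Hz; apply/eqP; rewrite -subr_eq0; apply/eqP; apply: (abs_eq0 aw).
apply/le_anti; rewrite (abs_ge0 aw) andbT.
apply/ler_addgt0Pr => e e0; rewrite add0r.
have e2 : 0 < e / 2 by rewrite divr_gt0.
have [Sy HSy] := Hy _ e2; have [Sz HSz] := Hz _ e2.
have H1 := HSy (Sy `|` Sz)%fset (fsubsetUl _ _).
have H2 := HSz (Sy `|` Sz)%fset (fsubsetUr _ _).
set s := \sum_(m <- _) _ in H1 H2.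
have -> : y - z = (y - s) - (z - s) by rewrite opprB addrA subrK.
by apply: le_trans (absB aw _ _) _; rewrite [e]splitr; apply: lerD; apply: ltW.
Qed.

Lemma eval_cvg B f : bounded_by v rho B f -> mps_cvg_at w iota f x.
Proof. by move=> /exists_value[y [Hy _]]; exists y. Qed.

Local Notation ev f := (mps_eval w iota f x).

Lemma eval_close B f d : bounded_by v rho B f -> w (ev f - partial f d) <= 2^-1 ^+ d * B.
Proof.
move=> Hf; have [y [Hy yd]] := exists_value Hf.
have H : mps_has_value w iota f x (ev f).
  by apply: (@xgetPex _ 0 [set y | mps_has_value w iota f x y]); exists y.
by rewrite (has_value_unique H Hy).
Qed.

(** At half the radius the partial sums converge at rate 2^-d, so a geometric estimate with any
    constant identifies the value. *)
Lemma eval_eq B C f z : bounded_by v rho B f -> (forall d, w (z - partial f d) <= 2^-1 ^+ d * C) ->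
  ev f = z.
Proof.
move=> Hf Hz; have B0 := bounded_ge0 Hf.
have C0 : 0 <= C by have := Hz 0%N; rewrite expr0 mul1r; apply: le_trans; apply: abs_ge0.
have p0 d : 0 <= 2^-1 ^+ d :> R by rewrite exprn_ge0 // invr_ge0.
apply: (@limit_unique _ _ (B + C) (partial f)) => d.
  by apply: le_trans (eval_close d Hf) _; rewrite ler_wpM2l // lerDl.
by apply: le_trans (Hz d) _; rewrite ler_wpM2l // lerDr.
Qed.

Lemma partial_bound B f d : bounded_by v rho B f -> w (partial f d) <= B.
Proof.
move=> Hf; apply: le_trans (abs_sum aw _ _ _) _.
apply: le_trans (Hf _ (low_uniq n d)); apply: ler_sum => m _.
apply: le_trans (@term_bound _ f m half_rho xr) _.
by rewrite ler_wpM2l ?(abs_ge0 av) // lerXn2r // nnegrE ltW.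
Qed.

Lemma partial0 f : partial f 0 = 0.
Proof. by rewrite /partial big_seq big1 // => m; rewrite mem_low. Qed.
Lemma eval_bound B f : bounded_by v rho B f -> w (ev f) <= B.
Proof. by move=> Hf; have := eval_close 0 Hf; rewrite partial0 subr0 expr0 mul1r. Qed.

Lemma evalD f g : Conv v rho f -> Conv v rho g -> ev (f + g) = ev f + ev g.
Proof.
move=> [B Hf] [B' Hg].
apply: (@eval_eq (B + B') (B + B')); first exact: boundedD (ltW rho0).
move=> d; have -> : ev f + ev g - partial (f + g) d = (ev f - partial f d) + (ev g - partial g d).
  have -> : partial (f + g) d = partial f d + partial g d.
    rewrite /partial -big_split; apply: eq_bigr => m _.
    by rewrite /term mpsD_coef mulrDl rmorphD.
  by rewrite opprD addrACA.
by rewrite mulrDr; apply: le_trans (absD aw _ _) _; apply: lerD; apply: eval_close.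
Qed.

Lemma evalN f : Conv v rho f -> ev (- f) = - ev f.
Proof.
move=> [B Hf]; apply: (@eval_eq B B); first exact: boundedN.
move=> d; have -> : - ev f - partial (- f) d = - (ev f - partial f d).
  have -> : partial (- f) d = - partial f d.
    by rewrite /partial -sumrN; apply: eq_bigr => m _; rewrite /term mpsN_coef mulNr rmorphN.
  by ring.
by rewrite (absN aw); apply: eval_close.
Qed.

(** The difference consists of the pairs of degrees below d whose total degree is at least d; half
    the radius damps each by 2^-d. *)
Lemma partialM B B' f g d : bounded_by v rho B f -> bounded_by v rho B' g ->
  w (partial f d * partial g d - partial (f * g) d) <= 2^-1 ^+ d * (B * B').
Proof.
move=> Hf Hg.
have E : partial f d * partial g d - partial (f * g) d =
  \sum_(b <- low n d) \sum_(c <- low n d | ~~ (mdeg (mnm_add b c) < d)%N) term f b * term g c.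
  have -> : partial (f * g) d =
    \sum_(b <- low n d) \sum_(c <- low n d | (mdeg (mnm_add b c) < d)%N) term f b * term g c.
    rewrite /partial big_seq.
    under eq_bigr => m md.
      rewrite mem_low in md.
      rewrite /term (mpsM_pairs _ _ md) mulr_suml rmorph_sum.
      under eq_bigr do rewrite mulr_suml rmorph_sum.
      over.
    rewrite -big_seq exchange_big /=; apply: eq_bigr => b _.
    rewrite exchange_big /= [RHS]big_mkcond; apply: eq_bigr => c _.
    case: ifP => bc.
      rewrite (bigD1_seq (mnm_add b c)) ?mem_low ?low_uniq //= eqxx mulr1 big1 ?addr0.
        by rewrite /term monD -!rmorphM mulrACA.
      by move=> m; rewrite eq_sym => /negPf ->; rewrite mulr0 mul0r rmorph0.
    rewrite big_seq big1 // => m; rewrite mem_low; case: eqP => [<-|]; first by rewrite bc.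
    by rewrite mulr0 mul0r rmorph0.
  rewrite /partial big_distrlr -sumrB; apply: eq_bigr => b _.
  by rewrite (bigID (fun c => mdeg (mnm_add b c) < d)%N) /= addrAC subrr add0r.
rewrite E; apply: le_trans (abs_sum aw _ _ _) _.
have v0 := abs_ge0 av; have r0 := ltW rho0.
apply: (@le_trans _ _ (\sum_(b <- low n d) \sum_(c <- low n d)
   2^-1 ^+ d * ((v (f b) * rho ^+ mdeg b) * (v (g c) * rho ^+ mdeg c)))).
  apply: ler_sum => b _; apply: le_trans (abs_sum aw _ _ _) _.
  rewrite big_mkcond; apply: ler_sum => c _; case: ifP => bc; last first.
    by rewrite !mulr_ge0 ?exprn_ge0 ?invr_ge0.
  rewrite -leqNgt mdegD in bc.
  rewrite (absM aw).
  apply: (@le_trans _ _ ((v (f b) * (rho / 2) ^+ mdeg b) * (v (g c) * (rho / 2) ^+ mdeg c))).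
    by apply: ler_pM; rewrite ?(abs_ge0 aw) ?term_bound.
  rewrite !expr_div_n !mulrA -[X in _ <= X]mulrA.
  have -> : v (f b) * rho ^+ mdeg b / 2 ^+ mdeg b * v (g c) * rho ^+ mdeg c / 2 ^+ mdeg c =
     2^-1 ^+ (mdeg b + mdeg c) * (v (f b) * rho ^+ mdeg b * (v (g c) * rho ^+ mdeg c)).
    by rewrite exprD !exprVn; ring.
  rewrite -!mulrA ler_wpM2r ?mulr_ge0 ?exprn_ge0 //.
  by apply: ler_wiXn2l => //; rewrite ?invr_ge0 // invf_le1 // ler1n.
under eq_bigr do rewrite -mulr_sumr.
rewrite -mulr_sumr -big_distrlr ler_wpM2l ?exprn_ge0 ?invr_ge0 //.
apply: ler_pM; rewrite ?(Hf _ (low_uniq n d)) ?(Hg _ (low_uniq n d)) //;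
  by apply: sumr_ge0 => m _; rewrite mulr_ge0 ?exprn_ge0.
Qed.

Lemma evalM f g : Conv v rho f -> Conv v rho g -> ev (f * g) = ev f * ev g.
Proof.
move=> [B Hf] [B' Hg].
have B0 := bounded_ge0 Hf; have B'0 := bounded_ge0 Hg.
apply: (@eval_eq (B * B') (B * B' + B * B' + B * B')); first exact: boundedM (ltW rho0) Hf Hg.
move=> d.
have -> : ev f * ev g - partial (f * g) d =
   ev f * (ev g - partial g d) + (ev f - partial f d) * partial g d +
   (partial f d * partial g d - partial (f * g) d) by ring.
have p0 : 0 <= 2^-1 ^+ d :> R by rewrite exprn_ge0 // invr_ge0.
apply: le_trans (absD aw _ _) _; rewrite [X in _ <= X]mulrDr; apply: lerD; last exact: partialM.
apply: le_trans (absD aw _ _) _; rewrite [X in _ <= X]mulrDr; apply: lerD; rewrite (absM aw).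
  by rewrite [X in _ <= X]mulrCA; apply: ler_pM; rewrite ?(abs_ge0 aw) ?eval_bound ?eval_close.
by rewrite [X in _ <= X]mulrA; apply: ler_pM; rewrite ?(abs_ge0 aw) ?partial_bound ?eval_close.
Qed.

Lemma partial_mpsC c d : partial (mpsC n c) d.+1 = iota c.
Proof.
rewrite /partial (bigD1_seq (@mnm0 n)) ?mem_low ?mdeg0 ?low_uniq //=.
rewrite /term [mpsC _ _ _]/= eqxx big1 ?addr0.
  rewrite /mon big1 ?mulr1 // => i _; by rewrite mnm0E expr0.
by move=> m /negPf m0; rewrite /= m0 mul0r rmorph0.
Qed.

Lemma evalC c : ev (mpsC n c) = iota c.
Proof.
have [B HB] : Conv v rho (mpsC n c).
  apply: (@bounded_finite _ _ v n av rho 1); first exact: ltW.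
  by move=> m; rewrite lt0n mdeg_eq0 => /negPf /= ->.
apply: (@eval_eq B (v c)) => // d; case: d => [|d].
  by rewrite partial0 subr0 expr0 mul1r w_iota.
by rewrite partial_mpsC subrr (abs0 aw) mulr_ge0 ?(abs_ge0 av) // exprn_ge0 // invr_ge0.
Qed.

Lemma evalX i : ev (mpsX k i) = iota (x i).
Proof.
have [B HB] : Conv v rho (mpsX k i).
  apply: (@bounded_finite _ _ v n av rho 2); first exact: ltW.
  move=> m m2 /=; case: eqP => // mE; move: m2; rewrite mE mdeg1 //.
have p0 d : 0 <= 2^-1 ^+ d :> R by rewrite exprn_ge0 // invr_ge0.
have part d : (1 < d)%N -> partial (mpsX k i) d = iota (x i).
  move=> d1; rewrite /partial (bigD1_seq (mnm1 i)) ?mem_low ?mdeg1 ?low_uniq //=.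
  rewrite /term [mpsX _ _ _]/= eqxx mul1r big1 ?addr0.
    rewrite /mon (bigD1 i) //= mnm1E eqxx expr1 big1 ?mulr1 // => j ji.
    by rewrite mnm1E eq_sym (negPf ji) expr0.
  by move=> m /negPf m0; rewrite /= m0 mul0r rmorph0.
have low1 : partial (mpsX k i) 1 = 0.
  rewrite /partial big_seq big1 // => m; rewrite mem_low ltnS leqn0 => /eqP m0.
  by rewrite /term /=; case: eqP => [mE|_]; [move: m0; rewrite mE mdeg1|rewrite mul0r rmorph0].
apply: (@eval_eq B (v (x i) + v (x i))) => // d; have v0 := abs_ge0 av (x i).
case: d => [|[|d]].
- by rewrite partial0 subr0 expr0 mul1r w_iota lerDl.
- by rewrite low1 subr0 w_iota expr1; lra.
- by rewrite part // subrr (abs0 aw) mulr_ge0 ?addr_ge0.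
Qed.

Lemma eval_vanish B l t f : vanish l f -> bounded_by v rho B f -> 0 <= t -> t <= rho ->
  (forall i, v (x i) <= t) -> w (ev f) <= (t / rho) ^+ l * B.
Proof.
move=> fl Hf t0 tr xt.
apply: (@le_of_le_halves _ _ _ B) => d.
rewrite -(subrK (partial f d) (ev f)) addrC; apply: le_trans (absD aw _ _) _.
apply: lerD; last exact: eval_close.
apply: le_trans (abs_sum aw _ _ _) _.
apply: (@le_trans _ _ (\sum_(m <- low n d) v (f m) * t ^+ mdeg m)).
  by apply: ler_sum => m _; apply: term_bound.
apply: (tail_bound av rho0 t0 tr Hf (low_uniq n d)) => m _.
by case: (leqP l (mdeg m)) => lm; [left|right; apply: fl].
Qed.

End Evaluation.

Section ConvergentSubring.
Variables (R : realType) (k : fieldType) (v : k -> R) (n : nat) (rho : R).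
Hypothesis av : is_absolute_value v.
Hypothesis rho0 : 0 < rho.
Implicit Types f g h : mps n k.

Lemma ConvD f g : Conv v rho f -> Conv v rho g -> Conv v rho (f + g).
Proof. by move=> [B Hf] [B' Hg]; exists (B + B'); apply: boundedD => //; apply: ltW. Qed.
Lemma ConvN f : Conv v rho f -> Conv v rho (- f).
Proof. by move=> [B Hf]; exists B; apply: boundedN. Qed.

Lemma ConvM f g : Conv v rho f -> Conv v rho g -> Conv v rho (f * g).
Proof. by move=> [B Hf] [B' Hg]; exists (B * B'); apply: boundedM => //; apply: ltW. Qed.

Lemma ConvC c : Conv v rho (mpsC n c).
Proof.
apply: (@bounded_finite _ _ v n av rho 1); first exact: ltW.
by move=> m; rewrite lt0n mdeg_eq0 => /negPf /= ->.
Qed.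

Lemma Conv0 : Conv v rho (0 : mps n k).
Proof. by rewrite -(rmorph0 (@mpsC n k)); apply: ConvC. Qed.
Lemma Conv1 : Conv v rho (1 : mps n k).
Proof. by rewrite -(rmorph1 (@mpsC n k)); apply: ConvC. Qed.

Lemma ConvX i : Conv v rho (mpsX k i : mps n k).
Proof.
apply: (@bounded_finite _ _ v n av rho 2); first exact: ltW.
by move=> m m2 /=; case: eqP => // mE; move: m2; rewrite mE mdeg1.
Qed.

Lemma Conv_sum (I : Type) (r : seq I) (P : pred I) (F : I -> mps n k) :
  (forall i, P i -> Conv v rho (F i)) -> Conv v rho (\sum_(i <- r | P i) F i).
Proof. by move=> HF; elim/big_ind: _ => //; [apply: Conv0|apply: ConvD]. Qed.

Lemma Conv_prod (I : Type) (r : seq I) (P : pred I) (F : I -> mps n k) :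
  (forall i, P i -> Conv v rho (F i)) -> Conv v rho (\prod_(i <- r | P i) F i).
Proof. by move=> HF; elim/big_ind: _ => //; [apply: Conv1|apply: ConvM]. Qed.
Lemma Conv_exp f m : Conv v rho f -> Conv v rho (f ^+ m).
Proof. by move=> Hf; elim: m => [|m IH]; rewrite ?expr0 ?exprS; [apply: Conv1|apply: ConvM]. Qed.

Lemma Conv_det p (M : 'M[mps n k]_p) : (forall i j, Conv v rho (M i j)) -> Conv v rho (\det M).
Proof.
move=> HM; apply: Conv_sum => s _; apply: ConvM; last by apply: Conv_prod.
by apply: Conv_exp; apply: ConvN; apply: Conv1.
Qed.

Definition mps_cut d f : mps n k := Mps (fun m => if (mdeg m < d)%N then f m else 0).

Lemma Conv_cut d f : Conv v rho (mps_cut d f).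
Proof.
apply: (@bounded_finite _ _ v n av rho d); first exact: ltW.
by move=> m /=; rewrite ltnNge => ->.
Qed.

Lemma vanish_cut d f : vanish d (f - mps_cut d f).
Proof. by move=> m md; rewrite mpsB_coef /= md subrr. Qed.

End ConvergentSubring.

Lemma convergent_common_radius (R : realType) (k : fieldType) (v : k -> R) (n p : nat)
    (f : 'I_p -> mps n k) : is_absolute_value v -> (forall i, mps_convergent v (f i)) ->
  exists2 rho, 0 < rho & forall i, Conv v rho (f i).
Proof.
move=> av fc.
have /choice[r rP] : forall i, exists r, 0 < r /\ exists B, bounded_by v r B (f i).
  by move=> i; have [r [B [r0 HB]]] := convergent_bounded av (fc i); exists r; split=> //; exists B.
have [rho [rho0 rhor]] : exists rho, 0 < rho /\ forall i, rho <= r i.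
  suff : forall s : seq 'I_p, exists rho, 0 < rho /\ forall i, i \in s -> rho <= r i.
    move=> /(_ (index_enum 'I_p))[rho [rho0 H]]; exists rho; split=> // i.
    by apply: H; rewrite mem_index_enum.
  elim=> [|i s [rho [rho0 H]]]; first by exists 1; split=> //; exact: ltr01.
  exists (Num.min rho (r i)); split; first by rewrite lt_min rho0; case: (rP i).
  move=> j; rewrite inE => /orP[/eqP->|/H]; first by rewrite ge_min lexx orbT.
  by move=> H'; rewrite ge_min H'.
exists rho => // i; have [_ [B HB]] := rP i; exists B.
by apply: bounded_le HB => //; apply: ltW.
Qed.

(** * Inequalities near the origin *)

Section Inequalities.
Variables (R : realType) (k : fieldType) (v : k -> R) (n : nat).
Hypothesis av : is_absolute_value v.
Variables (K : fieldType) (w : K -> R) (iota : {rmorphism k -> K}).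
Hypothesis hK : is_completion v w iota.
Variables (rho : R) (f : 'I_n -> mps n k) (J : mps n k).
Hypothesis rho0 : 0 < rho.
Hypothesis fC : forall i, Conv v rho (f i).
Hypothesis JC : Conv v rho J.
Let I := ideal_gen f.
Let aw : is_absolute_value w. Proof. by case: hK. Qed.
Let w_iota c : w (iota c) = v c. Proof. by case: hK. Qed.
Let inball x := forall i : 'I_n, v (x i) <= rho / 2.
Local Notation ev x g := (mps_eval w iota g x).
Let S x := \sum_(i < n) w (ev x (f i)).

Lemma S_ge0 x : 0 <= S x.
Proof. by apply: sumr_ge0 => i _; apply: abs_ge0. Qed.

Lemma eval_sum x (T : Type) (r : seq T) (P : pred T) (F : T -> mps n k) : inball x ->
  (forall i, P i -> Conv v rho (F i)) ->
  ev x (\sum_(i <- r | P i) F i) = \sum_(i <- r | P i) ev x (F i).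
Proof.
move=> xb HF.
suff [] : ev x (\sum_(i <- r | P i) F i) = \sum_(i <- r | P i) ev x (F i) /\
   Conv v rho (\sum_(i <- r | P i) F i) by [].
elim/big_rec2: _ => [|i y z Pi [IH zC]].
  split; last exact: Conv0.
  by rewrite -(rmorph0 (@mpsC n k)) (evalC av hK rho0 xb) rmorph0.
by split; [rewrite (evalD av hK rho0 xb) ?IH //; apply: HF|apply: ConvD => //; apply: HF].
Qed.

Lemma eval_exp x g m : inball x -> Conv v rho g -> ev x (g ^+ m) = ev x g ^+ m.
Proof.
move=> xb gC; elim: m => [|m IH].
  by rewrite !expr0 -(rmorph1 (@mpsC n k)) (evalC av hK rho0 xb) rmorph1.
by rewrite !exprS (evalM av hK rho0 xb) ?IH //; apply: Conv_exp.
Qed.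

(* Truncate the coefficients in an expression of a as an element of I^l. *)
Lemma ideal_approx l a M : ideal_exp I l a -> exists b C, [/\ Conv v rho b, vanish M (a - b), 0 <= C &
  forall x, inball x -> w (ev x b) <= C * S x ^+ l].
Proof.
elim: l a => [|l IH] a.
  move=> _; have [B HB] := Conv_cut av rho0 M a.
  exists (mps_cut M a), B; split.
  - by exists B.
  - exact: vanish_cut.
  - exact: bounded_ge0 HB.
  - by move=> x xb; rewrite expr0 mulr1; apply: (eval_bound av hK rho0 xb HB).
move=> [s [sP ->]]; elim: s sP => [|u s IHs] sP.
  exists 0, 0; rewrite big_nil subrr; split.
  - exact: Conv0.
  - exact: vanish_zero.
  - by [].
  - move=> x xb; rewrite -(rmorph0 (@mpsC n k)) (evalC av hK rho0 xb) rmorph0.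
    by rewrite (abs0 aw) mul0r.
have sub u' : u' \in s -> u' \in u :: s by rewrite inE => ->; rewrite orbT.
have [b [C [bC bv C0 bx]]] := IHs (fun u' us => sP u' (sub u' us)).
have [[c u1E] u2] := sP u (mem_head _ _).
have [b2 [C2 [b2C b2v C20 b2x]]] := IH _ u2.
have /choice[B HB] : forall i, exists B, bounded_by v rho B (mps_cut M (c i)).
  by move=> i; have [B HB] := Conv_cut av rho0 M (c i); exists B.
have cC i : Conv v rho (mps_cut M (c i)) by exists (B i).
have tC i : Conv v rho (mps_cut M (c i) * f i * b2) by apply: ConvM => //; apply: ConvM.
exists (\sum_i mps_cut M (c i) * f i * b2 + b), (\sum_i B i * C2 + C); split.
- by apply: ConvD => //; apply: Conv_sum.
- rewrite big_cons u1E opprD addrACA; apply: vanishD => //.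
  rewrite mulr_suml -sumrB; apply: vanish_sum => i _.
  have -> : c i * f i * u.2 - mps_cut M (c i) * f i * b2 =
     (f i * u.2) * (c i - mps_cut M (c i)) + (mps_cut M (c i) * f i) * (u.2 - b2) by ring.
  by apply: vanishD; apply: vanishMl => //; apply: vanish_cut.
- by rewrite addr_ge0 // sumr_ge0 // => i _; rewrite mulr_ge0 // (bounded_ge0 (HB i)).
- move=> x xb; rewrite (evalD av hK rho0 xb) //; last exact: Conv_sum.
  apply: le_trans (absD aw _ _) _; rewrite mulrDl; apply: lerD; last exact: bx.
  rewrite eval_sum //; apply: le_trans (abs_sum aw _ _ _) _.
  rewrite mulr_suml; apply: ler_sum => i _.
  rewrite !(evalM av hK rho0 xb) //; last exact: ConvM.
  rewrite !(absM aw) exprS -mulrA -[B i * C2 * _]mulrA.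
  have B0 := bounded_ge0 (HB i).
  apply: ler_pM; rewrite ?mulr_ge0 ?(abs_ge0 aw) //; first exact: (eval_bound av hK rho0 xb (HB i)).
  rewrite mulrCA; apply: ler_pM; rewrite ?(abs_ge0 aw) ?b2x //.
  by rewrite /S (bigD1 i) //= lerDl sumr_ge0 // => j _; apply: abs_ge0.
Qed.

Lemma le_max_norm (x : 'I_n -> k) i : v (x i) <= max_norm v x.
Proof. exact: (@le_bigmax _ _ _ 0 (fun i => v (x i)) i). Qed.

Lemma max_norm_attained (x : 'I_n -> k) (i0 : 'I_n) : exists i, max_norm v x = v (x i).
Proof.
rewrite /max_norm (@bigmax_eq_arg _ _ _ 0 i0 xpredT (fun i => v (x i))) //; first by eexists.
by move=> i _; apply: abs_ge0.
Qed.

(* Truncating the c_i in X_j^N = sum_i c_i f_i costs O(||x||^(N+1)) at x. *)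
Lemma norm_power_le N (i0 : 'I_n) : (forall j, I (mpsX k j ^+ N)) ->
  exists C r, [/\ 0 <= C, 0 < r, r <= rho / 2 &
    forall x, max_norm v x <= r -> max_norm v x ^+ N <= C * S x].
Proof.
move=> XN.
have /choice[c cE] : forall j, exists c : 'I_n -> mps n k, mpsX k j ^+ N = \sum_i c i * f i.
  by move=> j; have [c cE] := XN j; exists c.
have /choice[B HB] : forall ji : 'I_n * 'I_n, exists B, bounded_by v rho B (mps_cut N.+1 (c ji.1 ji.2)).
  by move=> ji; have [B HB] := Conv_cut av rho0 N.+1 (c ji.1 ji.2); exists B.
have cC j i : Conv v rho (mps_cut N.+1 (c j i)) by exists (B (j, i)); apply: (HB (j, i)).
have tC j i : Conv v rho (mps_cut N.+1 (c j i) * f i) by apply: ConvM.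
pose h j := mpsX k j ^+ N - \sum_i mps_cut N.+1 (c j i) * f i.
have hC j : Conv v rho (h j).
  by apply: ConvD => //; [apply: Conv_exp => //; apply: ConvX|apply: ConvN => //; apply: Conv_sum].
have hv j : vanish N.+1 (h j).
  rewrite /h cE -sumrB; apply: vanish_sum => i _; rewrite -mulrBl mulrC.
  by apply: vanishMl; apply: vanish_cut.
have /choice[D HD] : forall j, exists D, bounded_by v rho D (h j) by move=> j; have [D HD] := hC j; exists D.
have B0 ji := bounded_ge0 (HB ji); have D0 j := bounded_ge0 (HD j).
pose E := (\sum_j D j) / rho ^+ N.+1.
have E0 : 0 <= E by rewrite divr_ge0 ?exprn_ge0 ?(ltW rho0) // sumr_ge0.
pose BB := \sum_ji B ji.
have BB0 : 0 <= BB by apply: sumr_ge0.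
(* This radius makes ||x|| E at most 1/2, so half of ||x||^N absorbs the truncation error; hence the
   factor 2. *)
exists (2 * BB), (Num.min (rho / 2) (2 * E + 1)^-1); split.
- by rewrite mulr_ge0.
- rewrite lt_min divr_gt0 //= invr_gt0; lra.
- by rewrite ge_min lexx.
move=> x; rewrite le_min => /andP[xr xE].
set t := max_norm v x in xr xE *.
have xb : inball x by move=> i; apply: le_trans (le_max_norm x i) xr.
have t0 : 0 <= t by apply: le_trans (le_max_norm x i0); apply: abs_ge0.
have trho : t <= rho by apply: le_trans xr _; rewrite ler_pdivrMr // ler_peMr ?ler1n // ltW.
have main j : v (x j) ^+ N <= t * E * t ^+ N + BB * S x.
  have -> : v (x j) ^+ N = w (ev x (mpsX k j ^+ N)).
    by rewrite eval_exp //; [rewrite (evalX av hK rho0 xb) (absX aw) w_iota|apply: ConvX].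
  have -> : mpsX k j ^+ N = h j + \sum_i mps_cut N.+1 (c j i) * f i by rewrite /h subrK.
  rewrite (evalD av hK rho0 xb) //; last exact: Conv_sum.
  apply: le_trans (absD aw _ _) _; apply: lerD.
    apply: le_trans (eval_vanish av hK rho0 xb (hv j) (HD j) t0 trho (le_max_norm x)) _.
    have -> : (t / rho) ^+ N.+1 * D j = t ^+ N.+1 * (D j / rho ^+ N.+1) by rewrite expr_div_n mulrAC mulrA.
    rewrite mulrAC -exprS ler_wpM2l ?exprn_ge0 // ler_wpM2r ?invr_ge0 ?exprn_ge0 ?(ltW rho0) //.
    by rewrite (bigD1 j) //= lerDl sumr_ge0.
  rewrite eval_sum //; apply: le_trans (abs_sum aw _ _ _) _.
  rewrite mulr_sumr; apply: ler_sum => i _.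
  rewrite (evalM av hK rho0 xb) // (absM aw) ler_wpM2r ?(abs_ge0 aw) //.
  apply: le_trans (eval_bound av hK rho0 xb (HB (j, i))) _.
  by rewrite /BB (bigD1 (j, i)) //= lerDl sumr_ge0.
have [j tj] := max_norm_attained x i0.
have := main j; rewrite -tj -/t => H.
have tE : t * E <= 2^-1.
  have E1 : 0 < 2 * E + 1 by lra.
  have : t * (2 * E + 1) <= 1 by rewrite -ler_pdivlMr // div1r.
  by lra.
have : t * E * t ^+ N <= 2^-1 * t ^+ N by rewrite ler_wpM2r // exprn_ge0.
by lra.
Qed.

(** If Y exceeded the bound, then T < Y and each T^i Y^(D+1-i) with i >= 1 would be at most T Y^D;
    dividing the hypothesis by Y^D gives a contradiction. *)
Lemma power_inequality (Y T C' : R) D (C : nat -> R) : 0 <= Y -> 0 <= T -> 0 <= C' -> (forall i, 0 <= C i) ->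
  Y ^+ D.+1 <= \sum_(1 <= i < D.+2) C i * T ^+ i * Y ^+ (D.+1 - i) + C' * T ^+ D.+1 ->
  Y <= (1 + (\sum_(1 <= i < D.+2) C i + C')) * T.
Proof.
move=> Y0 T0 C'0 C0 H; rewrite leNgt; apply/negP => YT.
set s := \sum_(1 <= i < D.+2) C i in YT.
have s0 : 0 <= s by apply: sumr_ge0.
have sT : 0 <= (s + C') * T by rewrite mulr_ge0 ?addr_ge0.
have TY : T < Y by move: YT; rewrite mulrDl mul1r => YT; lra.
have Ypos : 0 < Y by apply: le_lt_trans TY.
have bound i : (1 <= i)%N -> (i <= D.+1)%N -> T ^+ i * Y ^+ (D.+1 - i) <= T * Y ^+ D.
  case: i => // i _; rewrite ltnS => iD; rewrite exprS -mulrA ler_wpM2l // subSS.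
  rewrite -{2}(subnKC iD) exprD ler_wpM2r ?exprn_ge0 // lerXn2r ?nnegrE //.
  exact: ltW.
have : Y ^+ D.+1 <= (s + C') * T * Y ^+ D.
  apply: le_trans H _; rewrite mulrDl mulrDl; apply: lerD.
    rewrite /s !mulr_suml big_nat_cond [X in _ <= X]big_nat_cond; apply: ler_sum => i /andP[/andP[i1 iD] _].
    by rewrite -!mulrA ler_wpM2l // bound.
  by rewrite -mulrA ler_wpM2l //; have := bound D.+1 isT (leqnn _); rewrite subnn expr0 mulr1.
rewrite exprS ler_pM2r ?exprn_gt0 //; move: YT; rewrite mulrDl mul1r; lra.
Qed.

Lemma jacobian_inequality N (i0 : 'I_n) p q D (a : nat -> mps n k) :
  (forall j, I (mpsX k j ^+ N)) ->
  (forall i, (i <= D.+1)%N -> ideal_exp I (p * i) (a i)) ->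
  (J ^+ q) ^+ D.+1 + \sum_(1 <= i < D.+2) a i * (J ^+ q) ^+ (D.+1 - i) = 0 ->
  exists r C, [/\ 0 < r, r <= rho / 2, 0 < C &
    forall x, max_norm v x <= r -> w (ev x J) ^+ q <= C * S x ^+ p].
Proof.
move=> XN aI rel.
have [C0 [r [C00 r0 rr norm_le]]] := norm_power_le i0 XN.
(* Truncation at order M leaves an error O(||x||^M), which ||x||^N <= C0 S turns into a multiple of
   (S^p)^(D+1), as [power_inequality] requires. *)
pose M := (N * (p * D.+1))%N.
have /choice[b bP] : forall i, exists b, exists C, (i <= D.+1)%N -> [/\ Conv v rho b, vanish M (a i - b), 0 <= C &
    forall x, inball x -> w (ev x b) <= C * S x ^+ (p * i)].
  move=> i; have [iD|iD] := boolP (i <= D.+1)%N; last by exists 0, 0.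
  by have [b [C H]] := ideal_approx M (aI i iD); exists b, C.
have /choice[C CP] := bP.
have YC : Conv v rho (J ^+ q) by apply: Conv_exp.
have Yx m : Conv v rho ((J ^+ q) ^+ m) by apply: Conv_exp.
pose h := (J ^+ q) ^+ D.+1 + \sum_(1 <= i < D.+2) b i * (J ^+ q) ^+ (D.+1 - i).
have termC i : (i <= D.+1)%N -> Conv v rho (b i * (J ^+ q) ^+ (D.+1 - i)).
  by move=> iD; apply: ConvM => //; case: (CP i iD).
have sumC : Conv v rho (\sum_(1 <= i < D.+2) b i * (J ^+ q) ^+ (D.+1 - i)).
  by rewrite big_nat_cond; apply: Conv_sum => // i /andP[/andP[_ iD] _]; apply: termC.
have [B HB] : Conv v rho h by apply: ConvD.
have hv : vanish M h.
  have -> : h = - \sum_(1 <= i < D.+2) (a i - b i) * (J ^+ q) ^+ (D.+1 - i).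
    rewrite -[LHS]subr0 -[X in _ - X]rel /h opprD addrACA subrr add0r -sumrB -sumrN.
    by apply: eq_bigr => i _; rewrite -mulrBl -mulNr opprB.
  rewrite big_nat_cond; apply: vanishN; apply: vanish_sum => i /andP[/andP[_ iD] _].
  by rewrite mulrC; apply: vanishMl; case: (CP i iD).
have B0 := bounded_ge0 HB.
pose C' := B / rho ^+ M * C0 ^+ (p * D.+1).
have C'0 : 0 <= C' by rewrite mulr_ge0 ?exprn_ge0 // divr_ge0 // exprn_ge0 // ltW.
pose C1 i := if (i <= D.+1)%N then C i else 0.
have C10 i : 0 <= C1 i by rewrite /C1; case: ifP => // iD; case: (CP i iD).
exists r, (1 + (\sum_(1 <= i < D.+2) C1 i + C')); split=> //.
  by apply: ltr_pwDl => //; rewrite addr_ge0 // sumr_ge0.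
move=> x xr; set t := max_norm v x in xr *.
have xb : inball x by move=> i; apply: le_trans (le_max_norm x i) (le_trans xr rr).
have t0 : 0 <= t by apply: le_trans (le_max_norm x i0); apply: abs_ge0.
have trho : t <= rho.
  by apply: le_trans xr (le_trans rr _); rewrite ler_pdivrMr // ler_peMr ?ler1n // ltW.
have S0 := S_ge0 x.
have w0 := abs_ge0 aw.
apply: power_inequality => //; rewrite ?exprn_ge0 //.
have evJ m : ev x ((J ^+ q) ^+ m) = (ev x J ^+ q) ^+ m by rewrite !eval_exp.
have JE : (J ^+ q) ^+ D.+1 = h - \sum_(1 <= i < D.+2) b i * (J ^+ q) ^+ (D.+1 - i) by rewrite /h addrK.
have -> : (w (ev x J) ^+ q) ^+ D.+1 = w (ev x ((J ^+ q) ^+ D.+1)) by rewrite evJ !(absX aw).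
rewrite {1}JE (evalD av hK rho0 xb); [|by exists B|exact: ConvN].
rewrite (evalN av hK rho0 xb) // addrC; apply: le_trans (absD aw _ _) _; apply: lerD.
  rewrite (absN aw) big_nat_cond [X in _ <= X]big_nat_cond.
  rewrite eval_sum //; last by move=> i /andP[/andP[_ iD] _]; apply: termC.
  apply: le_trans (abs_sum aw _ _ _) _.
  apply: ler_sum => i /andP[/andP[_ iD] _]; rewrite ltnS in iD.
  have [bC _ Ci bx] := CP i iD.
  rewrite (evalM av hK rho0 xb) // (absM aw) evJ !(absX aw) ler_wpM2r ?exprn_ge0 //.
  by rewrite /C1 iD -exprM; apply: bx.
apply: le_trans (eval_vanish av hK rho0 xb hv HB t0 trho (le_max_norm x)) _.
have -> : (t / rho) ^+ M * B = B / rho ^+ M * t ^+ M by rewrite expr_div_n mulrC [t ^+ M * _]mulrC mulrA.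
rewrite /C' -[X in _ <= X]mulrA ler_wpM2l ?divr_ge0 ?exprn_ge0 ?(ltW rho0) //.
rewrite /M exprM -[(S x ^+ p) ^+ _]exprM -exprMn lerXn2r ?nnegrE ?exprn_ge0 ?mulr_ge0 //.
exact: norm_le.
Qed.

End Inequalities.

Lemma radical_common_exponent (A : comNzRingType) (I : set A) m (g : 'I_m -> A) : is_ideal I ->
  (forall j, radical I (g j)) -> exists2 N, (0 < N)%N & forall j, I (g j ^+ N).
Proof.
move=> [_ _ IM] /choice[e eP]; exists (\max_j e j).+1 => // j.
have le_e : (e j <= (\max_j e j).+1)%N by apply: leqW; apply: leq_bigmax.
by rewrite -(subnK le_e) exprD; apply: IM.
Qed.

Lemma le_powR_root (R : realType) (a b C : R) p q : 0 <= a -> 0 <= b -> 0 <= C -> (0 < q)%N ->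
  a ^+ q <= C * b ^+ p -> a <= C `^ q%:R^-1 * b `^ (p%:R / q%:R).
Proof.
move=> a0 b0 C0 q0 H.
have qn0 : q%:R != 0 :> R by rewrite pnatr_eq0 -lt0n.
have qV0 : 0 <= q%:R^-1 :> R by rewrite invr_ge0.
have := ge0_ler_powR qV0 _ _ H; rewrite !nnegrE exprn_ge0 // mulr_ge0 ?exprn_ge0 //.
rewrite powRM ?exprn_ge0 // -!powR_mulrn // -!powRrM divff // powRr1 //.
exact.
Qed.

(** * Exponents and bounds from the rank at the origin *)

Section Jacobian.
Variables (k : fieldType) (n : nat) (f : 'I_n -> mps n k).
Hypothesis char0 : [pchar k] =i pred0.
Hypothesis f0 : forall i, mps_at0 (f i) = 0.
Hypothesis f_primary : is_primary_for (ideal_gen (@mpsX n k)) (ideal_gen f).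
Let m := \rank (map_mx (@mps_at0 n k) (jacobian_mx f)).

Lemma primary_exponent : exists2 N, (0 < N)%N & forall j, ideal_gen f (mpsX k j ^+ N).
Proof.
have [I_ideal _ _ radI] := f_primary; apply: radical_common_exponent => // j.
rewrite radI; exists (fun i => (i == j)%:R).
by rewrite (bigD1 j) //= eqxx mul1r big1 ?addr0 // => i /negPf ->; rewrite mul0r.
Qed.

(** The cofactors have order at least n - m - 1 = 1, which is c = 0; then p = q = 1 meets p N <= q
    (N + c) whatever N is. *)
Lemma jacobian_relation1 : (n - m = 2)%N -> exists D s, power_relation f 1 1 D s.
Proof.
move=> nm; have [N N0 XN] := primary_exponent.
have n0 : (0 < n)%N by lia.
apply: (@exists_power_relation _ _ _ char0 _ N 0 1 1 (Ordinal n0)) => //.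
- by move=> i; apply: vanish_at0.
- by move=> i j; have := @adj_vanish _ _ (jacobian_mx f) i j; rewrite -/m nm.
- by rewrite !mul1n addn0.
Qed.

(* X_j^N in I forces v(m) >= v(I)/N, which is where the exponent (N + 1) / N comes from. *)
Lemma jacobian_relation_gt1 : (3 <= n - m)%N -> exists p q D s,
  [/\ (0 < q)%N, (q < p)%N & power_relation f p q D s].
Proof.
move=> nm; have [N N0 XN] := primary_exponent.
have n0 : (0 < n)%N by lia.
have [||||D [s rel]] := @exists_power_relation _ _ _ char0 _ N 1 N.+1 N (Ordinal n0) N0 XN.
- by move=> i; apply: vanish_at0.
- by move=> i j; apply: (vanishW _ (@adj_vanish _ _ (jacobian_mx f) i j)); rewrite -/m; lia.
- by [].
- by rewrite addn1 mulnC.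
by exists N.+1, N, D, s.
Qed.

Variables (R : realType) (v : k -> R).
Hypothesis av : is_absolute_value v.
Hypothesis fC : forall i, mps_convergent v (f i).
Variables (K : fieldType) (w : K -> R) (iota : {rmorphism k -> K}).
Hypothesis hK : is_completion v w iota.

Lemma jacobian_bound p q D s : (0 < n)%N -> power_relation f p q D s ->
  exists r C, [/\ 0 < r, 0 < C & forall x, max_norm v x <= r ->
    [/\ forall i, mps_cvg_at w iota (f i) x, mps_cvg_at w iota (jacobian f) x &
      w (mps_eval w iota (jacobian f) x) ^+ q <= C * (\sum_(i < n) w (mps_eval w iota (f i) x)) ^+ p]].
Proof.
move=> n0 [sv rel]; have [N N0 XN] := primary_exponent.
have f1 i : vanish 1 (f i) by apply: vanish_at0.
have [rho rho0 fCv] := convergent_common_radius av fC.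
(* J is built from derivatives, for which [bounded_deriv] gives convergence at half the radius. *)
have rho20 : 0 < rho / 2 by rewrite divr_gt0.
have fCv2 i : Conv v (rho / 2) (f i).
  have [B HB] := fCv i; exists B; apply: bounded_le HB => //; first exact: ltW.
  by rewrite ler_pdivrMr // ler_peMr ?ler1n // ltW.
have JCv : Conv v (rho / 2) (jacobian f).
  apply: Conv_det => // i j; rewrite mxE; have [B HB] := fCv i.
  by eexists; apply: bounded_deriv HB.
have aI i : (i <= D.+1)%N -> ideal_exp (ideal_gen f) (p * i) (subst f (s i)).
  by move=> iD; apply: subst_ideal_exp => //; apply: sv.
have [r [C [r0 rr C0 H]]] := jacobian_inequality av hK rho20 fCv2 JCv (Ordinal n0) XN aI rel.
exists r, C; split=> // x xr.
have xb i : v (x i) <= rho / 2 / 2 by apply: le_trans (le_max_norm v x i) (le_trans xr rr).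
split; last exact: H.
- by move=> i; have [B HB] := fCv2 i; apply: (eval_cvg av hK rho20 xb HB).
- by have [B HB] := JCv; apply: (eval_cvg av hK rho20 xb HB).
Qed.

End Jacobian.

Theorem mainTheorem2 (R : realType) (k : fieldType) (n : nat)
    (f : 'I_n -> mps n k)
    (char0 : [pchar k] =i pred0)
    (f0 : forall i, mps_at0 (f i) = 0)
    (f_primary : is_primary_for (ideal_gen (@mpsX n k)) (ideal_gen f)) :
  let I := ideal_gen f in
  let J := jacobian f in
  let m := \rank (map_mx (@mps_at0 n k) (jacobian_mx f)) in
  [/\ ((n - m)%N = 2%N -> integral_closure I J),
      ((3 <= n - m)%N ->
         exists p q : nat,
           let theta : rat := p%:R / q%:R in
           [/\ (0 < q)%N, 1 < theta,
               rat_integral_closure R I theta J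
             & integral_closure (ideal_exp I p) (J ^+ q)])
    & forall absk : k -> R,
        is_absolute_value absk -> nontrivial_absolute_value absk ->
        (forall i, mps_convergent absk (f i)) ->
        forall (K : fieldType) (absK : K -> R) (iota : {rmorphism k -> K}),
        is_completion absk absK iota ->
        ((n - m)%N = 2%N ->
           exists r C : R, [/\ 0 < r, 0 < C
             & forall x : 'I_n -> k, max_norm absk x <= r ->
                 [/\ forall i, mps_cvg_at absK iota (f i) x,
                     mps_cvg_at absK iota J x
                   & absK (mps_eval absK iota J x)
                     <= C * (\sum_(i < n) absK (mps_eval absK iota (f i) x))]])
        /\
        ((3 <= n - m)%N ->
           exists (theta : rat) (r C : R), [/\ 1 < theta, 0 < r, 0 < C
             & forall x : 'I_n -> k, max_norm absk x <= r ->
                 [/\ forall i, mps_cvg_at absK iota (f i) x,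
                     mps_cvg_at absK iota J x
                   & absK (mps_eval absK iota J x)
                     <= C * powR (\sum_(i < n) absK (mps_eval absK iota (f i) x))
                                 (ratr theta)]])].
Proof.
move=> I J m.
have f1 i : vanish 1 (f i) by apply: vanish_at0.
have theta_gt1 p q : (0 < q)%N -> (q < p)%N -> 1 < p%:R / q%:R :> rat.
  by move=> q0 qp; rewrite ltr_pdivlMr ?ltr0n // mul1r ltr_nat.
split.
- by move=> /(jacobian_relation1 char0 f0 f_primary)[D [s rel]]; apply: integral_closure1 rel.
- move=> /(jacobian_relation_gt1 char0 f0 f_primary)[p [q [D [s [q0 qp rel]]]]].
  exists p, q; split=> //; first exact: theta_gt1.
    exact: rat_integral_closure_power rel.
  exact: integral_closure_exp rel.
move=> v av _ fC K w iota hK; have [aw _ _ _] := hK.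
split=> nm; have n0 : (0 < n)%N by lia.
  have [D [s rel]] := jacobian_relation1 char0 f0 f_primary nm.
  exact: jacobian_bound rel.
have [p [q [D [s [q0 qp rel]]]]] := jacobian_relation_gt1 char0 f0 f_primary nm.
have [r [C [r0 C0 H]]] := jacobian_bound f0 f_primary av fC hK n0 rel.
(* The constant is the q-th root of [C], because [bJ] bounds the q-th power of the absolute value of
   J(x). *)
exists (p%:R / q%:R), r, (C `^ q%:R^-1); split=> //; first exact: theta_gt1.
  exact: powR_gt0.
move=> x /H[cf cJ bJ]; split=> //.
rewrite (fmorph_div (@ratr R)) /= !ratr_nat; apply: le_powR_root => //.
- exact: abs_ge0.
- by apply: sumr_ge0 => i _; apply: abs_ge0.
- exact: ltW.
Qed.
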